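(* Let $u_0\in L^{2,\infty}_\sigma(\mathbb{R}^2_+)$ satisfy $\omega_0=-\nabla^\perp\cdot u_0\in M(\overline{\mathbb{R}^2_+})$. Then for all $t>0$, $$T(t)\omega_0(x)=\int_{\mathbb{R}^2_+}W(x,y,t)\,\omega_0(dy),$$ where $$W(x,y,t)=\Gamma(x-y,t)+\Gamma(x-y^*,t)+4\int_0^{y_2}\int_{\mathbb{R}}\Gamma(x-z^*,t)\,\partial_{z_1}^2E(z-y)\,dz_1dz_2-2\Gamma_0(x_2,t)\int_{\mathbb{R}}\Gamma_0(x_1-z_1,t)P_{y_2}(z_1-y_1)\,dz_1,$$ and $$T(t)\omega_0=e^{t\Delta_N}\omega_0-(e^{t\Delta_N}-e^{t\Delta_D})(H\partial_2-\partial_1)\partial_1(-\Delta_D)^{-1}\omega_0-2\Gamma_0(x_2,t)\,e^{t\partial_1^2}u_0^1(\cdot,0).$$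
   Context: $\mathbb{R}^2_+=\{x_2>0\}$; $M(\overline{\mathbb{R}^2_+})$ is the space of finite real regular Borel measures on $\overline{\mathbb{R}^2_+}$; $L^{2,\infty}_\sigma=\{f\in L^{2,\infty}(\mathbb{R}^2_+;\mathbb{R}^2):\mathrm{div}f=0,\ f^2(x_1,0)=0\}$ ($L^{2,\infty}$ the Lorentz space). $\nabla^\perp=(\partial_2,-\partial_1)$, $\nabla^\perp\cdot u=\partial_2u^1-\partial_1u^2$, $y^*=(y_1,-y_2)$, $E(x)=-\frac1{2\pi}\log|x|$, $D(x,y)=E(x-y)-E(x-y^* )$, $K\mu(x)=\int_{\mathbb{R}^2_+}\nabla^\perp_xD(x,y)\mu(dy)$, $(-\Delta_D)^{-1}\mu(x)=\int_{\mathbb{R}^2_+}D(x,y)\mu(dy)$. Here $u_0=K\omega_0$ and $u_0^1(x_1,0)=\frac1\pi\int_{\mathbb{R}^2_+}\frac{y_2}{|x_1-y_1|^2+y_2^2}\omega_0(dy)$. $\Gamma(x,t)=\frac1{4\pi t}e^{-|x|^2/4t}$ on $\mathbb{R}^2$, $\Gamma_0(r,t)=\frac1{(4\pi t)^{1/2}}e^{-r^2/4t}$ on $\mathbb{R}$, $P_s(x_1)=\frac{s}{\pi(x_1^2+s^2)}$. For functions (or measures) $\varphi$, $e^{t\Delta_N}\varphi(x)=\int_{\mathbb{R}^2_+}(\Gamma(x-y,t)+\Gamma(x-y^*,t))\varphi(y)dy$, $e^{t\Delta_D}\varphi(x)=\int_{\mathbb{R}^2_+}(\Gamma(x-y,t)-\Gamma(x-y^*,t))\varphi(y)dy$,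 $e^{t\partial_1^2}g(x_1)=\int_{\mathbb{R}}\Gamma_0(x_1-y_1,t)g(y_1)dy_1$. $H$ is the Hilbert transform in the variable $x_1$: $\widehat{Hg}(\xi_1)=-i\frac{\xi_1}{|\xi_1|}\hat g(\xi_1)$ with $\hat g(\xi_1)=\int e^{-ix_1\xi_1}g(x_1)dx_1$. $S(t)$ is the Stokes semigroup on $\mathbb{R}^2_+$ with Dirichlet boundary condition, $S(t)u_0=\int_{\mathbb{R}^2_+}G(x,z,t)u_0(z)dz$ with $$G_{ij}(x,z,t)=(\Gamma(x-z,t)-\Gamma(x-z^*,t))\delta_{ij}-4(1-\delta_{j2})\partial_{x_j}\int_0^{x_2}\int_{\mathbb{R}}\partial_{x_i}E(x-w)\Gamma(w-z^*,t)\,dw_1dw_2,$$ and $T(t)=-\nabla^\perp\cdot S(t)K$. Interpretation: integrals of the form $\int_0^{y_2}\int_{\mathbb{R}}(\cdots)dz_1dz_2$ containing $\partial_{z_1}^2E(z-y)$ are iterated, with the $z_1$-integral done first. The term $(e^{t\Delta_N}-e^{t\Delta_D})(H\partial_2-\partial_1)\partial_1(-\Delta_D)^{-1}\omega_0$ denotes the integral against $\omega_0(dy)$ of $(e^{t\Delta_N}-e^{t\Delta_D})$ applied in $z$ to $(H\partial_{z_2}-\partial_{z_1})\partial_{z_1}D(z,y)$, i.e. of $2\int_{\mathbb{R}^2_+}\Gamma(x-z^*,t)(H\partial_{z_2}-\partial_{z_1})\partial_{z_1}D(z,y)\,dz$ (again $z_1$-integral first, $H$ acting in $z_1$ for $z_2\neq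 y_2$). *)

(* Defs.v *)
From HB Require Import structures.
From mathcomp Require Import all_boot all_order all_algebra.
From mathcomp Require Import complex.
From mathcomp Require Import all_classical all_reals all_analysis.
Set Implicit Arguments.
Unset Strict Implicit.
Unset Printing Implicit Defensive.
Import Order.TTheory GRing.Theory Num.Theory.
Import numFieldNormedType.Exports.

Local Open Scope classical_set_scope.
Local Open Scope ring_scope.

(* Points and vectors of the plane are pairs (x_1, x_2).  The library norm on
   [R * R] is the max norm, so the Euclidean norm is defined here; the product
   topology and the product sigma-algebra are the usual topology and Borel
   sigma-algebra of the plane. *)
Section Plane.
Context {R : realType}.
Implicit Types (x y : R * R).

Definition half_plane : set (R * R) := [set x | 0 < x.2].
Definition closed_half_plane : set (R * R) := [set x | 0 <= x.2].

Definition eucl x : R := Num.sqrt (x.1 ^+ 2 + x.2 ^+ 2).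
Definition star y : R * R := (y.1, - y.2).

(* The indices 1, 2 of the coordinates are 0, 1 : 'I_2. *)
Definition comp2 (i : 'I_2) x : R := if i == 0 then x.1 else x.2.
Definition evec (i : 'I_2) : R * R := ((i == 0)%:R, (i == 1)%:R).
Definition partial (i : 'I_2) (f : R * R -> R) x : R := 'D_(evec i) f x.

Definition grad_perp (f : R * R -> R) x : R * R :=
  (partial 1 f x, - partial 0 f x).
Definition div_perp (u : R * R -> R * R) x : R :=
  partial 1 (fst \o u) x - partial 0 (snd \o u) x.

End Plane.

Section SignedMeasures.
Context {d : measure_display} {T : measurableType d} {R : realType}.
Variable nu : {charge set T -> \bar R}.

Definition hahn_pos : set T := sval (cid (Hahn_decomposition nu)).
Definition hahn_neg : set T := sval (cid (svalP (cid (Hahn_decomposition nu)))).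

Lemma hahnP : hahn_decomposition nu hahn_pos hahn_neg.
Proof. exact: svalP (cid (svalP (cid (Hahn_decomposition nu)))). Qed.

(* The positive and negative variations do not depend on the chosen Hahn
   decomposition. *)
Definition charge_integrable (D : set T) (f : T -> R) : Prop :=
  (jordan_pos hahnP).-integrable D (EFin \o f) /\
  (jordan_neg hahnP).-integrable D (EFin \o f).

Definition charge_int (D : set T) (f : T -> R) : R :=
  \int[jordan_pos hahnP]_(x in D) f x - \int[jordan_neg hahnP]_(x in D) f x.

End SignedMeasures.

Section FunctionSpaces.
Context {R : realType}.
Local Notation leb2 := (@lebesgue_measure R \x @lebesgue_measure R)%E.

Fixpoint Ck (k : nat) (f : R * R -> R) : Prop :=
  continuous f /\
  if k is k'.+1 then
    forall i : 'I_2, (forall x, derivable f x (evec i)) /\ Ck k' (partial i f)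
  else True.

(* C_c^oo(U), extended by zero to the plane *)
Definition test_function (U : set (R * R)) (phi : R * R -> R) : Prop :=
  [/\ forall k, Ck k phi,
      compact (closure [set x | phi x != 0]) &
      closure [set x | phi x != 0] `<=` U].

(* the Lorentz space L^{2,oo} (weak L^2) of the half plane:
   sup_{s > 0} s |{|f| > s}|^{1/2} < oo *)
Definition lorentz2oo (f : R * R -> R * R) : Prop :=
  [/\ measurable_fun half_plane (fst \o f), measurable_fun half_plane (snd \o f) &
      exists C : R, forall s : R, 0 < s ->
        ((s ^+ 2)%:E * leb2 (half_plane `&` [set x | (s < eucl (f x))%R]) <= C%:E)%E].

Definition pair_grad (f : R * R -> R * R) (phi : R * R -> R) : R :=
  \int[leb2]_(x in half_plane)
    ((f x).1 * partial 0 phi x + (f x).2 * partial 1 phi x).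

(* div f = 0 in the sense of distributions in the open half plane.  The normal
   trace f^2(x_1, 0) of such a field is the functional
   phi |-> - \int f . grad phi for phi in C_c^oo(R^2), by the Green formula. *)
Definition lorentz2oo_sigma (f : R * R -> R * R) : Prop :=
  [/\ lorentz2oo f,
      forall phi, test_function half_plane phi -> pair_grad f phi = 0 &
      forall phi, test_function setT phi -> pair_grad f phi = 0].

(* M(closed half plane): finite regular signed Borel measures, represented as
   charges of the plane that are carried by the closed half plane; finiteness
   is part of the library notion of charge. *)
Definition closed_half_plane_measure
    (nu : {charge set (R * R)%type -> \bar R}) : Prop :=
  (forall A : set (R * R), measurable A -> A `<=` ~` closed_half_plane ->
     nu A = 0%E) /\
  (forall A : set (R * R), measurable A -> forall e : R, 0 < e ->
     exists F U : set (R * R),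
       [/\ compact F, open U, F `<=` A, A `<=` U &
           (charge_variation (hahnP nu) (U `\` F) < e%:E)%E]).

(* omega = - nabla^perp . u in the sense of distributions in the open half
   plane *)
Definition is_vorticity (u : R * R -> R * R)
    (omega : {charge set (R * R)%type -> \bar R}) : Prop :=
  forall phi, test_function half_plane phi ->
    charge_int omega half_plane phi =
    \int[leb2]_(x in half_plane)
      ((u x).1 * partial 1 phi x - (u x).2 * partial 0 phi x).

End FunctionSpaces.

Section Kernels.
Context {R : realType}.
Local Notation leb := (@lebesgue_measure R).
Local Notation leb2 := (leb \x leb)%E.
Implicit Types (x y z w : R * R) (t : R) (omega : {charge set (R * R)%type -> \bar R}).

Definition Gamma x t : R := expR (- (eucl x ^+ 2 / (4 * t))) / (4 * pi * t).
Definition Gamma0 (r t : R) : R := expR (- (r ^+ 2 / (4 * t))) / Num.sqrt (4 * pi * t).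
Definition poisson (s r : R) : R := s / (pi * (r ^+ 2 + s ^+ 2)).

Definition Efun x : R := - (ln (eucl x) / (2 * pi)).
Definition Dfun x y : R := Efun (x - y) - Efun (x - star y).

(* The integral over y may diverge for x in a Lebesgue-null set, where the
   value is irrelevant; the same applies to [u1_trace] below. *)
Definition biot_savart omega x : R * R :=
  (charge_int omega half_plane (fun y => (grad_perp (Dfun ^~ y) x).1),
   charge_int omega half_plane (fun y => (grad_perp (Dfun ^~ y) x).2)).

Definition u1_trace omega (r : R) : R :=
  charge_int omega half_plane (fun y => y.2 / ((r - y.1) ^+ 2 + y.2 ^+ 2)) / pi.

Definition stokes_ker (i j : 'I_2) x z t : R :=
  (Gamma (x - z) t - Gamma (x - star z) t) * (i == j)%:R
  - 4 * (1 - (j == 1)%:R) *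
    partial j (fun x' =>
      \int[leb]_(w2 in `[0, x'.2]) \int[leb]_w1
        (partial i Efun (x' - (w1, w2)) * Gamma ((w1, w2) - star z) t)) x.

Definition stokes_comp t (u : R * R -> R * R) (i : 'I_2) x : R :=
  \int[leb2]_(z in half_plane) \sum_(j < 2) stokes_ker i j x z t * comp2 j (u z).

Definition stokes t (u : R * R -> R * R) x : R * R :=
  (stokes_comp t u 0 x, stokes_comp t u 1 x).

Definition T_op t omega x : R := - div_perp (stokes t (biot_savart omega)) x.

Definition heatN_ker x y t : R := Gamma (x - y) t + Gamma (x - star y) t.
Definition heatD_ker x y t : R := Gamma (x - y) t - Gamma (x - star y) t.

Definition heatN_meas t omega x : R :=
  charge_int omega half_plane (fun y => heatN_ker x y t).

(* (e^{t Delta_N} - e^{t Delta_D}) f as an iterated integral, z_1 first *)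
Definition heatNmD t (f : R * R -> R) x : R :=
  \int[leb]_(z2 in `]0, +oo[) \int[leb]_z1
    ((heatN_ker x (z1, z2) t - heatD_ker x (z1, z2) t) * f (z1, z2)).

Definition heat1 t (g : R -> R) (r : R) : R := \int[leb]_s (Gamma0 (r - s) t * g s).

Definition Wker x y t : R :=
  Gamma (x - y) t + Gamma (x - star y) t
  + 4 * \int[leb]_(z2 in `[0, y.2]) \int[leb]_z1
      (Gamma (x - star (z1, z2)) t * partial 0 (partial 0 Efun) ((z1, z2) - y))
  - 2 * Gamma0 x.2 t * \int[leb]_z1 (Gamma0 (x.1 - z1) t * poisson y.2 (z1 - y.1)).

End Kernels.

(* The Hilbert transform of a real function g, as the Fourier multiplier with
   symbol - i xi / |xi|; the inverse transform of a Hermitian-symmetric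
   function is real, hence the final real part. *)
Section Hilbert.
Context {R : realType}.
Local Notation leb := (@lebesgue_measure R).
Local Open Scope complex_scope.

Definition cexp (a : R) : R[i] := cos a +i* sin a.

Definition cint (f : R -> R[i]) : R[i] :=
  (\int[leb]_s complex.Re (f s)) +i* (\int[leb]_s complex.Im (f s)).

Definition fourier (g : R -> R[i]) (xi : R) : R[i] :=
  cint (fun s => cexp (- (s * xi)) * g s).
Definition fourier_inv (h : R -> R[i]) (s : R) : R[i] :=
  ((2 * pi)^-1)%:C * cint (fun xi => cexp (s * xi) * h xi).

Definition hilbert (g : R -> R) (s : R) : R :=
  complex.Re (fourier_inv
    (fun xi => (0 +i* (- (xi / `|xi|))) * fourier (fun s' => (g s')%:C) xi) s).

End Hilbert.

Section Remainder.
Context {R : realType}.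
Implicit Types (x y z : R * R) (t : R) (omega : {charge set (R * R)%type -> \bar R}).

Definition hilbert1 (f : R * R -> R) z : R := hilbert (fun s => f (s, z.2)) z.1.

(* (H d_{z_2} - d_{z_1}) d_{z_1} D(z, y) *)
Definition HD_ker z y : R :=
  hilbert1 (partial 1 (partial 0 (Dfun ^~ y))) z
  - partial 0 (partial 0 (Dfun ^~ y)) z.

Definition remainder_ker t x y : R := heatNmD t (HD_ker ^~ y) x.

(* (e^{t Delta_N} - e^{t Delta_D}) (H d_2 - d_1) d_1 (- Delta_D)^{-1} omega *)
Definition remainder t omega x : R :=
  charge_int omega half_plane (remainder_ker t x).

End Remainder.

(* Main.v *)
(* Everything is expressed through the one-dimensional integrals
     int_0^oo xi^k e^(- a xi - t xi^2) cos (r xi) dxi   (or sin),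
   on which convolution in the first variable with the heat kernel, the Poisson
   kernel or their derivatives acts by multiplying the integrands; in particular
   the Stokes kernel G and its derivatives become explicit.  They are bounded by
   C / ((1 + z_1^2) (1 + z_2^2)), and |grad_perp D(z, y)| <= C / |z - y|, so that
   the products are integrable in z uniformly in y.  Hence one may differentiate
   under the integral sign and apply Fubini: T(t) omega (x) is the integral
   against omega(dy) of
     int (d_1 G_21 u^1 + d_1 G_22 u^2 - d_2 G_11 u^1) dz,  u = grad_perp D(., y).
   Integrating in z_1 first, the fibre at height z_2 is an exact derivative in
   z_2, up to a term supported in z_2 < y_2 which is the area integral of W.  The
   jump of the primitive at z_2 = y_2 gives the Neumann heat kernel and its value
   at z_2 = 0 the boundary term.
   For the second formula, the Hilbert transform of d_2 d_1 D(., y) is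
   sgn(z_2 - y_2) d_1^2 E(z - y) - d_1^2 E(z - y^* ), so that (H d_2 - d_1) d_1 D
   vanishes above height y_2 and equals - 2 d_1^2 E(z - y) below; the remainder
   kernel is then the same area integral. *)
Require Import Defs.
From HB Require Import structures.
From mathcomp Require Import all_boot all_order all_algebra.
From mathcomp Require Import all_classical all_reals all_analysis.
From mathcomp Require Import measurable_realfun.
From mathcomp Require Import ring lra.
Set Implicit Arguments.
Unset Strict Implicit.
Unset Printing Implicit Defensive.
Import Order.TTheory GRing.Theory Num.Theory.
Import numFieldNormedType.Exports.
Local Open Scope classical_set_scope.
Local Open Scope ring_scope.

(** * Measurability of elementary functions *)

Section Measurability.
Context {R : realType}.

(** Two facts keep the computation explicit. In d_1 G_21 - d_2 G_11 the non-local terms [Mc t 2] of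
    the Stokes kernel cancel, so every fibre integral is a convolution with a known multiplier. And
    1/|z - y| is, up to the factor sqrt pi, the integral of exp(- |z - y|^2 v^2) over v, so that its
    integral against a product weight factors into one-dimensional Gaussian integrals, bounded
    uniformly in y. The decay 1/(1 + r^2) takes two integrations by parts, and for [sinI] without a
    power of xi the first already leaves a boundary term. The estimates therefore concern exponents
    k >= 1, the only ones in the non-local parts of the kernels. Derivatives and integrals are total
    functions with default value 0: the diagonal z = y, the height z_2 = y_2 and the points where a
    Biot-Savart integral diverges have to be accounted for in every pointwise identity. Estimates
    are made for finite positive measures and applied to both variations of omega. *)

Lemma measurable_invr : measurable_fun [set: R] (@GRing.inv R).
Proof.
(* Inversion is discontinuous at 0, so it is written by cases through [expR] and [ln]; the value at
   0 is the convention 0^-1 = 0. *)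
have -> : @GRing.inv R = fun x => if x == 0 then 0 else
    if 0 < x then expR (- ln x) else - expR (- ln (- x)).
  apply/funext => x; case: eqVneq => [->|x0]; first by rewrite invr0.
  case: ltP => [xp|xn]; first by rewrite expRN lnK.
  rewrite expRN lnK ?invrN ?opprK//.
  by rewrite posrE oppr_gt0 lt_neqAle x0.
apply: measurable_fun_ifT => //.
  by apply: measurable_fun_eqr => //; exact: measurable_cst.
apply: measurable_fun_ifT => //.
  exact: measurable_fun_ltr.
  apply: measurableT_comp; first exact: measurable_expR.
  by apply: measurable_funN; exact: measurable_ln.
apply: measurable_funN; apply: measurableT_comp; first exact: measurable_expR.
apply: measurable_funN; apply: measurableT_comp; first exact: measurable_ln.
exact: measurable_funN.
Qed.

Lemma measurable_sinr : measurable_fun [set: R] (@sin R).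
Proof. by apply: continuous_measurable_fun; exact: continuous_sin. Qed.

Lemma measurable_cosr : measurable_fun [set: R] (@cos R).
Proof. by apply: continuous_measurable_fun; exact: continuous_cos. Qed.

End Measurability.

Ltac mfun := repeat (match goal with
  | |- measurable_fun _ (fun x => @?f x + @?g x) => apply: measurable_funD
  | |- measurable_fun _ (fun x => - @?f x) => apply: measurable_funN
  | |- measurable_fun _ (fun x => @?f x * @?g x) => apply: measurable_funM
  | |- measurable_fun _ (fun x => @?f x ^+ ?n) => apply: measurable_funX
  | |- measurable_fun _ (fun x => @GRing.inv _ (@?f x)) =>
     apply: (measurableT_comp measurable_invr)
  | |- measurable_fun _ (fun x => expR (@?f x)) =>
     apply: (measurableT_comp (@measurable_expR _))
  | |- measurable_fun _ (fun x => cos (@?f x)) =>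
     apply: (measurableT_comp measurable_cosr)
  | |- measurable_fun _ (fun x => sin (@?f x)) =>
     apply: (measurableT_comp measurable_sinr)
  | |- measurable_fun _ (fun x => Num.norm (@?f x)) =>
     apply: (measurableT_comp (@normr_measurable _ setT))
  | |- measurable_fun _ (fun x => if (@?f x < @?g x)%R then _ else _) =>
     apply: measurable_fun_ifT; [apply: measurable_fun_ltr| |]
  | |- measurable_fun _ (fun x => if (@?f x == @?g x)%R then _ else _) =>
     apply: measurable_fun_ifT; [apply: measurable_fun_eqr| |]
  | |- measurable_fun _ fst => exact: measurable_fst
  | |- measurable_fun _ snd => exact: measurable_snd
  | |- measurable_fun _ (fun x => fst x) => exact: measurable_fst
  | |- measurable_fun _ (fun x => snd x) => exact: measurable_snd
  | H : measurable_fun _ ?f |- measurable_fun _ (fun x => ?f x) => exact: H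
  | H : measurable_fun _ ?f |- measurable_fun _ (fun x => ?f (@?g x)) => apply: (measurableT_comp H)
  | |- measurable_fun _ (fun x => fst (@?f x)) => apply: (measurableT_comp measurable_fst)
  | |- measurable_fun _ (fun x => snd (@?f x)) => apply: (measurableT_comp measurable_snd)
  | |- measurable_fun _ (fun x => x) => apply: measurable_id
  | |- measurable_fun _ (@GRing.mul _ ?c) =>
     apply: (@measurable_funM _ _ _ _ (fun=> c) (fun y => y))
  | |- measurable_fun _ (@GRing.add _ ?c) =>
     apply: (@measurable_funD _ _ _ _ (fun=> c) (fun y => y))
  | |- measurable_fun _ (@GRing.opp _) =>
     apply: (@measurable_funN _ _ _ _ (fun y => y))
  | |- measurable_fun _ (@GRing.inv _) => exact: measurable_invr
  | |- measurable_fun _ (@expR _) => exact: measurable_expR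
  | |- measurable_fun _ (@cos _) => exact: measurable_cosr
  | |- measurable_fun _ (@sin _) => exact: measurable_sinr
  | |- measurable_fun _ (fun x => ?c) => exact: measurable_cst
  end).

(** * Product measures and Fubini's theorem for real-valued integrals *)

Section Plane_lebesgue.
Context {R : realType}.
Notation leb := (@lebesgue_measure R).
(* A constant of its own, so that the sigma-finite instance can be attached to
   the product measure. *)
Definition lebm2 : set (measurableTypeR R * measurableTypeR R) -> \bar R := (leb \x leb)%E.
HB.instance Definition _ := Measure.on lebm2.

Lemma lebm2_sigma_finite : sigma_finite setT lebm2.
Proof.
have /sigma_finiteP[F [TF ndF Foo]] := sigma_finiteT leb.
(* The exhaustion F is nondecreasing, so the larger of two indices serves both coordinates. *)
exists (fun n => F n `*` F n).
 rewrite -setXTT {1}TF TF predeqE => -[x y]; split.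
    move=> [/= [n _ Fnx] [k _ Gky]]; exists (maxn n k) => //; split.
    - by move: x Fnx; exact/subsetPset/ndF/leq_maxl.
    - by move: y Gky; exact/subsetPset/ndF/leq_maxr.
  by move=> [n _ []/= ? ?]; split; exists n.
move=> k; have [? ?] := Foo k; have [? ?] := Foo k.
split; first exact: measurableX.
by rewrite /lebm2 product_measure1E// lte_mul_pinfty// ge0_fin_numE.
Qed.
HB.instance Definition _ := @Measure_isSigmaFinite.Build _ _ _ lebm2
  lebm2_sigma_finite.

End Plane_lebesgue.

Section FubiniReal.
Context d1 d2 (T1 : measurableType d1) (T2 : measurableType d2) (R : realType).
Variables (m1 : {sigma_finite_measure set T1 -> \bar R})
  (m2 : {sigma_finite_measure set T2 -> \bar R}).
Implicit Types (f : T1 * T2 -> R).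

(** The extended integral is a difference of two Tonelli integrals, measurable in x, and [fine] is
    measurable; hence the claim covers also the x where the integral diverges. *)
Lemma measurable_Rintegral_param f : measurable_fun setT f ->
  measurable_fun setT (fun x => \int[m2]_y f (x, y)).
Proof.
move=> mf; apply: measurableT_comp => //.
have mF : measurable_fun setT (EFin \o f) by exact/measurable_EFinP.
under eq_fun do rewrite integralE.
apply: emeasurable_funB.
- rewrite [X in measurable_fun _ X](_ : _ = fubini_F m2 (EFin \o f)^\+%E).
    apply: measurable_fun_fubini_tonelli_F => //; exact: measurable_funepos.
  by apply/funext => x; apply: eq_integral => y _; rewrite !funeposE.
- rewrite [X in measurable_fun _ X](_ : _ = fubini_F m2 (EFin \o f)^\-%E).
    apply: measurable_fun_fubini_tonelli_F => //; exact: measurable_funeneg.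
  by apply/funext => x; apply: eq_integral => y _; rewrite !funenegE.
Qed.

(** The real inner integral is [fine] of the extended one, and [fine] can only lower the absolute
    value, since it sends infinities to 0. *)
Lemma integrable_fubini1 f : (m1 \x m2)%E.-integrable setT (EFin \o f) ->
  m1.-integrable setT (EFin \o (fun x => \int[m2]_y f (x, y))).
Proof.
move=> fi; have Fi := integrable_fubini_F fi.
apply/integrableP; split.
  apply/measurable_EFinP/measurable_Rintegral_param/measurable_EFinP.
  exact: measurable_int fi.
move/integrableP : (Fi) => [mF]; apply: le_lt_trans.
apply: ge0_le_integral => //.
- apply: measurableT_comp => //; apply/measurable_EFinP.
  apply/measurable_Rintegral_param/measurable_EFinP.
  exact: measurable_int fi.
- exact: measurableT_comp.
- move=> x _ /=; rewrite /Rintegral /fubini_F /=.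
  by case: (integral _ _ _) => [r| |] /=; rewrite ?normr0 ?leey ?lexx.
Qed.

Lemma Rintegral_fubini1 f : (m1 \x m2)%E.-integrable setT (EFin \o f) ->
  \int[m1]_x \int[m2]_y f (x, y) = \int[(m1 \x m2)%E]_z f z.
Proof.
move=> fi; rewrite /Rintegral -(integral12_prod_meas1 fi); congr fine.
(* The inner integrals are finite almost everywhere, and there [fine] loses nothing. *)
have Fi := integrable_fubini_F fi.
apply: ae_eq_integral => //.
- exact: measurable_int (integrable_fubini1 fi).
- exact: measurable_int Fi.
- have := integrable_ae measurableT Fi; apply: filterS => x /= h xT.
  by rewrite fineK //; exact: h.
Qed.

Lemma integrable_swap f : (m1 \x m2)%E.-integrable setT (EFin \o f) ->
  (m2 \x m1)%E.-integrable setT (EFin \o (f \o (fun p => (p.2, p.1)))).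
Proof.
move=> fi; have mf := measurable_int _ fi.
have msw : measurable_fun setT (fun p : T2 * T1 => (p.2, p.1)).
  exact: measurable_swap.
apply/(integrable12ltyP m2 m1).
  by apply/measurable_EFinP; apply: measurableT_comp msw; exact/measurable_EFinP.
by move/(integrable21ltyP m1 m2 mf) : fi.
Qed.

End FubiniReal.

Section FubiniReal2.
Context d1 d2 (T1 : measurableType d1) (T2 : measurableType d2) (R : realType).
Variables (m1 : {sigma_finite_measure set T1 -> \bar R})
  (m2 : {sigma_finite_measure set T2 -> \bar R}).
Implicit Types (f : T1 * T2 -> R).

Lemma integrable_fubini2 f : (m1 \x m2)%E.-integrable setT (EFin \o f) ->
  m2.-integrable setT (EFin \o (fun y => \int[m1]_x f (x, y))).
Proof. by move=> /integrable_swap /integrable_fubini1. Qed.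

Lemma Rintegral_fubini2 f : (m1 \x m2)%E.-integrable setT (EFin \o f) ->
  \int[m2]_y \int[m1]_x f (x, y) = \int[(m1 \x m2)%E]_z f z.
Proof.
move=> fi; rewrite /Rintegral -(integral21_prod_meas1 fi); congr fine.
have Fi := integrable_fubini_F (integrable_swap fi).
apply: ae_eq_integral => //.
- exact: measurable_int (integrable_fubini2 fi).
- exact: measurable_int Fi.
- have := integrable_ae measurableT Fi; apply: filterS => x /= h xT.
  by rewrite fineK //; exact: h.
Qed.

Lemma Rfubini f : (m1 \x m2)%E.-integrable setT (EFin \o f) ->
  \int[m1]_x \int[m2]_y f (x, y) = \int[m2]_y \int[m1]_x f (x, y).
Proof. by move=> fi; rewrite Rintegral_fubini1// Rintegral_fubini2. Qed.

Variables (D1 : set T1) (D2 : set T2).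
Hypotheses (mD1 : measurable D1) (mD2 : measurable D2).

(** Extension by zero from a rectangle is extension by zero in one variable after the other; this
    reduces Fubini on D1 x D2 to the whole product. *)
Let restrictX f x y : (f \_ (D1 `*` D2)) (x, y) =
  ((fun x => ((fun y => f (x, y)) \_ D2) y) \_ D1) x.
Proof.
rewrite !patchE; case: ifPn; rewrite in_setX; first by move=> /andP[-> ->].
by rewrite negb_and => /orP[/negbTE -> //|/negbTE ->]; case: ifP.
Qed.

Let inner f x : \int[m2]_y (f \_ (D1 `*` D2)) (x, y) =
  ((fun x => \int[m2]_(y in D2) f (x, y)) \_ D1) x.
Proof.
under eq_Rintegral do rewrite restrictX.
rewrite [RHS]patchE; case: ifPn => xD.
  by rewrite [RHS]Rintegral_mkcond; apply: eq_Rintegral => y _; rewrite patchE xD.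
by under eq_Rintegral do rewrite patchE (negbTE xD); rewrite Rintegral_cst// mul0r.
Qed.

Let inner2 f y : \int[m1]_x (f \_ (D1 `*` D2)) (x, y) =
  ((fun y => \int[m1]_(x in D1) f (x, y)) \_ D2) y.
Proof.
rewrite [RHS]patchE; case: ifPn => yD.
  rewrite [RHS]Rintegral_mkcond; apply: eq_Rintegral => x _.
  by rewrite restrictX !patchE yD.
under eq_Rintegral do rewrite restrictX !patchE (negbTE yD) if_same.
by rewrite Rintegral_cst// mul0r.
Qed.

Variable f : T1 * T2 -> R.
Hypothesis fi : (m1 \x m2)%E.-integrable (D1 `*` D2) (EFin \o f).

Let fi' : (m1 \x m2)%E.-integrable setT (EFin \o (f \_ (D1 `*` D2))).
Proof.
by rewrite -restrict_EFin; apply/(integrable_mkcond _ (measurableX mD1 mD2)).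
Qed.

Lemma integrable_fubini1_on :
  m1.-integrable D1 (EFin \o (fun x => \int[m2]_(y in D2) f (x, y))).
Proof.
apply/(integrable_mkcond _ mD1); rewrite restrict_EFin.
apply: eq_integrable (integrable_fubini1 fi') => // x _ /=.
by rewrite inner.
Qed.

Lemma integrable_fubini2_on :
  m2.-integrable D2 (EFin \o (fun y => \int[m1]_(x in D1) f (x, y))).
Proof.
apply/(integrable_mkcond _ mD2); rewrite restrict_EFin.
apply: eq_integrable (integrable_fubini2 fi') => // x _ /=.
by rewrite inner2.
Qed.

Lemma Rintegral_fubini1_on :
  \int[m1]_(x in D1) \int[m2]_(y in D2) f (x, y) =
  \int[(m1 \x m2)%E]_(z in D1 `*` D2) f z.
Proof.
rewrite [RHS]Rintegral_mkcond -(Rintegral_fubini1 fi') Rintegral_mkcond.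
by apply: eq_Rintegral => x _; rewrite inner.
Qed.

Lemma Rintegral_fubini2_on :
  \int[m2]_(y in D2) \int[m1]_(x in D1) f (x, y) =
  \int[(m1 \x m2)%E]_(z in D1 `*` D2) f z.
Proof.
rewrite [RHS]Rintegral_mkcond -(Rintegral_fubini2 fi') Rintegral_mkcond.
by apply: eq_Rintegral => x _; rewrite inner2.
Qed.

Lemma Rfubini_on :
  \int[m1]_(x in D1) \int[m2]_(y in D2) f (x, y) =
  \int[m2]_(y in D2) \int[m1]_(x in D1) f (x, y).
Proof. by rewrite Rintegral_fubini1_on Rintegral_fubini2_on. Qed.

End FubiniReal2.

Section ProductDomination.
Context d1 d2 (T1 : measurableType d1) (T2 : measurableType d2) (R : realType).
Variables (m1 : {sigma_finite_measure set T1 -> \bar R})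
  (m2 : {sigma_finite_measure set T2 -> \bar R}).
Variables (D1 : set T1) (D2 : set T2).
Hypotheses (mD1 : measurable D1) (mD2 : measurable D2).

Lemma integrable_prod (g : T1 -> R) (h : T2 -> R) :
  m1.-integrable D1 (EFin \o g) -> m2.-integrable D2 (EFin \o h) ->
  (m1 \x m2)%E.-integrable (D1 `*` D2) (EFin \o (fun z => g z.1 * h z.2)).
Proof.
move=> gi hi; apply/(integrable_mkcond _ (measurableX mD1 mD2)).
have -> : (EFin \o (fun z => g z.1 * h z.2)) \_ (D1 `*` D2) =
    EFin \o (fun z => (g \_ D1) z.1 * (h \_ D2) z.2).
  apply/funext => -[x y]; rewrite !patchE/= !patchE in_setX.
  by case: (x \in D1); case: (y \in D2); rewrite /= ?(mulr0, mul0r).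
move/(integrable_mkcond _ mD1) : gi; rewrite restrict_EFin.
move/(integrable_mkcond _ mD2) : hi; rewrite restrict_EFin.
set h' := h \_ D2; set g' := g \_ D1 => hi gi.
have mg : measurable_fun setT g' by apply/measurable_EFinP; exact: measurable_int gi.
have mh : measurable_fun setT h' by apply/measurable_EFinP; exact: measurable_int hi.
apply/(integrable12ltyP m1 m2); first by apply/measurable_EFinP; mfun.
have /integrableP[_ hlt] := hi; have /integrableP[_ glt] := gi.
rewrite (eq_integral (fun x => `|(g' x)%:E| * \int[m2]_y `|(h' y)%:E|)%E); last first.
  move=> x _; rewrite -ge0_integralZl//.
  - by apply: eq_integral => y _; rewrite /= normrM.
  - by apply/measurable_EFinP; mfun.
rewrite ge0_integralZr//.
- by rewrite lte_mul_pinfty// ?integral_ge0// ge0_fin_numE// integral_ge0.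
- by apply/measurable_EFinP; mfun.
- by apply: integral_ge0.
Qed.

(** A majorant of product form settles integrability without evaluating an iterated integral; the
    exchanges of order in the trigonometric integrals rest on it. *)
Lemma integrable_prod_dom (f : T1 * T2 -> R) (g : T1 -> R) (h : T2 -> R) :
  measurable_fun (D1 `*` D2) f ->
  m1.-integrable D1 (EFin \o g) -> m2.-integrable D2 (EFin \o h) ->
  (forall x y, D1 x -> D2 y -> `|f (x, y)| <= g x * h y) ->
  (m1 \x m2)%E.-integrable (D1 `*` D2) (EFin \o f).
Proof.
move=> mf gi hi fgh; apply: le_integrable (integrable_prod gi hi) => //.
- exact: measurableX.
- exact/measurable_EFinP.
- move=> [x y] [/= Dx Dy]; rewrite lee_fin (le_trans (fgh _ _ Dx Dy))//.
  exact: ler_norm.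
Qed.

End ProductDomination.

(** * Derivative rules for functions of one real variable *)

Section DerivativeRules.
Context {R : realType}.
Implicit Types (f g : R -> R).

(* [is_derive] is a type class, whose automatic resolution would fill in
   derivatives in an unwanted form; this is the same notion as a plain
   predicate. *)
Definition hasd f (x l : R) : Prop := is_derive x (1 : R) f l.

Lemma hasd_eq f x l l' : hasd f x l -> l = l' -> hasd f x l'.
Proof. by move=> fl <-. Qed.

Lemma hasd_continuous f x l : hasd f x l -> {for x, continuous f}.
Proof. by move=> [df _]; exact/differentiable_continuous/derivable1_diffP. Qed.

Lemma hasd_cst (c x : R) : hasd (fun=> c) x 0.
Proof. exact: is_derive_cst. Qed.

Lemma hasd_id (x : R) : hasd (fun y => y) x 1.
Proof. exact: is_derive_id. Qed.

Lemma hasd_add f g x df dg : hasd f x df -> hasd g x dg ->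
  hasd (fun y => f y + g y) x (df + dg).
Proof. by move=> fd gd; exact: is_deriveD. Qed.

Lemma hasd_opp f x df : hasd f x df -> hasd (fun y => - f y) x (- df).
Proof. by move=> fd; exact: is_deriveN. Qed.

Lemma hasd_mul f g x df dg : hasd f x df -> hasd g x dg ->
  hasd (fun y => f y * g y) x (df * g x + f x * dg).
Proof.
move=> fd gd; apply: (hasd_eq (is_deriveM fd gd)).
by rewrite addrC; congr (_ + _); exact: mulrC.
Qed.

Lemma hasd_comp f g x dg df : hasd g x dg -> hasd f (g x) df ->
  hasd (fun y => f (g y)) x (df * dg).
Proof. by move=> gd fd; exact: (@is_derive1_comp _ f g). Qed.

Lemma hasd_expR f x df : hasd f x df ->
  hasd (fun y => expR (f y)) x (expR (f x) * df).
Proof. by move=> fd; exact: (hasd_comp fd (is_derive_expR _)). Qed.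

Lemma hasd_cos f x df : hasd f x df ->
  hasd (fun y => cos (f y)) x (- sin (f x) * df).
Proof. by move=> fd; exact: (hasd_comp fd (is_derive_cos _)). Qed.

Lemma hasd_sin f x df : hasd f x df ->
  hasd (fun y => sin (f y)) x (cos (f x) * df).
Proof. by move=> fd; exact: (hasd_comp fd (is_derive_sin _)). Qed.

Lemma hasd_pow f k x df : hasd f x df ->
  hasd (fun y => f y ^+ k) x (k%:R * f x ^+ k.-1 * df).
Proof.
move=> fd; elim: k => [|k ih].
  by under eq_fun do rewrite expr0; rewrite !mul0r; exact: hasd_cst.
under eq_fun do rewrite exprS.
apply: (hasd_eq (hasd_mul fd ih)).
case: k {ih} => [|k]; first by rewrite !mul0r mulr0 expr0 addr0 mulr1 !mul1r.
by rewrite /= (exprS (f x) k) [in RHS]mulrSr; ring.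
Qed.

Lemma hasd_inv f x df : f x != 0 -> hasd f x df ->
  hasd (fun y => (f y)^-1) x (- (f x) ^- 2 * df).
Proof. by move=> f0 fd; exact: (is_deriveV f0 fd). Qed.

End DerivativeRules.

Ltac isd := repeat (match goal with
  | |- hasd (fun y => y) _ _ => exact: hasd_id
  | |- hasd (@GRing.mul _ ?c) _ _ => apply: (@hasd_mul _ (fun=> c) (fun y => y))
  | |- hasd (@GRing.add _ ?c) _ _ => apply: (@hasd_add _ (fun=> c) (fun y => y))
  | |- hasd (@GRing.opp _) _ _ => apply: (@hasd_opp _ (fun y => y))
  | |- hasd (@expR _) _ _ => apply: (@hasd_expR _ (fun y => y))
  | |- hasd (@cos _) _ _ => apply: (@hasd_cos _ (fun y => y))
  | |- hasd (@sin _) _ _ => apply: (@hasd_sin _ (fun y => y))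
  | |- hasd id _ _ => exact: hasd_id
  | |- hasd (fun y => ?c) _ _ => exact: hasd_cst
  | |- hasd (fun y => @?f y + @?g y) _ _ => apply: hasd_add
  | |- hasd (fun y => - @?f y) _ _ => apply: hasd_opp
  | |- hasd (fun y => @?f y * @?g y) _ _ => apply: hasd_mul
  | |- hasd (fun y => @?f y ^+ ?k) _ _ => apply: hasd_pow
  | |- hasd (fun y => @GRing.inv _ (@?f y)) _ _ => apply: hasd_inv
  | |- hasd (fun y => expR (@?f y)) _ _ => apply: hasd_expR
  | |- hasd (fun y => cos (@?f y)) _ _ => apply: hasd_cos
  | |- hasd (fun y => sin (@?f y)) _ _ => apply: hasd_sin
  end).

(** * Domination, limits and differentiation under the integral sign *)

Section RealIntegration.
Context d (T : measurableType d) (R : realType) (m : {measure set T -> \bar R}).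
Variable (D : set T).
Hypothesis mD : measurable D.
Implicit Types f g : T -> R.

Lemma integrableRD f g : m.-integrable D (EFin \o f) ->
  m.-integrable D (EFin \o g) -> m.-integrable D (EFin \o (fun x => f x + g x)).
Proof. by move=> fi gi; apply: eq_integrable (integrableD mD fi gi). Qed.

Lemma integrableRB f g : m.-integrable D (EFin \o f) ->
  m.-integrable D (EFin \o g) -> m.-integrable D (EFin \o (fun x => f x - g x)).
Proof. by move=> fi gi; apply: eq_integrable (integrableB mD fi gi). Qed.

Lemma integrableRZl k f : m.-integrable D (EFin \o f) ->
  m.-integrable D (EFin \o (fun x => k * f x)).
Proof. by move=> fi; apply: eq_integrable (integrableZl mD k fi). Qed.

Lemma integrableRmeas f : m.-integrable D (EFin \o f) -> measurable_fun D f.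
Proof. by move=> /measurable_int /measurable_EFinP. Qed.

Lemma le_integrableR f g : measurable_fun D f ->
  (forall x, D x -> `|f x| <= g x) ->
  m.-integrable D (EFin \o g) -> m.-integrable D (EFin \o f).
Proof.
move=> mf fg gi; apply: le_integrable gi => //; first exact/measurable_EFinP.
by move=> x Dx /=; rewrite lee_fin (le_trans (fg _ Dx))// ler_norm.
Qed.

Lemma integrableRMb f g c : m.-integrable D (EFin \o f) ->
  measurable_fun D g -> (forall x, D x -> `|g x| <= c) ->
  m.-integrable D (EFin \o (fun x => f x * g x)).
Proof.
move=> fi mg gc; have mf := integrableRmeas fi.
apply: (@le_integrableR _ (fun x => c * `|f x|)).
- exact: measurable_funM.
- by move=> x Dx; rewrite normrM mulrC ler_wpM2r// gc.
- by apply: integrableRZl; apply: eq_integrable (integrable_norm fi).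
Qed.

Lemma RintegralN f : m.-integrable D (EFin \o f) ->
  \int[m]_(x in D) (- f x) = - \int[m]_(x in D) f x.
Proof.
by move=> fi; under eq_Rintegral do rewrite -mulN1r; rewrite RintegralZl// mulN1r.
Qed.

Lemma RintegralZB c f g : m.-integrable D (EFin \o f) -> m.-integrable D (EFin \o g) ->
  \int[m]_(x in D) (c * f x - g x) = c * \int[m]_(x in D) f x - \int[m]_(x in D) g x.
Proof.
by move=> fi gi; rewrite RintegralB//; [rewrite RintegralZl|exact: integrableRZl].
Qed.

Lemma normr_Rintegral_le f g : measurable_fun D f ->
  m.-integrable D (EFin \o g) -> (forall x, D x -> `|f x| <= g x) ->
  `|\int[m]_(x in D) f x| <= \int[m]_(x in D) g x.
Proof.
move=> mf gi fg; have fi := le_integrableR mf fg gi.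
apply: le_trans (le_normr_Rintegral mD fi) _.
by apply: le_Rintegral => //; apply: eq_integrable (integrable_norm fi).
Qed.

Lemma dominated_cvgR (f_ : nat -> T -> R) f g :
  (forall n, measurable_fun D (f_ n)) ->
  (forall x, D x -> f_ n x @[n --> \oo] --> f x) ->
  m.-integrable D (EFin \o g) ->
  (forall n x, D x -> `|f_ n x| <= g x) ->
  \int[m]_(x in D) f_ n x @[n --> \oo] --> \int[m]_(x in D) f x.
Proof.
move=> mf_ f_f gi fg.
have mf : measurable_fun D f by apply: measurable_fun_cvg mf_ _.
have fi : m.-integrable D (EFin \o f).
  apply: le_integrableR gi => // x Dx.
  apply/ler_addgt0Pr => e e0.
  have /cvgrPdist_le /(_ _ e0) [N _ /(_ N (leqnn _)) /=] := f_f _ Dx.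
  move=> h; rewrite -(subrK (f_ N x) (f x)) (le_trans (ler_normD _ _))//.
  by rewrite addrC lerD// fg.
have H : (\int[m]_(x in D) (f_ n x)%:E)%E @[n --> \oo] --> (\int[m]_(x in D) (f x)%:E)%E.
  apply: (@dominated_cvg _ _ _ m _ mD (fun n x => (f_ n x)%:E) _ (EFin \o g)) => //=.
  - by move=> n; apply/measurable_EFinP.
  - by move=> x Dx; apply: cvg_EFin; [exact: nearW|exact: f_f].
rewrite -(fineK (integrable_fin_num mD fi)) in H.
exact: fine_cvg H.
Qed.

(** Dominated convergence for g cut off outside [D_ n]; integrals over half lines become limits of
    integrals over segments in this way. *)
Lemma cvg_Rintegral_exhaust (D_ : nat -> set T) g :
  m.-integrable D (EFin \o g) -> (forall n, measurable (D_ n)) ->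
  (forall n, D_ n `<=` D) -> (forall x, D x -> \forall n \near \oo, D_ n x) ->
  \int[m]_(x in D_ n) g x @[n --> \oo] --> \int[m]_(x in D) g x.
Proof.
move=> gi mD_ D_D DD_.
have -> : (fun n => \int[m]_(x in D_ n) g x) =
    (fun n => \int[m]_(x in D) (g \_ (D_ n)) x).
  by apply/funext => n; rewrite -Rintegral_mkcondr setIidr.
apply: (@dominated_cvgR _ _ (fun x => `|g x|)).
- move=> n; apply/(measurable_restrict _ (mD_ n) mD).
  by apply: measurable_funS (integrableRmeas gi).
- move=> x Dx; apply: cvg_near_cst; apply: filterS (DD_ _ Dx) => n Dn.
  by rewrite patchE mem_set.
- by apply: eq_integrable (integrable_norm gi).
- by move=> n x Dx; rewrite patchE; case: ifP => // _; rewrite normr0.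
Qed.

End RealIntegration.

Section Differentiation.
Context {R : realType} d {Y : measurableType d} {m : {measure set Y -> \bar R}}.

(** The conditions are local in the parameter because the kernels are differentiated only at
    positive height and the majorants are uniform only on bounded ranges. *)
Lemma hasd_Rintegral (f df : R -> Y -> R) (B : set Y) (a u v : R) (G : Y -> R) :
  measurable B -> u < a < v ->
  (forall x, u < x < v -> m.-integrable B (EFin \o f x)) ->
  (forall x y, u < x < v -> B y -> hasd (f ^~ y) x (df x y)) ->
  m.-integrable B (EFin \o G) ->
  (forall x y, u < x < v -> B y -> `|df x y| <= G y) ->
  hasd (fun x => \int[m]_(y in B) f x y) a (\int[m]_(y in B) df a y).
Proof.
move=> mB auv fi fd Gi dfG.
pose G' y := `|G y|.
have Gi' : m.-integrable B (EFin \o G').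
  by apply: eq_integrable (integrable_norm Gi).
have d1 x y : u < x < v -> B y -> partial1of2 f x y = df x y.
  by move=> xuv By; rewrite partial1of2E; have [_ ->] := fd _ _ xuv By.
have Ia : `]u, v[%classic a by rewrite /= in_itv.
have I1 x : `]u, v[%classic x -> m.-integrable B (EFin \o f x).
  by rewrite /= in_itv; exact: fi.
have I2 x y : `]u, v[%classic x -> B y -> derivable (f ^~ y) x 1.
  by rewrite /= in_itv => xuv By; have [] := fd _ _ xuv By.
have I3 x y : `]u, v[%classic x -> B y -> `|partial1of2 f x y| <= G' y.
  rewrite /= in_itv => xuv By; rewrite d1// (le_trans (dfG _ _ xuv By))//.
  exact: ler_norm.
have G0 y : 0 <= G' y by exact: normr_ge0.
split; first exact: (derivable_under_integral mB Ia I1 I2 G0 Gi' I3).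
rewrite -derive1E (differentiation_under_integral mB Ia I1 I2 G0 Gi' I3).
by apply: eq_Rintegral => y; rewrite inE => By; exact: d1.
Qed.

End Differentiation.

(** * Fundamental theorem of calculus, reflections and exponential bounds on the line *)

Section RealLine.
Context {R : realType}.
Local Notation leb := (@lebesgue_measure R).
Implicit Types (f g G : R -> R).

Lemma integrable_itv_cc g a b : continuous g ->
  leb.-integrable `[a, b] (EFin \o g).
Proof.
move=> cg; apply: continuous_compact_integrable; first exact: segment_compact.
exact: continuous_subspaceT.
Qed.

Lemma Rintegral_FTC_cc G g a b : a <= b -> continuous g ->
  (forall x, hasd G x (g x)) ->
  \int[leb]_(x in `[a, b]) g x = G b - G a.
Proof.
rewrite le_eqVlt => /predU1P[<-|ab] cg dG.
  by rewrite set_itv1 Rintegral_set1 subrr.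
have cG x : {for x, continuous G} by apply: hasd_continuous (dG x).
rewrite /Rintegral (@continuous_FTC2 _ g G)//.
- exact: continuous_subspaceT.
- split.
  + by move=> x _; have [] := dG x.
  + by apply: cvg_at_right_filter; exact: cG.
  + by apply: cvg_at_left_filter; exact: cG.
- by move=> x _; rewrite derive1E; have [_ ->] := dG x.
Qed.

Lemma Rintegral_FTC_cy G g a l : continuous g ->
  leb.-integrable `[a, +oo[ (EFin \o g) ->
  (forall x, hasd G x (g x)) -> G x @[x --> +oo] --> l ->
  \int[leb]_(x in `[a, +oo[) g x = l - G a.
Proof.
move=> cg gi dG Gl.
have A : \int[leb]_(x in `[a, a + n%:R]) g x @[n --> \oo] -->
    \int[leb]_(x in `[a, +oo[) g x.
  apply: cvg_Rintegral_exhaust => //.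
  - by move=> n; apply: subset_itvl.
  - move=> x /=; rewrite in_itv/= andbT => ax; near=> n; rewrite /= in_itv/= ax/=.
    rewrite -lerBlDl; near: n; exact: nbhs_infty_ger.
have B : \int[leb]_(x in `[a, a + n%:R]) g x @[n --> \oo] --> l - G a.
  have -> : (fun n => \int[leb]_(x in `[a, a + n%:R]) g x) = (fun n => G (a + n%:R) - G a).
    by apply/funext => n; rewrite (@Rintegral_FTC_cc G)// lerDl.
  apply: cvgB; last exact: cvg_cst.
  apply: (@cvg_comp _ _ _ (fun n => a + n%:R) G); last exact: Gl.
  apply/cvgryPge => A'; near=> n; rewrite -lerBlDl; near: n; exact: nbhs_infty_ger.
exact: (cvg_unique _ A B).
Unshelve. all: end_near. Qed.

(** A named map, so that its measurability can be registered and the image of Lebesgue measure under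
    it formed. *)
Definition subl (r : R) (x : measurableTypeR R) : measurableTypeR R := r - x.

Lemma measurable_subl r : measurable_fun setT (subl r).
Proof. exact: measurable_funB. Qed.
HB.instance Definition _ r := isMeasurableFun.Build _ _ _ _ (subl r) (measurable_subl r).

(** By uniqueness of Lebesgue measure half-open intervals suffice; the reflection exchanges the open
    and the closed end and keeps the length. *)
Lemma lebesgue_measure_subl (r : R) (A : set R) : measurable A ->
  pushforward leb (subl r) A = leb A.
Proof.
move=> mA; apply/esym/lebesgue_measure_unique => //= _ [[a b]] _ <-.
rewrite /pushforward (_ : _ @^-1` _ = `[r - b, r - a[%classic); last first.
  by apply/seteqP; split => x /=; rewrite !in_itv/= /subl; lra.
rewrite !lebesgue_measure_itv/= !lte_fin ltrD2l ltrN2; case: ifP => // _.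
by rewrite -!EFinB; congr EFin; lra.
Qed.

Lemma integrable_subl r f : leb.-integrable setT (EFin \o f) ->
  leb.-integrable setT (EFin \o (fun s => f (r - s))).
Proof.
move=> /integrableP[/measurable_EFinP mf foo]; apply/integrableP; split.
  by apply/measurable_EFinP; exact: (measurableT_comp mf (measurable_subl r)).
apply: le_lt_trans foo.
have -> : (\int[leb]_x `|(EFin \o f) x| = \int[pushforward leb (subl r)]_x `|(EFin \o f) x|)%E.
  by apply: eq_measure_integral => A mA _;
    first [exact: lebesgue_measure_subl | exact/esym/lebesgue_measure_subl].
rewrite ge0_integral_pushforward//.
by apply: measurableT_comp => //; exact/measurable_EFinP.
Qed.

Lemma Rintegral_subl r f : leb.-integrable setT (EFin \o f) ->
  \int[leb]_s f (r - s) = \int[leb]_s f s.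
Proof.
move=> fi; rewrite /Rintegral; congr fine.
transitivity (\int[pushforward leb (subl r)]_x (f x)%:E)%E; last first.
  apply: eq_measure_integral => A mA _.
  by first [exact: lebesgue_measure_subl | exact/esym/lebesgue_measure_subl].
rewrite integral_pushforward//.
- exact: measurable_int fi.
- exact: integrable_subl.
Qed.

(** The negative half line is carried over by s -> - s. The parity arguments go through this fold:
    even integrands double, odd ones cancel. *)
Lemma Rintegral_fold f : leb.-integrable setT (EFin \o f) ->
  \int[leb]_s f s = \int[leb]_(s in `[0, +oo[) (f s + f (- s)).
Proof.
move=> fi.
have mf := integrableRmeas fi.
have fiN : leb.-integrable setT (EFin \o (fun s => f (- s))).
  by apply: eq_integrable (integrable_subl 0 fi) => // s _ /=; rewrite sub0r.
have on D (g : R -> R) : measurable D -> leb.-integrable setT (EFin \o g) ->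
    leb.-integrable D (EFin \o g).
  by move=> mD; apply: integrableS.
rewrite RintegralD//; [|exact: on|exact: on].
have -> : [set: R] = `[0, +oo[%classic `|` `]-oo, 0[%classic.
  by rewrite setUC -(@itv_bndbnd_setU _ _ _ (BLeft 0))// set_itvE.
rewrite Rintegral_setU//; last 2 first.
- by apply: on => //; exact: measurableU.
- apply/disj_setPS => x [/=]; rewrite !in_itv/= andbT; lra.
congr (_ + _).
rewrite -[RHS]Rintegral_itv_obnd_cbnd; last exact: on.
rewrite [LHS]Rintegral_mkcond [RHS]Rintegral_mkcond -(Rintegral_subl 0).
  apply: eq_Rintegral => s _; rewrite !patchE !sub0r.
  have -> : (- s \in `]-oo, 0[%classic) = (s \in `]0, +oo[%classic) => //.
  by apply/idP/idP; rewrite !inE/= !in_itv/= ?andbT ?oppr_lt0.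
rewrite -restrict_EFin.
have mI : measurable (`]-oo, 0[%classic : set (measurableTypeR R)) by exact: measurable_itv.
have := (@integrable_mkcond _ _ _ leb _ (EFin \o f) mI). move=> [h _]; apply: h; apply: on=> //.
Qed.

End RealLine.

Section Exponential.
Context {R : realType}.
Local Notation leb := (@lebesgue_measure R).

Lemma expR_cvg0 (c : R) : 0 < c -> expR (- (c * x)) @[x --> +oo] --> 0.
Proof.
move=> c0; apply: (@cvg_comp _ _ _ (fun x => c * x) (fun x => expR (- x))); last exact: cvgr_expR.
exact: gt0_cvgMry.
Qed.

Lemma continuous_expRM (c : R) : continuous (fun x => expR (- (c * x)) : R).
Proof.
by move=> x; eapply hasd_continuous; isd.
Qed.

Lemma integrable_expR (c : R) : 0 < c ->
  leb.-integrable `[0, +oo[ (EFin \o (fun x => expR (- (c * x)))).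
Proof.
move=> c0; apply/integrableP; split.
  by apply/measurable_EFinP; apply: measurable_funTS; mfun.
have d x : hasd (fun x => - (c^-1 * expR (- (c * x)))) x (expR (- (c * x))).
  by eapply hasd_eq; [isd|rewrite /=; field; rewrite gt_eqF].
under eq_integral do rewrite /= ger0_norm ?expR_ge0//.
rewrite (@ge0_continuous_FTC2y _ _ (fun x => - (c^-1 * expR (- (c * x)))) _ 0).
- by rewrite -EFinB ltry.
- by move=> x _; exact: expR_ge0.
- by apply: continuous_subspaceT; exact: continuous_expRM.
- rewrite -oppr0 -(mulr0 c^-1); apply: cvgN; apply: cvgMr; exact: expR_cvg0.
- by move=> x _; have [] := d x.
- by apply: cvg_at_right_filter; exact: (hasd_continuous (d 0)).
- by move=> x _; rewrite derive1E; have [_ ->] := d x.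
Qed.

(** A single term of the exponential series: (d x)^k / k! <= exp(d x). *)
Lemma pow_le_expR k (d x : R) : 0 < d -> 0 <= x -> x ^+ k <= k`!%:R / d ^+ k * expR (d * x).
Proof.
move=> d0 x0.
have H : (d * x) ^+ k <= k`!%:R * expR (d * x).
  case: k => [|k]; first by rewrite expr0 fact0 mul1r -expR0 ler_expR mulr_ge0// ltW.
  have dx0 : 0 <= d * x by rewrite mulr_ge0// ltW.
  have := expR_ge1Dxn k dx0; rewrite -ler_pdivrMl ?ltr0n ?fact_gt0//; lra.
rewrite -(ler_pM2l (exprn_gt0 k d0)) -exprMn (le_trans H)// mulrA mulrCA mulfV ?mulr1//.
by rewrite expf_neq0// gt_eqF.
Qed.

End Exponential.

(** * The integrals [cosI] and [sinI]: recurrences, derivatives and decay *)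

Section TrigLaplace.
Context {R : realType}.
Local Notation leb := (@lebesgue_measure R).
Implicit Types (t a r xi : R) (k : nat).

(* Up to constants, cosI and sinI are the inverse Fourier transforms of
   |xi|^k e^(- a |xi|) e^(- t xi^2): at t = 0, k = 0 the Poisson kernel and its
   conjugate at height a, at a = 0 derivatives of the heat kernel. *)
Definition kap t k a xi : R := xi ^+ k * expR (- (a * xi) - t * xi ^+ 2).
Definition cosI t k r a : R := \int[leb]_(xi in `[0, +oo[) (kap t k a xi * cos (r * xi)).
Definition sinI t k r a : R := \int[leb]_(xi in `[0, +oo[) (kap t k a xi * sin (r * xi)).

(* Admissible parameters: Gaussian decay, or plain exponential decay. *)
Definition adm t a := (0 < t) || ((t == 0) && (0 < a)).

Lemma kap_ge0 t k a xi : 0 <= xi -> 0 <= kap t k a xi.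
Proof. by move=> x0; rewrite mulr_ge0 ?expR_ge0// exprn_ge0. Qed.

Lemma kap_gauss_le t k A : 0 < t -> exists M : R, forall a xi, `|a| <= A -> 0 <= xi ->
  kap t k a xi <= M * expR (- (2^-1 * xi)).
Proof.
(* Completing the square gives - a xi - t xi^2 <= - xi + (1 - a)^2 / (4 t), with (1 - a)^2 <= (1 +
   A)^2. One half of exp(- xi) absorbs the power xi^k at the cost k! / 2^-1^k; the other half is the
   decay that remains. *)
move=> t0; exists (k`!%:R / 2^-1 ^+ k * expR ((1 + A) ^+ 2 / (4 * t))) => a xi aA xi0.
have h : expR (- (a * xi) - t * xi ^+ 2) <=
    expR (- (2^-1 * xi)) * expR (- (2^-1 * xi)) * expR ((1 + A) ^+ 2 / (4 * t)).
  rewrite -!expRD ler_expR.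
  set L := (1 + A) ^+ 2 / (4 * t); pose l := (1 - a) ^+ 2 / (4 * t).
  have lL : l <= L.
    rewrite ler_pM2r ?invr_gt0; last lra.
    by have := aA; rewrite ler_norml => /andP[? ?]; nra.
  have : 0 <= t * (xi - (1 - a) / (2 * t)) ^+ 2 by rewrite mulr_ge0 ?sqr_ge0// ltW.
  have -> : t * (xi - (1 - a) / (2 * t)) ^+ 2 = t * xi ^+ 2 - (1 - a) * xi + l.
    by rewrite /l; field; rewrite gt_eqF.
  lra.
have p := pow_le_expR k (_ : 0 < 2^-1 :> R) xi0.
apply: le_trans (ler_pM (exprn_ge0 _ xi0) (expR_ge0 _) (p _) h) _; first lra.
rewrite le_eqVlt; apply/orP; left; apply/eqP.
have e : expR (2^-1 * xi) * expR (- (2^-1 * xi)) = 1 by rewrite -expRD addrN expR0.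
transitivity (k`!%:R / 2^-1 ^+ k * (expR (2^-1 * xi) * expR (- (2^-1 * xi))) * expR (- (2^-1 * xi)) * expR ((1 + A) ^+ 2 / (4 * t))); first ring.
by rewrite e; ring.
Qed.

Lemma kap_le t k a : adm t a -> exists M c, 0 < c /\
  forall xi, 0 <= xi -> kap t k a xi <= M * expR (- (c * xi)).
Proof.
case/orP=> [t0|/andP[/eqP -> a0]].
  have [M h] := kap_gauss_le k `|a| t0; exists M, 2^-1; split; first lra.
  by move=> xi; apply: h.
exists (k`!%:R / (a / 2) ^+ k), (a / 2); split; first lra.
move=> xi xi0; rewrite /kap mul0r subr0.
have a20 : 0 < a / 2 by lra.
have p := pow_le_expR k a20 xi0.
apply: le_trans (ler_wpM2r (expR_ge0 _) p) _.
set M := _ / _ ^+ _.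
by rewrite -(mulrA M) -expRD; have -> : a / 2 * xi - a * xi = - (a / 2 * xi) by lra.
Qed.

Lemma measurable_kap t k a : measurable_fun setT (kap t k a).
Proof. rewrite /kap; mfun. Qed.

Lemma integrable_kap t k a : adm t a -> leb.-integrable `[0, +oo[ (EFin \o kap t k a).
Proof.
move=> /(kap_le k)[M [c [c0 h]]].
have gi : leb.-integrable `[0, +oo[ (EFin \o (fun x => M * expR (- (c * x)))).
  by apply: integrableRZl => //; exact: integrable_expR.
apply: le_integrableR gi => //.
- by apply: measurable_funTS; exact: measurable_kap.
- move=> x /=; rewrite in_itv/= andbT => x0; rewrite ger0_norm ?kap_ge0//; exact: h.
Qed.

Lemma integrable_kap_cos t k a r : adm t a ->
  leb.-integrable `[0, +oo[ (EFin \o (fun xi => kap t k a xi * cos (r * xi))).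
Proof.
move=> ta; apply: (@integrableRMb _ _ _ _ _ _ _ _ 1) => //.
- exact: integrable_kap.
- by apply: measurable_funTS; mfun.
- by move=> x _; exact: cos_max.
Qed.

Lemma integrable_kap_sin t k a r : adm t a ->
  leb.-integrable `[0, +oo[ (EFin \o (fun xi => kap t k a xi * sin (r * xi))).
Proof.
move=> ta; apply: (@integrableRMb _ _ _ _ _ _ _ _ 1) => //.
- exact: integrable_kap.
- by apply: measurable_funTS; mfun.
- by move=> x _; exact: sin_max.
Qed.

Lemma kap_cvg0 t k a (h : R -> R) : adm t a -> (forall x, `|h x| <= 1) ->
  kap t k a x * h x @[x --> +oo] --> 0.
Proof.
move=> /(kap_le k)[M [c [c0 H]]] h1.
have cM : M * expR (- (c * x)) @[x --> +oo] --> 0.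
  by rewrite -(mulr0 M); apply: cvgMr; exact: expR_cvg0.
apply/norm_cvg0P; apply: (@squeeze_cvgr _ _ _ _ (cst 0) _ _ _ _ _ cM); last exact: cvg_cst.
near=> x; have x0 : 0 <= x by near: x; exact: nbhs_pinfty_ge.
rewrite /= normr_ge0/= normrM (ger0_norm (kap_ge0 _ _ _ x0)).
by rewrite (le_trans _ (H _ x0))// ler_piMr// kap_ge0.
Unshelve. all: end_near. Qed.

Lemma hasd_kap t k a xi : hasd (kap t k a) xi
  (k%:R * kap t k.-1 a xi - a * kap t k a xi - 2 * t * kap t k.+1 a xi).
Proof.
rewrite /kap; eapply hasd_eq; first isd.
rewrite /= (exprS xi k); ring.
Qed.

Lemma kap00 t a : kap t 0 a 0 = 1.
Proof. by rewrite /kap expr0 mul1r (_ : _ - _ = 0) ?expR0//; ring. Qed.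

Lemma kapS0 t k a : kap t k.+1 a 0 = 0.
Proof. by rewrite /kap expr0n/= mul0r. Qed.

(** Integration by parts: the derivative of [kap t k a xi * cos (r * xi)] is integrated over the
    half line. The value at xi = 0 leaves a boundary term, 1 for k = 0 and 0 otherwise. In
    [cosI_rec] the sine vanishes at 0 and there is none. At k = 0 the predecessor [k.-1] is
    harmless, its coefficient being 0. *)
Lemma sinI_rec t k a r : adm t a -> r * sinI t k r a =
  (k == 0)%:R + k%:R * cosI t k.-1 r a - a * cosI t k r a - 2 * t * cosI t k.+1 r a.
Proof.
move=> ta.
pose g xi := (k%:R * (kap t k.-1 a xi * cos (r * xi)) - a * (kap t k a xi * cos (r * xi))
    - 2 * t * (kap t k.+1 a xi * cos (r * xi))) - r * (kap t k a xi * sin (r * xi)).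
have ic j := integrable_kap_cos j r ta.
have is_ j := integrable_kap_sin j r ta.
have gE : \int[leb]_(xi in `[0, +oo[) g xi = 0 - kap t k a 0 * cos (r * 0).
  apply: (@Rintegral_FTC_cy _ (fun xi => kap t k a xi * cos (r * xi))).
  - move=> x; eapply hasd_continuous; rewrite /g /kap; isd.
  - by do ![apply: integrableRB => //|apply: integrableRZl => //].
  - move=> x; eapply hasd_eq; first (apply: hasd_mul; [exact: hasd_kap|isd]).
    rewrite /g /=; ring.
  - by apply: kap_cvg0 => // x; exact: cos_max.
move: gE; rewrite /g RintegralB//; last 2 first.
- by do ![apply: integrableRB => //|apply: integrableRZl => //].
- by apply: integrableRZl.
rewrite RintegralB//; last 2 first.
- by do ![apply: integrableRB => //|apply: integrableRZl => //].
- by apply: integrableRZl.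
rewrite RintegralB//; last 2 first.
- by apply: integrableRZl.
- by apply: integrableRZl.
rewrite !RintegralZl// mulr0 cos0 mulr1 -/(cosI t k.-1 r a) -/(cosI t k r a) -/(cosI t k.+1 r a) -/(sinI t k r a).
by case: k {ic is_ g} => [|k]; rewrite ?kap00 ?kapS0 /=; lra.
Qed.

Lemma cosI_rec t k a r : adm t a -> r * cosI t k r a =
  - (k%:R * sinI t k.-1 r a - a * sinI t k r a - 2 * t * sinI t k.+1 r a).
Proof.
move=> ta.
pose g xi := (k%:R * (kap t k.-1 a xi * sin (r * xi)) - a * (kap t k a xi * sin (r * xi))
    - 2 * t * (kap t k.+1 a xi * sin (r * xi))) + r * (kap t k a xi * cos (r * xi)).
have ic j := integrable_kap_cos j r ta.
have is_ j := integrable_kap_sin j r ta.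
have gE : \int[leb]_(xi in `[0, +oo[) g xi = 0 - kap t k a 0 * sin (r * 0).
  apply: (@Rintegral_FTC_cy _ (fun xi => kap t k a xi * sin (r * xi))).
  - move=> x; eapply hasd_continuous; rewrite /g /kap; isd.
  - apply: integrableRD => //; last by apply: integrableRZl.
    by do ![apply: integrableRB => //|apply: integrableRZl => //].
  - move=> x; eapply hasd_eq; first (apply: hasd_mul; [exact: hasd_kap|isd]).
    rewrite /g /=; ring.
  - by apply: kap_cvg0 => // x; exact: sin_max.
move: gE; rewrite /g RintegralD//; last 2 first.
- by do ![apply: integrableRB => //|apply: integrableRZl => //].
- by apply: integrableRZl.
rewrite RintegralB//; last 2 first.
- by do ![apply: integrableRB => //|apply: integrableRZl => //].
- by apply: integrableRZl.
rewrite RintegralB//; last 2 first.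
- by apply: integrableRZl.
- by apply: integrableRZl.
rewrite !RintegralZl// mulr0 sin0 mulr0 -/(sinI t k.-1 r a) -/(sinI t k r a) -/(sinI t k.+1 r a) -/(cosI t k r a).
lra.
Qed.

End TrigLaplace.

Section ParamOn.
Context d1 d2 (T1 : measurableType d1) (T2 : measurableType d2) (R : realType).
Variables (m2 : {sigma_finite_measure set T2 -> \bar R}).

Lemma measurable_Rintegral_param_on (f : T1 * T2 -> R) (D : set T2) :
  measurable D -> measurable_fun setT f ->
  measurable_fun setT (fun x => \int[m2]_(y in D) f (x, y)).
Proof.
move=> mD mf.
have -> : (fun x => \int[m2]_(y in D) f (x, y)) =
    (fun x => \int[m2]_y (fun z => f z * \1_D z.2) (x, y)).
  apply/funext => x; rewrite Rintegral_mkcond; apply: eq_Rintegral => y _ /=.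
  by rewrite patchE indicE; case: ifP => _; rewrite ?mulr1 ?mulr0.
have mi : measurable_fun setT (\1_D : T2 -> R) by exact: measurable_indic.
exact: (measurable_Rintegral_param m2
  (measurable_funM mf (measurableT_comp mi measurable_snd))).
Qed.

End ParamOn.

Section TrigLaplaceFacts.
Context {R : realType}.
Local Notation leb := (@lebesgue_measure R).
Implicit Types (t a r xi : R) (k : nat).

Lemma measurable_cosI_pair t k :
  measurable_fun setT (fun p : R * R => cosI t k p.1 p.2).
Proof.
rewrite /cosI.
apply: (@measurable_Rintegral_param_on _ _ _ _ R leb
  (fun q : (R * R) * R => kap t k q.1.2 q.2 * cos (q.1.1 * q.2))) => //.
rewrite /kap; mfun.
Qed.

Lemma measurable_sinI_pair t k :
  measurable_fun setT (fun p : R * R => sinI t k p.1 p.2).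
Proof.
rewrite /sinI.
apply: (@measurable_Rintegral_param_on _ _ _ _ R leb
  (fun q : (R * R) * R => kap t k q.1.2 q.2 * sin (q.1.1 * q.2))) => //.
rewrite /kap; mfun.
Qed.

Lemma measurable_cosI d (T : measurableType d) t k (f g : T -> R) :
  measurable_fun setT f -> measurable_fun setT g ->
  measurable_fun setT (fun x => cosI t k (f x) (g x)).
Proof.
move=> mf mg.
exact: (measurableT_comp (measurable_cosI_pair t k) (measurable_fun_pair mf mg)).
Qed.

Lemma measurable_sinI d (T : measurableType d) t k (f g : T -> R) :
  measurable_fun setT f -> measurable_fun setT g ->
  measurable_fun setT (fun x => sinI t k (f x) (g x)).
Proof.
move=> mf mg.
exact: (measurableT_comp (measurable_sinI_pair t k) (measurable_fun_pair mf mg)).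
Qed.

Lemma cosIN t k r a : cosI t k (- r) a = cosI t k r a.
Proof. by apply: eq_Rintegral => x _; rewrite mulNr cosN. Qed.

Lemma sinIN t k r a : adm t a -> sinI t k (- r) a = - sinI t k r a.
Proof.
move=> ta; rewrite /sinI -RintegralN//; last exact: integrable_kap_sin.
by apply: eq_Rintegral => x _; rewrite mulNr sinN mulrN.
Qed.

Lemma adm0 a : 0 < a -> adm 0 a.
Proof. by move=> a0; rewrite /adm eqxx a0 orbT. Qed.

Lemma admt t a : 0 < t -> adm t a.
Proof. by rewrite /adm => ->. Qed.

Lemma sqrD_gt0 (r a : R) : 0 < a -> 0 < r ^+ 2 + a ^+ 2.
Proof. by move=> a0; rewrite ltr_wpDl ?sqr_ge0// exprn_gt0. Qed.

(** At t = 0 and k = 0 the two recurrences close up into the linear system r C = a S, r S = 1 - a C,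
    which determines C and S. *)
Lemma cosI00 r a : 0 < a -> cosI 0 0 r a = a / (r ^+ 2 + a ^+ 2).
Proof.
move=> a0; have := sinI_rec 0 r (adm0 a0); have := cosI_rec 0 r (adm0 a0).
have := sqrD_gt0 r a0 => p.
rewrite /= => h1 h2; apply: (mulIf (lt0r_neq0 p)); rewrite mulfVK ?lt0r_neq0//.
have {}h1 : r * cosI 0 0 r a = a * sinI 0 0 r a by move: h1; lra.
have {}h2 : r * sinI 0 0 r a = 1 - a * cosI 0 0 r a by move: h2; lra.
have : r * (r * cosI 0 0 r a) = a * (r * sinI 0 0 r a) by rewrite h1; ring.
rewrite h2; lra.
Qed.

Lemma sinI00 r a : 0 < a -> sinI 0 0 r a = r / (r ^+ 2 + a ^+ 2).
Proof.
move=> a0; have := cosI_rec 0 r (adm0 a0); rewrite cosI00//= => h.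
have := sqrD_gt0 r a0 => p.
have {}h : a * sinI 0 0 r a = a * (r / (r ^+ 2 + a ^+ 2)) by move: h; lra.
by apply: (mulfI _ h); rewrite gt_eqF.
Qed.

Lemma normr_cosI_le t k r a : adm t a ->
  `|cosI t k r a| <= \int[leb]_(xi in `[0, +oo[) kap t k a xi.
Proof.
move=> ta; apply: normr_Rintegral_le => //.
- by apply: measurable_funTS; rewrite /kap; mfun.
- exact: integrable_kap.
- move=> x /=; rewrite in_itv/= andbT => x0.
  by rewrite normrM ger0_norm ?kap_ge0// ler_piMr ?kap_ge0 ?cos_max.
Qed.

Lemma normr_sinI_le t k r a : adm t a ->
  `|sinI t k r a| <= \int[leb]_(xi in `[0, +oo[) kap t k a xi.
Proof.
move=> ta; apply: normr_Rintegral_le => //.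
- by apply: measurable_funTS; rewrite /kap; mfun.
- exact: integrable_kap.
- move=> x /=; rewrite in_itv/= andbT => x0.
  by rewrite normrM ger0_norm ?kap_ge0// ler_piMr ?kap_ge0 ?sin_max.
Qed.

Lemma kapSr t k a xi : kap t k.+1 a xi = xi * kap t k a xi.
Proof. by rewrite /kap exprS mulrA. Qed.

Lemma hasd_cosI_r t k r a : adm t a ->
  hasd (fun r => cosI t k r a) r (- sinI t k.+1 r a).
Proof.
move=> ta; rewrite /sinI -RintegralN//; last exact: integrable_kap_sin.
apply: (@hasd_Rintegral R _ _ leb (fun r xi => kap t k a xi * cos (r * xi))
  (fun r xi => - (kap t k.+1 a xi * sin (r * xi))) _ r (r - 1) (r + 1) (kap t k.+1 a)) => //.
- by apply/andP; split; lra.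
- by move=> x _; exact: integrable_kap_cos.
- move=> x xi _ _; eapply hasd_eq; first isd.
  by rewrite /= kapSr; ring.
- exact: integrable_kap.
- move=> x xi _ /=; rewrite in_itv/= andbT => x0.
  by rewrite normrN normrM ger0_norm ?kap_ge0// ler_piMr ?kap_ge0 ?sin_max.
Qed.

Lemma hasd_sinI_r t k r a : adm t a ->
  hasd (fun r => sinI t k r a) r (cosI t k.+1 r a).
Proof.
move=> ta; rewrite /cosI.
apply: (@hasd_Rintegral R _ _ leb (fun r xi => kap t k a xi * sin (r * xi))
  (fun r xi => (kap t k.+1 a xi * cos (r * xi))) _ r (r - 1) (r + 1) (kap t k.+1 a)) => //.
- by apply/andP; split; lra.
- by move=> x _; exact: integrable_kap_sin.
- move=> x xi _ _; eapply hasd_eq; first isd.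
  by rewrite /= kapSr; ring.
- exact: integrable_kap.
- move=> x xi _ /=; rewrite in_itv/= andbT => x0.
  by rewrite normrM ger0_norm ?kap_ge0// ler_piMr ?kap_ge0 ?cos_max.
Qed.

(** Gaussian decay makes the integral smooth in a also at and below a = 0, so that primitives can be
    differentiated across the height where the argument [y.2 - a] changes sign. *)
Lemma hasd_cosI_a t k r a : 0 < t ->
  hasd (fun a => cosI t k r a) a (- cosI t k.+1 r a).
Proof.
move=> t0; rewrite /cosI -RintegralN//; last exact/integrable_kap_cos/admt.
have [M H] := kap_gauss_le k.+1 (`|a| + 1) t0.
have Mi : leb.-integrable `[0, +oo[ (EFin \o (fun xi => M * expR (- (2^-1 * xi)))).
  by apply: integrableRZl => //; apply: integrable_expR; lra.
apply: (@hasd_Rintegral R _ _ leb (fun a xi => kap t k a xi * cos (r * xi))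
  (fun a xi => - (kap t k.+1 a xi * cos (r * xi))) _ a (a - 1) (a + 1)
  (fun xi => M * expR (- (2^-1 * xi)))) => //.
- by apply/andP; split; lra.
- by move=> x _; exact/integrable_kap_cos/admt.
- move=> x xi _ _; rewrite /kap; eapply hasd_eq; first isd.
  by rewrite /= (exprS xi k); ring.
- move=> x xi /andP[x1 x2] /=; rewrite in_itv/= andbT => x0.
  rewrite normrN normrM ger0_norm ?kap_ge0//.
  rewrite (@le_trans _ _ (kap t k.+1 x xi))// ?ler_piMr ?kap_ge0 ?cos_max//.
  apply: H => //; rewrite ler_norml.
  by have := ler_norm a; have := ler_norm (- a); rewrite normrN; lra.
Qed.

Lemma kap_int_bound t k A : 0 < t -> exists2 M : R, 0 <= M & forall a, `|a| <= A ->
  \int[leb]_(xi in `[0, +oo[) kap t k a xi <= M.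
Proof.
move=> t0; have [M H] := kap_gauss_le k A t0.
have Mi : leb.-integrable `[0, +oo[ (EFin \o (fun xi => M * expR (- (2^-1 * xi)))).
  by apply: integrableRZl => //; apply: integrable_expR; lra.
exists (`|\int[leb]_(xi in `[0, +oo[) (M * expR (- (2^-1 * xi)))|) => //.
move=> a aA; apply: le_trans (ler_norm _).
apply: le_Rintegral => //; first exact/integrable_kap/admt.
by move=> x /=; rewrite in_itv/= andbT => x0; exact: H.
Qed.

Lemma trigI_bound t k A : 0 < t -> exists2 M : R, 0 <= M & forall r a, `|a| <= A ->
  `|cosI t k r a| <= M /\ `|sinI t k r a| <= M.
Proof.
move=> t0; have [M M0 H] := kap_int_bound k A t0; exists M => // r a aA.
split; apply: le_trans (H _ aA).
- exact/normr_cosI_le/admt.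
- exact/normr_sinI_le/admt.
Qed.

Let lin_bound (n A t x y z a bx bY bz : R) : 0 <= n -> 0 <= t -> `|a| <= A ->
  `|x| <= bx -> `|y| <= bY -> `|z| <= bz ->
  `|n * x - a * y - 2 * t * z| <= n * bx + A * bY + 2 * t * bz.
Proof.
move=> n0 t0 aA xb yb zb.
apply: le_trans (ler_normB _ _) _; apply: lerD; last first.
  by rewrite !normrM (ger0_norm t0) ger0_norm// ler_wpM2l// mulr_ge0.
apply: le_trans (ler_normB _ _) _; apply: lerD.
  by rewrite normrM ger0_norm// ler_wpM2l.
by rewrite normrM ler_pM.
Qed.

(** The recurrences express r times an integral through integrals of neighbouring exponents, which
    are bounded uniformly for |a| <= A. *)
Lemma trigI_bound1 t k A : 0 < t -> exists2 M : R, 0 <= M & forall r a, `|a| <= A ->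
  `|r * cosI t k r a| <= M /\ `|r * sinI t k r a| <= M.
Proof.
move=> t0; have [M1 M10 H1] := trigI_bound k.-1 A t0.
have [M2 M20 H2] := trigI_bound k A t0.
have [M3 M30 H3] := trigI_bound k.+1 A t0.
exists (`|1 + (k%:R * M1 + A * M2 + 2 * t * M3)|) => // r a aA.
have [h1 h1'] := H1 r a aA; have [h2 h2'] := H2 r a aA; have [h3 h3'] := H3 r a aA.
have A0 : 0 <= A by apply: le_trans aA.
have ta := admt a t0.
have bc := lin_bound (ler0n R k) (ltW t0) aA h1 h2 h3.
have bs := lin_bound (ler0n R k) (ltW t0) aA h1' h2' h3'.
split.
  rewrite (cosI_rec _ _ ta) normrN; apply: le_trans bs _.
  by apply: le_trans (ler_norm _); rewrite lerDr.
rewrite (sinI_rec _ _ ta) -2!addrA addrA; set c := _ - _ in bc.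
have -> : (k == 0)%:R + k%:R * cosI t k.-1 r a +
    (- (a * cosI t k r a) - 2 * t * cosI t k.+1 r a) = (k == 0)%:R + c.
  by rewrite /c !addrA.
apply: le_trans (ler_normD _ _) _.
apply: le_trans (ler_norm _); apply: lerD => //.
by case: (k == 0); rewrite /= ?normr1 ?normr0.
Qed.

(* Two integrations by parts, i.e. two uses of the recurrences. *)
Lemma trigI_decay t k A : 0 < t -> exists2 M : R, 0 <= M & forall r a, `|a| <= A ->
  `|cosI t k.+1 r a| <= M / (1 + r ^+ 2) /\ `|sinI t k.+1 r a| <= M / (1 + r ^+ 2).
Proof.
(* [M0] bounds the integral itself. For r^2 times the integral, the recurrence of exponent [k.+1],
   which has no boundary term, is multiplied by r once more; this leaves r times integrals of
   exponents [k], [k.+1], [k.+2]. *)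
move=> t0; have [M0 M00 H0] := trigI_bound k.+1 A t0.
have [M1 M10 H1] := trigI_bound1 k A t0.
have [M2 M20 H2] := trigI_bound1 k.+1 A t0.
have [M3 M30 H3] := trigI_bound1 k.+2 A t0.
exists (`|M0 + (k.+1%:R * M1 + A * M2 + 2 * t * M3)|) => // r a aA.
have [h0 h0'] := H0 r a aA; have [h1 h1'] := H1 r a aA.
have [h2 h2'] := H2 r a aA; have [h3 h3'] := H3 r a aA.
have ta := admt a t0.
have bc := lin_bound (ler0n R k.+1) (ltW t0) aA h1 h2 h3.
have bs := lin_bound (ler0n R k.+1) (ltW t0) aA h1' h2' h3'.
have r2 : 0 < 1 + r ^+ 2 by rewrite ltr_wpDr// sqr_ge0.
have main (x : R) B : `|x| <= M0 -> `|r ^+ 2 * x| <= B -> `|x| <= `|M0 + B| / (1 + r ^+ 2).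
  move=> x0 xB; rewrite ler_pdivlMr//; apply: le_trans (ler_norm _).
  rewrite mulrDr mulr1; apply: lerD => //.
  by rewrite mulrC; move: xB; rewrite normrM (ger0_norm (sqr_ge0 _)).
split; apply: main => //.
- rewrite expr2 -mulrA (cosI_rec _ _ ta) mulrN normrN; apply: le_trans bs.
  by rewrite le_eqVlt; apply/orP; left; apply/eqP; congr (`| _ |); rewrite /=; ring.
- rewrite expr2 -mulrA (sinI_rec _ _ ta); apply: le_trans bc.
  by rewrite le_eqVlt; apply/orP; left; apply/eqP; congr (`| _ |); rewrite /=; ring.
Qed.

End TrigLaplaceFacts.

(** * Fourier transforms of the heat and Poisson kernels, and convolutions *)

Section FourierPairs.
Context {R : realType}.
Local Notation leb := (@lebesgue_measure R).
Implicit Types (t a b r s y xi : R) (k : nat) (g : R -> R).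

(** By [cosI_rec] the function satisfies C' = - r C / (2 t), so its product with exp(r^2 / (4 t))
    has derivative 0. *)
Lemma cosI_gauss t r : 0 < t ->
  cosI t 0 r 0 = cosI t 0 0 0 * expR (- (r ^+ 2 / (4 * t))).
Proof.
move=> t0.
pose f r := cosI t 0 r 0 * expR (r ^+ 2 / (4 * t)).
have df x : hasd f x 0.
  rewrite /f; eapply hasd_eq.
    apply: hasd_mul; first exact/hasd_cosI_r/admt.
    isd.
  have h : sinI t 1 x 0 = x * cosI t 0 x 0 / (2 * t).
    have := cosI_rec 0 x (admt 0 t0); rewrite /= => ->; field.
    by rewrite gt_eqF.
  by rewrite /= h; field; rewrite gt_eqF.
have := is_derive_0_is_cst r 0 df; rewrite /f expr0n/= mul0r expR0 mulr1 => <-.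
by rewrite -mulrA -expRD addrN expR0 mulr1.
Qed.

Lemma Gamma0_ge0 r t : 0 <= Gamma0 r t.
Proof. by rewrite /Gamma0 divr_ge0// ?expR_ge0// sqrtr_ge0. Qed.

Lemma Gamma0N r t : Gamma0 (- r) t = Gamma0 r t.
Proof. by rewrite /Gamma0 sqrrN. Qed.

Lemma Gamma0_normal r t : 0 < t -> Gamma0 r t = normal_pdf 0 (Num.sqrt (2 * t)) r.
Proof.
move=> t0; have t20 : 0 < 2 * t by lra.
rewrite normal_pdfE; last by rewrite gt_eqF// sqrtr_gt0.
rewrite /normal_peak /normal_fun /Gamma0 sqr_sqrtr; last by rewrite ltW.
rewrite mulrC; congr (_^-1 * expR _).
  by congr Num.sqrt; rewrite -mulr_natl; ring.
by rewrite subr0 mulNr; congr (- (_ / _)); rewrite -mulr_natl; ring.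
Qed.

Lemma integrable_Gamma0 t : 0 < t -> leb.-integrable setT (EFin \o (fun s => Gamma0 s t)).
Proof.
move=> t0; apply: eq_integrable (integrable_normal_pdf 0 (Num.sqrt (2 * t))) => //.
by move=> x _; rewrite /= Gamma0_normal.
Qed.

Lemma Rintegral_Gamma0 t : 0 < t -> \int[leb]_s Gamma0 s t = 1.
Proof.
move=> t0; rewrite /Rintegral.
under eq_integral do rewrite Gamma0_normal//.
by rewrite integral_normal_pdf.
Qed.

Lemma pi4_gt0 t : 0 < t -> 0 < 4 * pi * t :> R.
Proof. by move=> t0; rewrite !mulr_gt0// ?pi_gt0. Qed.

(** A factor 1 + v^2 is paid for by doubling the time. With u = v^2 / (8 t) this is (1 + 8 t u)
    exp(- u) <= 1 + 8 t, from exp u >= 1 + u; sqrt 2 is the ratio of the normalisations. *)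
Lemma Gamma0_moment t v : 0 < t ->
  (1 + v ^+ 2) * Gamma0 v t <= (1 + 8 * t) * Num.sqrt 2 * Gamma0 v (2 * t).
Proof.
move=> t0; have N0 : 0 < Num.sqrt (4 * pi * t) by rewrite sqrtr_gt0 pi4_gt0.
have N20 : 0 < Num.sqrt 2 :> R by rewrite sqrtr_gt0.
rewrite /Gamma0 (_ : 4 * pi * (2 * t) = 2 * (4 * pi * t)); last ring.
rewrite (@sqrtrM _ 2)//.
have -> : (1 + 8 * t) * Num.sqrt 2 * (expR (- (v ^+ 2 / (4 * (2 * t)))) /
    (Num.sqrt 2 * Num.sqrt (4 * pi * t))) =
    (1 + 8 * t) * expR (- (v ^+ 2 / (8 * t))) / Num.sqrt (4 * pi * t).
  have -> : 4 * (2 * t) = 8 * t by ring.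
  by field; rewrite !gt_eqF.
rewrite mulrA ler_pM2r ?invr_gt0//.
have -> : - (v ^+ 2 / (4 * t)) = - (v ^+ 2 / (8 * t)) + - (v ^+ 2 / (8 * t)).
  by field; rewrite gt_eqF.
rewrite expRD mulrA ler_wpM2r ?expR_ge0//.
set u := v ^+ 2 / (8 * t).
have u0 : 0 <= u by rewrite divr_ge0 ?sqr_ge0//; lra.
have vE : v ^+ 2 = 8 * t * u by rewrite /u; field; rewrite gt_eqF.
have e1 : (1 + u) * expR (- u) <= 1.
  by rewrite expRN ler_pdivrMr ?expR_gt0// mul1r expR_ge1Dx.
have e0 : 0 <= expR (- u) by exact: expR_ge0.
have ue0 : 0 <= u * expR (- u) by exact: mulr_ge0.
rewrite vE mulrDl mul1r; apply: lerD; first lra.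
by rewrite -mulrA ler_piMr; lra.
Qed.

Lemma integrable_mulGamma0 t : 0 < t ->
  leb.-integrable setT (EFin \o (fun s => s * Gamma0 s t)).
Proof.
move=> t0; have t20 : 0 < 2 * t by lra.
have gi : leb.-integrable setT
    (EFin \o (fun s => (1 + 8 * t) * Num.sqrt 2 * Gamma0 s (2 * t))).
  by apply: integrableRZl => //; exact: integrable_Gamma0.
apply: le_integrableR gi => //; first by rewrite /Gamma0; mfun.
move=> v _; apply: le_trans (Gamma0_moment v t0).
rewrite normrM (ger0_norm (Gamma0_ge0 _ _)) ler_wpM2r ?Gamma0_ge0//.
by rewrite ler_norml; nra.
Qed.

Lemma integrable_trig (f h : R -> R) : leb.-integrable setT (EFin \o f) ->
  measurable_fun setT h -> (forall x, `|h x| <= 1) ->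
  leb.-integrable setT (EFin \o (fun s => f s * h s)).
Proof. by move=> fi mh h1; apply: (@integrableRMb _ _ _ _ _ _ _ _ 1). Qed.

Let th_gt0 t : 0 < t -> 0 < (4 * t)^-1.
Proof. by move=> t0; rewrite invr_gt0; lra. Qed.

(** The heat kernel is itself a [kap], with time parameter (4 t)^-1; its own Fourier transform is
    thus again a [cosI]. *)
Lemma Gamma0_kap t s : 0 < t ->
  Gamma0 s t = (Num.sqrt (4 * pi * t))^-1 * kap (4 * t)^-1 0 0 s.
Proof.
move=> t0; rewrite /Gamma0 /kap expr0 mul1r mul0r oppr0 sub0r mulrC.
by rewrite (mulrC _ (s ^+ 2)).
Qed.

Lemma Gamma0_cos t xi : 0 < t ->
  \int[leb]_s (Gamma0 s t * cos (s * xi)) = expR (- (t * xi ^+ 2)).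
Proof.
move=> t0; set N := (Num.sqrt (4 * pi * t))^-1.
have E z : \int[leb]_s (Gamma0 s t * cos (s * z)) = 2 * N * cosI (4 * t)^-1 0 z 0.
  rewrite Rintegral_fold; last first.
    by apply: integrable_trig; [exact: integrable_Gamma0|mfun|move=> x; exact: cos_max].
  rewrite -RintegralZl//; last exact/integrable_kap_cos/admt/th_gt0.
  apply: eq_Rintegral => s _.
  by rewrite Gamma0N mulNr cosN Gamma0_kap// -/N (mulrC s z); ring.
(* At frequency 0 the left side is the total mass 1; this fixes the constant in [E] without
   evaluating it. *)
have := E 0; under eq_Rintegral do rewrite mulr0 cos0 mulr1.
rewrite Rintegral_Gamma0// => e1.
rewrite E (cosI_gauss _ (th_gt0 t0)) mulrA -e1 mul1r.
by congr (expR (- _)); field; rewrite gt_eqF.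
Qed.

Lemma Gamma0_sin t xi : 0 < t -> \int[leb]_s (Gamma0 s t * sin (s * xi)) = 0.
Proof.
move=> t0; rewrite Rintegral_fold; last first.
  by apply: integrable_trig; [exact: integrable_Gamma0|mfun|move=> x; exact: sin_max].
under eq_Rintegral do rewrite Gamma0N mulNr sinN mulrN addrN.
by rewrite Rintegral_cst// mul0r.
Qed.

Definition dGamma0 r t : R := - (r / (2 * t)) * Gamma0 r t.

Lemma hasd_Gamma0 r t : 0 < t -> hasd (fun r => Gamma0 r t) r (dGamma0 r t).
Proof.
move=> t0; rewrite /dGamma0 /Gamma0; eapply hasd_eq; first isd.
have N0 : 0 < Num.sqrt (4 * pi * t) by rewrite sqrtr_gt0 pi4_gt0.
by rewrite /=; field; rewrite !gt_eqF.
Qed.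

Lemma integrable_dGamma0 t : 0 < t ->
  leb.-integrable setT (EFin \o (fun s => dGamma0 s t)).
Proof.
move=> t0; have := @integrableRZl _ _ _ leb _ measurableT (- (2 * t)^-1) _ (integrable_mulGamma0 t0).
by apply: eq_integrable => // s _ /=; rewrite /dGamma0; congr EFin; ring.
Qed.

(** [cosI_rec] of exponent 0 at height 0 reads xi C = 2 t' S, with S the sine integral of exponent 1
    and t' = (4 t)^-1; C is already known from [Gamma0_cos]. *)
Lemma dGamma0_sin t xi : 0 < t ->
  \int[leb]_s (dGamma0 s t * sin (s * xi)) = - (xi * expR (- (t * xi ^+ 2))).
Proof.
move=> t0; set N := (Num.sqrt (4 * pi * t))^-1.
have th0 := th_gt0 t0.
have -> : \int[leb]_s (dGamma0 s t * sin (s * xi)) =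
    - (t^-1 * N) * sinI (4 * t)^-1 1 xi 0.
  rewrite Rintegral_fold; last first.
    by apply: integrable_trig; [exact: integrable_dGamma0|mfun|move=> x; exact: sin_max].
  rewrite -RintegralZl//; last exact/integrable_kap_sin/admt.
  apply: eq_Rintegral => s _.
  rewrite /dGamma0 Gamma0N (mulNr s xi) sinN kapSr Gamma0_kap// -/N (mulrC s xi).
  by field; rewrite gt_eqF.
have -> : expR (- (t * xi ^+ 2)) = 2 * N * cosI (4 * t)^-1 0 xi 0.
  rewrite -Gamma0_cos// Rintegral_fold; last first.
    by apply: integrable_trig; [exact: integrable_Gamma0|mfun|move=> x; exact: cos_max].
  rewrite -RintegralZl//; last exact/integrable_kap_cos/admt.
  apply: eq_Rintegral => s _.
  by rewrite Gamma0N mulNr cosN Gamma0_kap// -/N (mulrC s xi); ring.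
have := cosI_rec 0 xi (admt 0 th0); rewrite /= => h.
rewrite mulrCA h; field; rewrite gt_eqF//=.
Qed.

Lemma dGamma0_cos t xi : 0 < t -> \int[leb]_s (dGamma0 s t * cos (s * xi)) = 0.
Proof.
move=> t0; rewrite Rintegral_fold; last first.
  by apply: integrable_trig; [exact: integrable_dGamma0|mfun|move=> x; exact: cos_max].
under eq_Rintegral do rewrite /dGamma0 Gamma0N !mulNr cosN opprK addNr.
by rewrite Rintegral_cst// mul0r.
Qed.

Section Convolution.
Variables (g gc gs : R -> R).
Hypothesis gi : leb.-integrable setT (EFin \o g).
Hypothesis gcE : forall xi, \int[leb]_s (g s * cos (s * xi)) = gc xi.
Hypothesis gsE : forall xi, \int[leb]_s (g s * sin (s * xi)) = gs xi.
Variables (t b : R) (k : nat).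
Hypothesis tb : adm t b.

Let gri r : leb.-integrable setT (EFin \o (fun s => g (r - s))).
Proof. exact: integrable_subl. Qed.

Let gcr r xi : \int[leb]_s (g (r - s) * cos ((r - s) * xi)) = gc xi.
Proof.
rewrite (@Rintegral_subl R r (fun s => g s * cos (s * xi))) ?gcE//.
by apply: integrable_trig => //; [mfun|move=> x; exact: cos_max].
Qed.

Let gsr r xi : \int[leb]_s (g (r - s) * sin ((r - s) * xi)) = gs xi.
Proof.
rewrite (@Rintegral_subl R r (fun s => g s * sin (s * xi))) ?gsE//.
by apply: integrable_trig => //; [mfun|move=> x; exact: sin_max].
Qed.

(** Fubini, then the splitting (s - y) xi = (r - y) xi - (r - s) xi in the addition formula: the
    s-integral sees only the transforms [gc] and [gs] of g, which appear as multipliers of the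
    integrand. *)
Lemma conv_cosI r y : \int[leb]_s (g (r - s) * cosI t k (s - y) b) =
  \int[leb]_(xi in `[0, +oo[) (kap t k b xi *
     (cos ((r - y) * xi) * gc xi + sin ((r - y) * xi) * gs xi)).
Proof.
have mg := integrableRmeas (gri r).
transitivity (\int[leb]_s \int[leb]_(xi in `[0, +oo[)
    (g (r - s) * (kap t k b xi * cos ((s - y) * xi)))).
  apply: eq_Rintegral => s _; rewrite RintegralZl//.
  exact: integrable_kap_cos.
rewrite (@Rfubini_on _ _ _ _ _ leb leb setT `[0, +oo[ _ _
  (fun z => g (r - z.1) * (kap t k b z.2 * cos ((z.1 - y) * z.2))))//; last first.
  apply: (@integrable_prod_dom _ _ _ _ _ leb leb _ _ _ _ _ (fun s => `|g (r - s)|) (kap t k b)) => //.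
  - apply: measurable_funTS; apply: measurable_funM.
      exact: (measurableT_comp mg measurable_fst).
    rewrite /kap; mfun.
  - by apply: eq_integrable (integrable_norm (gri r)).
  - exact: integrable_kap.
  - move=> s xi _ /=; rewrite in_itv/= andbT => x0.
    rewrite normrM ler_wpM2l// normrM ger0_norm ?kap_ge0// ler_piMr ?kap_ge0//.
    exact: cos_max.
apply: eq_Rintegral => xi _ /=.
have ic : leb.-integrable setT (EFin \o (fun s => g (r - s) * cos ((r - s) * xi))).
  by apply: integrable_trig => //; [mfun|move=> x; exact: cos_max].
have is_ : leb.-integrable setT (EFin \o (fun s => g (r - s) * sin ((r - s) * xi))).
  by apply: integrable_trig => //; [mfun|move=> x; exact: sin_max].
have icZ := integrableRZl measurableT (cos ((r - y) * xi)) ic.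
have isZ := integrableRZl measurableT (sin ((r - y) * xi)) is_.
transitivity (\int[leb]_s (kap t k b xi *
   (cos ((r - y) * xi) * (g (r - s) * cos ((r - s) * xi)) +
    sin ((r - y) * xi) * (g (r - s) * sin ((r - s) * xi))))).
  apply: eq_Rintegral => s _.
  rewrite (_ : (s - y) * xi = (r - y) * xi - (r - s) * xi); last ring.
  by rewrite cosB; ring.
rewrite RintegralZl//; last exact: integrableRD.
by rewrite RintegralD// RintegralZl// RintegralZl// gcr gsr.
Qed.

Lemma conv_sinI r y : \int[leb]_s (g (r - s) * sinI t k (s - y) b) =
  \int[leb]_(xi in `[0, +oo[) (kap t k b xi *
     (sin ((r - y) * xi) * gc xi - cos ((r - y) * xi) * gs xi)).
Proof.
have mg := integrableRmeas (gri r).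
transitivity (\int[leb]_s \int[leb]_(xi in `[0, +oo[)
    (g (r - s) * (kap t k b xi * sin ((s - y) * xi)))).
  apply: eq_Rintegral => s _; rewrite RintegralZl//.
  exact: integrable_kap_sin.
rewrite (@Rfubini_on _ _ _ _ _ leb leb setT `[0, +oo[ _ _
  (fun z => g (r - z.1) * (kap t k b z.2 * sin ((z.1 - y) * z.2))))//; last first.
  apply: (@integrable_prod_dom _ _ _ _ _ leb leb _ _ _ _ _ (fun s => `|g (r - s)|) (kap t k b)) => //.
  - apply: measurable_funTS; apply: measurable_funM.
      exact: (measurableT_comp mg measurable_fst).
    rewrite /kap; mfun.
  - by apply: eq_integrable (integrable_norm (gri r)).
  - exact: integrable_kap.
  - move=> s xi _ /=; rewrite in_itv/= andbT => x0.
    rewrite normrM ler_wpM2l// normrM ger0_norm ?kap_ge0// ler_piMr ?kap_ge0//.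
    exact: sin_max.
apply: eq_Rintegral => xi _ /=.
have ic : leb.-integrable setT (EFin \o (fun s => g (r - s) * cos ((r - s) * xi))).
  by apply: integrable_trig => //; [mfun|move=> x; exact: cos_max].
have is_ : leb.-integrable setT (EFin \o (fun s => g (r - s) * sin ((r - s) * xi))).
  by apply: integrable_trig => //; [mfun|move=> x; exact: sin_max].
have icZ := integrableRZl measurableT (sin ((r - y) * xi)) ic.
have isZ := integrableRZl measurableT (cos ((r - y) * xi)) is_.
transitivity (\int[leb]_s (kap t k b xi *
   (sin ((r - y) * xi) * (g (r - s) * cos ((r - s) * xi)) -
    cos ((r - y) * xi) * (g (r - s) * sin ((r - s) * xi))))).
  apply: eq_Rintegral => s _.
  rewrite (_ : (s - y) * xi = (r - y) * xi - (r - s) * xi); last ring.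
  by rewrite sinB; ring.
rewrite RintegralZl//; last exact: integrableRB.
by rewrite RintegralB// RintegralZl// RintegralZl// gcr gsr.
Qed.

End Convolution.

End FourierPairs.

(** * The Fourier transform of the Poisson kernel *)

Section PoissonFourier.
Context {R : realType}.
Local Notation leb := (@lebesgue_measure R).
Implicit Types (t a b r s y xi : R) (k : nat).

Lemma poissonE b s : 0 < b -> poisson b s = cosI 0 0 s b / pi.
Proof.
move=> b0; rewrite cosI00// /poisson; have := sqrD_gt0 s b0 => p.
by move: (@pi R) (pi_gt0 R) => q q0; field; rewrite (gt_eqF p) (gt_eqF q0).
Qed.

(** The integrand is even and nonnegative, and its primitive atan (s / b) is bounded. *)
Lemma integrable_cosI00 b : 0 < b -> leb.-integrable setT (EFin \o (fun s => cosI 0 0 s b)).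
Proof.
move=> b0.
have cE : (fun s => cosI 0 0 s b) = (fun s => b / (s ^+ 2 + b ^+ 2)).
  by apply/funext => s; exact: cosI00.
have p s := sqrD_gt0 s b0.
have cc : continuous (fun s => cosI 0 0 s b).
  move=> s; rewrite cE; eapply hasd_continuous; isd; exact: lt0r_neq0 (p s).
have d x : hasd (fun s => atan (b^-1 * s)) x (cosI 0 0 x b).
  eapply hasd_eq; first (apply: (@hasd_comp _ (@atan R)); [isd|exact: is_derive1_atan]).
  rewrite /= cosI00//; have := p x => px.
  have -> : 1 + (b^-1 * x) ^+ 2 = (x ^+ 2 + b ^+ 2) / b ^+ 2 by field; rewrite (gt_eqF b0).
  by field; rewrite (gt_eqF b0) (gt_eqF px).
apply/integrableP; split.
  by apply/measurable_EFinP; exact: continuous_measurable_fun.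
have c0 x : 0 <= cosI 0 0 x b by rewrite cosI00// divr_ge0// ltW.
under eq_integral do rewrite /= ger0_norm//.
rewrite ge0_symfun_integralT//; last first.
  by move=> s /=; rewrite cosIN.
rewrite (_ : [set x | _] = `[0, +oo[%classic); last first.
  by apply/seteqP; split => x/=; rewrite in_itv/= andbT.
rewrite (@ge0_continuous_FTC2y _ _ (fun s => atan (b^-1 * s)) _ (pi / 2)).
- by rewrite -EFinB -EFinM ltry.
- by move=> x _.
- exact: continuous_subspaceT.
- apply: (@cvg_comp _ _ _ (fun x => b^-1 * x) (@atan R)); last exact: cvgy_atan.
  have bi : 0 < b^-1 by rewrite invr_gt0.
  exact: gt0_cvgMry.
- by move=> x _; have [] := d x.
- by apply: cvg_at_right_filter; exact: (hasd_continuous (d 0)).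
- by move=> x _; rewrite derive1E; have [_ ->] := d x.
Qed.

(** First absolute moment, needed for the rate of the Gaussian regularisation. [sinI_rec] at r = 0
    and exponent 0 yields it from the boundary term 1. *)
Let Gabs t : 0 < t -> \int[leb]_v (`|v| * Gamma0 v t) = 4 * t / Num.sqrt (4 * pi * t).
Proof.
move=> t0; have th0 : 0 < (4 * t)^-1 by rewrite invr_gt0; lra.
rewrite Rintegral_fold; last first.
  apply: eq_integrable (integrable_norm (integrable_mulGamma0 t0)) => // v _ /=.
  by rewrite normrM (ger0_norm (Gamma0_ge0 _ _)).
have := sinI_rec 0 0 (admt 0 th0); rewrite /= mul0r => h.
have {}h : cosI (4 * t)^-1 1 0 0 = 2 * t.
  have {}h : 2 * (4 * t)^-1 * cosI (4 * t)^-1 1 0 0 = 1 by move: h; lra.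
  have -> : cosI (4 * t)^-1 1 0 0 = 2 * t * (2 * (4 * t)^-1 * cosI (4 * t)^-1 1 0 0).
    by field; rewrite gt_eqF.
  by rewrite h mulr1.
have -> : 4 * t / Num.sqrt (4 * pi * t) = 2 / Num.sqrt (4 * pi * t) * cosI (4 * t)^-1 1 0 0.
  by rewrite h; ring.
rewrite -RintegralZl//; last exact/integrable_kap_cos/admt.
apply: eq_Rintegral => v; rewrite inE/= in_itv/= andbT => v0.
rewrite Gamma0N normrN (ger0_norm v0) Gamma0_kap// mul0r cos0 kapSr; ring.
Qed.

Lemma expR_sqr_Gamma0 (e s : R) : 0 < e -> expR (- (e * s ^+ 2)) = Num.sqrt (pi / e) * Gamma0 s (4 * e)^-1.
Proof.
move=> e0; rewrite /Gamma0.
have -> : 4 * pi * (4 * e)^-1 = pi / e by field; rewrite gt_eqF.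
have N0 : 0 < Num.sqrt (pi / e) by rewrite sqrtr_gt0 divr_gt0// pi_gt0.
rewrite [RHS]mulrCA mulfV ?lt0r_neq0// mulr1; congr expR; field; rewrite gt_eqF//.
Qed.

Let gauss_cos (e z : R) : 0 < e ->
  \int[leb]_s (expR (- (e * s ^+ 2)) * cos (s * z)) = 2 * pi * Gamma0 z e.
Proof.
move=> e0; have t0 : 0 < (4 * e)^-1 by rewrite invr_gt0; lra.
have -> : \int[leb]_s (expR (- (e * s ^+ 2)) * cos (s * z)) =
    Num.sqrt (pi / e) * \int[leb]_s (Gamma0 s (4 * e)^-1 * cos (s * z)).
  rewrite -RintegralZl//; last first.
    by apply: integrable_trig; [exact: integrable_Gamma0|mfun|move=> x; exact: cos_max].
  by apply: eq_Rintegral => s _; rewrite expR_sqr_Gamma0// mulrA.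
rewrite Gamma0_cos// /Gamma0.
have -> : (4 * e)^-1 * z ^+ 2 = z ^+ 2 / (4 * e) by rewrite mulrC.
have -> : 4 * pi * e = (2 * e) ^+ 2 * (pi / e) by field; rewrite gt_eqF.
rewrite (@sqrtrM _ ((2 * e) ^+ 2)) ?sqr_ge0// sqrtr_sqr ger0_norm; last lra.
have N0 : 0 < Num.sqrt (pi / e) by rewrite sqrtr_gt0 divr_gt0// pi_gt0.
have NN : Num.sqrt (pi / e) ^+ 2 = pi / e by rewrite sqr_sqrtr// divr_ge0 ?pi_ge0// ltW.
move: (Num.sqrt (pi / e)) NN N0 => N NN N0.
have pE : pi = e * N ^+ 2 by rewrite NN; field; rewrite gt_eqF.
by rewrite pE; field; rewrite !gt_eqF.
Qed.

Lemma integrable_expR_sqr (e : R) : 0 < e ->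
  leb.-integrable setT (EFin \o (fun s => expR (- (e * s ^+ 2)))).
Proof.
move=> e0; have t0 : 0 < (4 * e)^-1 by rewrite invr_gt0; lra.
have := @integrableRZl _ _ _ leb _ measurableT (Num.sqrt (pi / e)) _ (integrable_Gamma0 t0).
by apply: eq_integrable => // s _ /=; rewrite expR_sqr_Gamma0.
Qed.

(** This is [conv_cosI] at r = y = 0 for g s = exp(- e s^2) cos (s xi). The product of cosines gives
    Gaussians centred at xi and - xi, which the fold merges into one integral over the line. *)
Let Jreg (e b xi : R) : 0 < e -> 0 < b ->
  \int[leb]_s (expR (- (e * s ^+ 2)) * cos (s * xi) * cosI 0 0 s b) =
  pi * \int[leb]_eta (expR (- (b * `|eta|)) * Gamma0 (xi - eta) e).
Proof.
move=> e0 b0.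
pose g s := expR (- (e * s ^+ 2)) * cos (s * xi).
have gi : leb.-integrable setT (EFin \o g).
  by apply: integrable_trig; [exact: integrable_expR_sqr|mfun|move=> x; exact: cos_max].
have gint z : leb.-integrable setT (EFin \o (fun s => expR (- (e * s ^+ 2)) * cos (s * z))).
  by apply: integrable_trig; [exact: integrable_expR_sqr|mfun|move=> x; exact: cos_max].
have gcE z : \int[leb]_s (g s * cos (s * z)) = pi * (Gamma0 (xi - z) e + Gamma0 (xi + z) e).
  transitivity (\int[leb]_s (2^-1 * (expR (- (e * s ^+ 2)) * cos (s * (xi - z)) +
     expR (- (e * s ^+ 2)) * cos (s * (xi + z))))).
    apply: eq_Rintegral => s _; by rewrite /g (mulrBr s) (mulrDr s) cosB cosD; lra.
  rewrite RintegralZl//; last exact: integrableRD.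
  by rewrite RintegralD// !gauss_cos//; lra.
have := @conv_cosI R g _ (fun z => \int[leb]_s (g s * sin (s * z))) gi gcE (fun=> erefl)
  0 b 0 (adm0 b0) 0 0.
rewrite subrr.
have -> : \int[leb]_s (g (0 - s) * cosI 0 0 (s - 0) b) =
    \int[leb]_s (expR (- (e * s ^+ 2)) * cos (s * xi) * cosI 0 0 s b).
  by apply: eq_Rintegral => s _; rewrite /g sub0r subr0 sqrrN mulNr cosN.
move=> ->; rewrite [in RHS]Rintegral_fold; last first.
  have := integrable_subl xi (integrable_Gamma0 e0) => Gi.
  have mG := integrableRmeas Gi.
  apply: le_integrableR Gi => //.
    by apply: measurable_funM => //; mfun.
  move=> x _; rewrite normrM (ger0_norm (Gamma0_ge0 _ _)) ger0_norm ?expR_ge0//.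
  by rewrite ler_piMl ?Gamma0_ge0// -expR0 ler_expR oppr_le0 mulr_ge0// ltW.
rewrite -RintegralZl//; last first.
  have Gi1 := integrable_subl xi (integrable_Gamma0 e0).
  have Gi2 : leb.-integrable setT (EFin \o (fun s => Gamma0 (xi + s) e)).
    apply: eq_integrable (integrable_subl (- xi) (integrable_Gamma0 e0)) => // s _ /=.
    by rewrite -(Gamma0N (xi + s)) opprD.
  have Gi := integrableRD measurableT Gi1 Gi2.
  have Gp : leb.-integrable `[0, +oo[ (EFin \o (fun s => Gamma0 (xi - s) e + Gamma0 (xi + s) e)).
    exact: integrableS Gi.
  apply: le_integrableR Gp => //.
    by rewrite /Gamma0; apply: measurable_funTS; mfun.
  move=> x _; rewrite normrN opprK -mulrDr normrM ger0_norm ?expR_ge0//.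
  rewrite ger0_norm ?addr_ge0 ?Gamma0_ge0// ler_piMl ?addr_ge0 ?Gamma0_ge0//.
  by rewrite -expR0 ler_expR oppr_le0 mulr_ge0// ltW.
apply: eq_Rintegral => eta; rewrite inE/= in_itv/= andbT => eta0.
rewrite normrN (ger0_norm eta0) opprK mul0r cos0 sin0 mul0r addr0 mul1r.
by rewrite /kap expr0 mul1r mul0r subr0; ring.
Qed.

Let expR_lip (x y : R) : 0 <= x -> 0 <= y -> `|expR (- x) - expR (- y)| <= `|x - y|.
Proof.
wlog xy : x y / x <= y => [H x0 y0|x0 _].
  have [xy|/ltW yx] := leP x y; first exact: H.
  by rewrite distrC (distrC x) H.
rewrite ger0_norm; last by rewrite subr_ge0 ler_expR lerN2.
rewrite distrC ger0_norm; last by rewrite subr_ge0.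
have -> : - y = - x + - (y - x) by lra.
rewrite expRD.
have h1 : expR (- x) <= 1 by rewrite -expR0 ler_expR oppr_le0.
have h2 := expR_ge1Dx (- (y - x)).
have h3 := expR_ge0 (- x); have h4 := expR_ge0 (- (y - x)).
nra.
Qed.

Let expG_integrable (e b xi : R) : 0 < e -> 0 < b ->
  leb.-integrable setT (EFin \o (fun eta => expR (- (b * `|eta|)) * Gamma0 (xi - eta) e)).
Proof.
move=> e0 b0; have Gi := integrable_subl xi (integrable_Gamma0 e0).
have mG := integrableRmeas Gi.
apply: le_integrableR Gi => //; first by apply: measurable_funM => //; mfun.
move=> x _; rewrite normrM (ger0_norm (Gamma0_ge0 _ _)) ger0_norm ?expR_ge0//.
by rewrite ler_piMl ?Gamma0_ge0// -expR0 ler_expR oppr_le0 mulr_ge0// ltW.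
Qed.

(** A Gaussian mean around xi of a function that is b-Lipschitz differs from its value at xi by at
    most b times the first absolute moment. *)
Let Jlim (e b xi : R) : 0 < e -> 0 < b ->
  `|\int[leb]_eta (expR (- (b * `|eta|)) * Gamma0 (xi - eta) e) - expR (- (b * `|xi|))|
  <= b * (4 * e / Num.sqrt (4 * pi * e)).
Proof.
move=> e0 b0; have Gi := integrable_subl xi (integrable_Gamma0 e0).
have mG := integrableRmeas Gi.
have Gi' := integrableRZl measurableT (expR (- (b * `|xi|))) Gi.
have -> : expR (- (b * `|xi|)) = \int[leb]_eta (expR (- (b * `|xi|)) * Gamma0 (xi - eta) e).
  rewrite RintegralZl// (@Rintegral_subl R xi (fun s => Gamma0 s e)) ?Rintegral_Gamma0 ?mulr1//.
  exact: integrable_Gamma0.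
have Ei := expG_integrable xi e0 b0.
rewrite -RintegralB//.
have Ai : leb.-integrable setT (EFin \o (fun v => `|v| * Gamma0 v e)).
  apply: eq_integrable (integrable_norm (integrable_mulGamma0 e0)) => // v _ /=.
  by rewrite normrM (ger0_norm (Gamma0_ge0 _ _)).
have Asi := integrable_subl xi Ai.
rewrite -(Gabs e0) -(Rintegral_subl xi Ai) -RintegralZl//.
apply: normr_Rintegral_le => //.
- exact: (integrableRmeas (integrableRB measurableT Ei Gi')).
- exact: integrableRZl.
- move=> x _ /=; rewrite -mulrBl normrM (ger0_norm (Gamma0_ge0 _ _)).
  rewrite [leRHS]mulrA ler_wpM2r ?Gamma0_ge0//; apply: le_trans (expR_lip _ _) _.
  + by rewrite mulr_ge0// ltW.
  + by rewrite mulr_ge0// ltW.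
  + rewrite -mulrBr normrM (gtr0_norm b0) ler_wpM2l ?(ltW b0)// distrC.
    exact: ler_dist_dist.
Qed.

(** Inserting the Laplace integral of [cosI 0 0 s b] gives a double integral that does not converge
    absolutely. A factor exp(- e s^2) makes Fubini available; as e tends to 0, dominated convergence
    applies on one side and [Jlim] on the other. *)
Lemma poisson_cos b xi : 0 < b ->
  \int[leb]_s (cosI 0 0 s b * cos (s * xi)) = pi * expR (- (b * `|xi|)).
Proof.
move=> b0.
(* The regularisation parameter is e = (dl n)^2, so that the error, of order sqrt e, is a multiple
   of [dl n]. *)
pose dl (n : nat) : R := n.+1%:R^-1.
have dl0 n : 0 < dl n by rewrite invr_gt0.
have e0 n : 0 < dl n ^+ 2 by rewrite exprn_gt0.
pose J n := \int[leb]_s (expR (- (dl n ^+ 2 * s ^+ 2)) * cos (s * xi) * cosI 0 0 s b).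
have dlc : dl n @[n --> \oo] --> 0 by exact: cvg_harmonic.
have J1 : J n @[n --> \oo] --> \int[leb]_s (cosI 0 0 s b * cos (s * xi)).
  apply: (@dominated_cvgR _ _ _ leb _ _ _ _ (fun s => `|cosI 0 0 s b|)) => //.
  - move=> n; apply: measurable_funM; first mfun.
    exact: (measurable_cosI _ _ (@measurable_id _ _ _) (@measurable_cst _ _ _ _ _ b)).
  - move=> s _; rewrite -[X in _ --> X]mul1r mulrA (mulrAC _ (cosI _ _ _ _)) mul1r.
    apply: cvgMl; rewrite -[X in _ --> X]mul1r; apply: cvgMl.
    have H : - (dl n ^+ 2 * s ^+ 2) @[n --> \oo] --> - (0 * 0 * s ^+ 2).
      by apply: cvgN; apply: cvgMl; exact: (cvgM dlc dlc).
    rewrite !mul0r oppr0 in H.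
    by have := cvg_comp _ _ H (@continuous_expR R 0); rewrite expR0.
  - exact: (integrable_norm (integrable_cosI00 b0)).
  - move=> n s _; rewrite normrM ler_piMl// normrM (@le_trans _ _ (1 * 1)) ?mulr1//.
    rewrite -[leRHS]mulr1 ler_pM// ?cos_max// ger0_norm ?expR_ge0//.
    by rewrite -expR0 ler_expR oppr_le0 mulr_ge0// ?sqr_ge0// ltW.
apply: (cvg_unique _ J1) => //.
pose K := pi * (b * (4 / Num.sqrt (4 * pi))).
have Kc : K * dl n @[n --> \oo] --> 0 by rewrite -(mulr0 K); exact: cvgMr.
apply/subr_cvg0/norm_cvg0P.
apply: (@squeeze_cvgr _ _ _ _ (cst 0) _ _ _ _ _ Kc); last exact: cvg_cst.
apply: nearW => n; rewrite /= normr_ge0/=.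
have p0 := pi_gt0 R.
rewrite /J Jreg// -mulrBr normrM (gtr0_norm p0) /K -mulrA ler_wpM2l ?(ltW p0)//.
apply: le_trans (Jlim _ _ _) _ => //.
rewrite -[leRHS]mulrA ler_wpM2l ?(ltW b0)//.
have p40 : 0 < 4 * pi :> R by rewrite mulr_gt0.
rewrite sqrtrM ?(ltW p40)// sqrtr_sqr (gtr0_norm (dl0 n)).
have q0 : 0 < Num.sqrt (4 * pi) :> R by rewrite sqrtr_gt0.
move: (Num.sqrt _) q0 => q q0; have d0 := dl0 n.
by rewrite le_eqVlt; apply/orP; left; apply/eqP; field; rewrite !gt_eqF.
Qed.

Lemma poisson_sin b xi : 0 < b -> \int[leb]_s (cosI 0 0 s b * sin (s * xi)) = 0.
Proof.
move=> b0; rewrite Rintegral_fold; last first.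
  by apply: integrable_trig; [exact: integrable_cosI00|mfun|move=> x; exact: sin_max].
under eq_Rintegral do rewrite cosIN mulNr sinN mulrN addrN.
by rewrite Rintegral_cst// mul0r.
Qed.

Lemma kapM_gauss t k b xi : kap 0 k b xi * expR (- (t * xi ^+ 2)) = kap t k b xi.
Proof. by rewrite /kap mul0r subr0 -mulrA -expRD. Qed.

Lemma Gamma0_conv_cosI t k r y b : 0 < t -> 0 < b ->
  \int[leb]_s (Gamma0 (r - s) t * cosI 0 k (s - y) b) = cosI t k (r - y) b.
Proof.
move=> t0 b0.
rewrite (conv_cosI (integrable_Gamma0 t0) (fun xi => Gamma0_cos xi t0)
  (fun xi => Gamma0_sin xi t0) k (adm0 b0)).
by apply: eq_Rintegral => xi _; rewrite mulr0 addr0 -(kapM_gauss t); ring.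
Qed.

Lemma Gamma0_conv_sinI t k r y b : 0 < t -> 0 < b ->
  \int[leb]_s (Gamma0 (r - s) t * sinI 0 k (s - y) b) = sinI t k (r - y) b.
Proof.
move=> t0 b0.
rewrite (conv_sinI (integrable_Gamma0 t0) (fun xi => Gamma0_cos xi t0)
  (fun xi => Gamma0_sin xi t0) k (adm0 b0)).
by apply: eq_Rintegral => xi _; rewrite mulr0 subr0 -(kapM_gauss t); ring.
Qed.

Lemma dGamma0_conv_sinI t r y b : 0 < t -> 0 < b ->
  \int[leb]_s (dGamma0 (r - s) t * sinI 0 0 (s - y) b) = cosI t 1 (r - y) b.
Proof.
move=> t0 b0.
rewrite (conv_sinI (integrable_dGamma0 t0) (fun xi => dGamma0_cos xi t0)
  (fun xi => dGamma0_sin xi t0) 0 (adm0 b0)).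
by apply: eq_Rintegral => xi _; rewrite kapSr -(kapM_gauss t); ring.
Qed.

(** The Poisson multiplier exp(- b xi) raises the height from 0 to b. The factor pi appears since
    [cosI 0 0] is pi times the Poisson kernel. *)
Lemma cosI1_conv_poisson t r y b : 0 < t -> 0 < b ->
  \int[leb]_s (cosI t 1 (r - s) 0 * cosI 0 0 (s - y) b) = pi * cosI t 1 (r - y) b.
Proof.
move=> t0 b0.
have -> : \int[leb]_s (cosI t 1 (r - s) 0 * cosI 0 0 (s - y) b) =
    \int[leb]_s (cosI 0 0 (y - s) b * cosI t 1 (s - r) 0).
  apply: eq_Rintegral => s _; rewrite mulrC -(cosIN _ _ (s - y)) -(cosIN _ _ (r - s)).
  by rewrite !opprB.
rewrite (conv_cosI (integrable_cosI00 b0) (fun xi => poisson_cos xi b0)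
  (fun xi => poisson_sin xi b0) 1 (admt 0 t0)).
rewrite -(cosIN _ _ (r - y)) opprB -RintegralZl//; last exact/integrable_kap_cos/admt.
apply: eq_Rintegral => xi; rewrite inE/= in_itv/= andbT => xi0.
rewrite mulr0 addr0 (ger0_norm xi0) /kap mul0r oppr0 sub0r (expRD (- (b * xi))); ring.
Qed.

End PoissonFourier.

(** * Partial derivatives of E and of the Green function D *)

Section PartialDerivatives.
Context {R : realType}.
Implicit Types (f : R * R -> R) (x : R * R).

Let quot0 f x : (fun h : R => h^-1 *: (f (h *: evec 0 + x) - f x)) =
    (fun h : R => h^-1 *: (f (h *: (1 : R) + x.1, x.2) - f (x.1, x.2))).
Proof.
apply/funext => h; congr (_ *: (f _ - _)).
  by rewrite /evec /=; congr pair => /=; rewrite scaler0 add0r.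
by case: x.
Qed.

Let quot1 f x : (fun h : R => h^-1 *: (f (h *: evec 1 + x) - f x)) =
    (fun h : R => h^-1 *: (f (x.1, h *: (1 : R) + x.2) - f (x.1, x.2))).
Proof.
apply/funext => h; congr (_ *: (f _ - _)).
  by rewrite /evec /=; congr pair => /=; rewrite scaler0 add0r.
by case: x.
Qed.

Lemma partial0_derive f x : partial 0 f x = 'D_1 (fun s => f (s, x.2)) x.1.
Proof. by rewrite /partial /derive quot0. Qed.

Lemma partial1_derive f x : partial 1 f x = 'D_1 (fun s => f (x.1, s)) x.2.
Proof. by rewrite /partial /derive quot1. Qed.

Lemma partial0_hasd f x l : hasd (fun s => f (s, x.2)) x.1 l ->
  derivable f x (evec 0) /\ partial 0 f x = l.
Proof.
by move=> [fd fl]; rewrite partial0_derive fl /derivable quot0; split; [exact: fd|].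
Qed.

Lemma partial1_hasd f x l : hasd (fun s => f (x.1, s)) x.2 l ->
  derivable f x (evec 1) /\ partial 1 f x = l.
Proof.
by move=> [fd fl]; rewrite partial1_derive fl /derivable quot1; split; [exact: fd|].
Qed.

Lemma derive_junk (f : R -> R) (x : R) : ~ derivable f x 1 -> 'D_1 f x = 0.
Proof. by move=> H; rewrite /derive dvgP. Qed.

Lemma hasd_near (f g : R -> R) (x l : R) : (\forall y \near x, f y = g y) ->
  hasd f x l -> hasd g x l.
Proof.
move=> fg [fd fl]; split; first exact: (near_eq_derivable fg fd).
by rewrite -fl; symmetry; exact: (@near_eq_derive _ _ _ f g x 1 fg).
Qed.

Lemma hasd_ln (f : R -> R) (x df : R) : 0 < f x -> hasd f x df ->
  hasd (fun y => ln (f y)) x ((f x)^-1 * df).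
Proof. by move=> f0 fd; apply: (hasd_comp fd); exact: is_derive1_ln. Qed.

End PartialDerivatives.

Section LogKernel.
Context {R : realType}.
Implicit Types (x y z : R * R) (s a : R).

(** Valid at the origin too, where both logarithms take the default value 0. *)
Lemma EfunE s a : Efun (s, a) = - (ln (s ^+ 2 + a ^+ 2) / (4 * pi)).
Proof.
rewrite /Efun /eucl /=; congr (- _).
have -> : ln (Num.sqrt (s ^+ 2 + a ^+ 2)) = ln (s ^+ 2 + a ^+ 2) / 2.
  have [u0|] := ltP 0 (s ^+ 2 + a ^+ 2).
    rewrite -[in RHS](sqr_sqrtr (ltW u0)) lnXn ?sqrtr_gt0//.
    by rewrite -mulr_natr; field.
  by move=> u0; rewrite ler0_sqrtr// !ln0// mul0r.
by move: (@pi R) (pi_gt0 R) => q q0; field; rewrite gt_eqF.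
Qed.

Definition sqn s a : R := s ^+ 2 + a ^+ 2.

Lemma hasd_Efun1 s a : 0 < sqn s a ->
  hasd (fun s => Efun (s, a)) s (- (s / (2 * pi * sqn s a))).
Proof.
move=> p; rewrite (_ : (fun s => _) = fun s => - (ln (s ^+ 2 + a ^+ 2) / (4 * pi))); last first.
  by apply/funext => u; exact: EfunE.
eapply hasd_eq.
  apply: hasd_opp; apply: hasd_mul; last exact: hasd_cst.
  apply: hasd_ln; [exact: p|isd].
rewrite /=; move: p; rewrite /sqn => p.
by move: (@pi R) (pi_gt0 R) => q q0; field; rewrite (gt_eqF p) (gt_eqF q0).
Qed.

Lemma hasd_Efun2 s a : 0 < sqn s a ->
  hasd (fun a => Efun (s, a)) a (- (a / (2 * pi * sqn s a))).
Proof.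
move=> p; rewrite (_ : (fun a => _) = fun a => - (ln (s ^+ 2 + a ^+ 2) / (4 * pi))); last first.
  by apply/funext => u; exact: EfunE.
eapply hasd_eq.
  apply: hasd_opp; apply: hasd_mul; last exact: hasd_cst.
  apply: hasd_ln; [exact: p|isd].
rewrite /=; move: p; rewrite /sqn => p.
by move: (@pi R) (pi_gt0 R) => q q0; field; rewrite (gt_eqF p) (gt_eqF q0).
Qed.

Lemma sqn_gt0 s a : a != 0 -> 0 < sqn s a.
Proof. by move=> a0; rewrite /sqn ltr_wpDl ?sqr_ge0// exprn_even_gt0. Qed.

Lemma partial0_Efun s a : a != 0 ->
  partial 0 Efun (s, a) = - (sinI 0 0 s `|a| / (2 * pi)).
Proof.
move=> a0; have p := sqn_gt0 s a0.
have [_ ->] := @partial0_hasd R Efun (s, a) _ (hasd_Efun1 p).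
rewrite sinI00 ?normr_gt0// real_normK ?num_real// -/(sqn s a).
by move: (@pi R) (pi_gt0 R) => q q0; field; rewrite (gt_eqF p) (gt_eqF q0).
Qed.

Lemma partial1_Efun s a : 0 < a ->
  partial 1 Efun (s, a) = - (cosI 0 0 s a / (2 * pi)).
Proof.
move=> a0; have p : 0 < sqn s a by rewrite sqn_gt0// gt_eqF.
have [_ ->] := @partial1_hasd R Efun (s, a) _ (hasd_Efun2 p).
rewrite cosI00// -/(sqn s a).
by move: (@pi R) (pi_gt0 R) => q q0; field; rewrite (gt_eqF p) (gt_eqF q0).
Qed.

Lemma hasd_partial0_Efun s a : a != 0 ->
  hasd (fun s => partial 0 Efun (s, a)) s (- (cosI 0 1 s `|a| / (2 * pi))).
Proof.
move=> a0; rewrite (_ : (fun s => _) = fun s => - (sinI 0 0 s `|a| / (2 * pi))); last first.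
  by apply/funext => u; exact: partial0_Efun.
have h := hasd_sinI_r 0 s (adm0 (_ : 0 < `|a|)).
eapply hasd_eq; first (apply: hasd_opp; apply: hasd_mul; [apply: h|isd]).
  by rewrite normr_gt0.
by rewrite mulr0 addr0.
Qed.

Lemma partial00_Efun s a : a != 0 ->
  partial 0 (partial 0 Efun) (s, a) = - (cosI 0 1 s `|a| / (2 * pi)).
Proof.
by move=> a0; have [_ ->] := @partial0_hasd R _ (s, a) _ (hasd_partial0_Efun s a0).
Qed.

(* The components of grad_perp D.  At z = y the limits defining the partial
   derivatives of D diverge and the library derivative is the junk value 0,
   which the case distinction reproduces. *)
Definition K1 z y : R :=
  if z.1 == y.1 then
    if z.2 == y.2 then 0 else
    - ((z.2 - y.2) / sqn (z.1 - y.1) (z.2 - y.2)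
     - (z.2 + y.2) / sqn (z.1 - y.1) (z.2 + y.2)) / (2 * pi)
  else
    - ((z.2 - y.2) / sqn (z.1 - y.1) (z.2 - y.2)
     - (z.2 + y.2) / sqn (z.1 - y.1) (z.2 + y.2)) / (2 * pi).
Definition K2 z y : R :=
  ((z.1 - y.1) / sqn (z.1 - y.1) (z.2 - y.2)
   - (z.1 - y.1) / sqn (z.1 - y.1) (z.2 + y.2)) / (2 * pi).

Lemma DfunE y s a : Dfun (s, a) y = Efun (s - y.1, a - y.2) - Efun (s - y.1, a + y.2).
Proof. by have -> : a + y.2 = a - - y.2 by rewrite opprK. Qed.

Let sqn_le0 (s a : R) : sqn s a <= 0 -> (s == 0) && (a == 0).
Proof.
move=> h; rewrite -(sqrf_eq0 s) -(sqrf_eq0 a) -paddr_eq0 ?sqr_ge0//.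
by rewrite eq_le h addr_ge0 ?sqr_ge0.
Qed.

(** The default value at the singularity is 0, whereas the logarithm is unbounded nearby. This is
    what rules out a derivative of D on the diagonal. *)
Let ln_sqr_discontinuous (x y : R) : x = y ->
  ~ {for x, continuous (fun a => - (ln ((a - y) ^+ 2) / (4 * pi)))}.
Proof.
move=> -> cE.
have {}cE : (fun a => - (ln ((a - y) ^+ 2) / (4 * pi))) a @[a --> y] --> 0.
  have e : - (ln ((y - y) ^+ 2) / (4 * pi)) = 0.
    by rewrite subrr (expr0n _ 2)/= ln0// mul0r oppr0.
  by rewrite -[X in _ --> X]e; exact: cE.
have p4 : 0 < 4 * pi :> R by rewrite mulr_gt0// pi_gt0.
move/cvgrPdist_lt : cE => /(_ (1 / (4 * pi))) [|e /= e0 He]; first by rewrite divr_gt0.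
(* Since d <= exp(- 1), the logarithm of d^2 is at most - 2, which violates the tolerance 1 / (4
   pi); d <= e / 2 keeps the point inside the ball. *)
pose d := Num.min (e / 2) (expR (- 1)).
have d0 : 0 < d by rewrite lt_min expR_gt0 andbT divr_gt0.
have de : d < e by rewrite (@le_lt_trans _ _ (e / 2)) ?ge_min ?lexx//; lra.
have d1 : d <= expR (- 1) by rewrite ge_min lexx orbT.
have /He : ball_ Num.norm y e (y + d).
  by rewrite /= opprD addNKr normrN gtr0_norm.
rewrite sub0r opprK addrC addKr lnXn// normrM (gtr0_norm (_ : 0 < (4 * pi)^-1)) ?invr_gt0//.
rewrite ltr_pM2r ?invr_gt0//.
have : ln d <= - 1 by rewrite -(expRK (- 1)) ler_ln// posrE// expR_gt0.
move=> l1; rewrite ltr_norml => /andP[+ _]; rewrite -mulr_natl; lra.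
Qed.

Lemma partial1_Dfun z y : half_plane z -> half_plane y -> partial 1 (Dfun ^~ y) z = K1 z y.
Proof.
rewrite /half_plane /= => z0 y0.
have c0 : 0 < sqn (z.1 - y.1) (z.2 + y.2) by rewrite sqn_gt0// gt_eqF// addr_gt0.
have [b0|] := ltP 0 (sqn (z.1 - y.1) (z.2 - y.2)).
  have H : hasd (fun a => Dfun (z.1, a) y) z.2
      (- ((z.2 - y.2) / sqn (z.1 - y.1) (z.2 - y.2)
     - (z.2 + y.2) / sqn (z.1 - y.1) (z.2 + y.2)) / (2 * pi)).
    rewrite (_ : (fun a => _) = fun a => Efun (z.1 - y.1, a - y.2) - Efun (z.1 - y.1, a + y.2)); last first.
      by apply/funext => a; exact: DfunE.
    eapply hasd_eq.
      apply: hasd_add; [|apply: hasd_opp].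
      - apply: (@hasd_comp _ (fun a => Efun (z.1 - y.1, a)) (fun a => a - y.2)); [isd|exact: hasd_Efun2].
      - apply: (@hasd_comp _ (fun a => Efun (z.1 - y.1, a)) (fun a => a + y.2)); [isd|exact: hasd_Efun2].
    rewrite /=; move: (sqn _ _) b0 (sqn _ _) c0 => B B0 C C0.
    by move: (@pi R) (pi_gt0 R) => q q0; field; rewrite (gt_eqF B0) (gt_eqF C0) (gt_eqF q0).
  have [_ ->] := @partial1_hasd R (Dfun ^~ y) z _ H.
  rewrite /K1; case: eqP => // e1; case: eqP => // e2.
  by move: b0; rewrite e1 e2 !subrr /sqn expr0n/= addr0 ltxx.
move=> b0.
have /andP[e1 e2] : (z.1 == y.1) && (z.2 == y.2).
  by rewrite -subr_eq0 -(subr_eq0 z.2); exact: sqn_le0.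
(* On the diagonal a derivative would make D continuous along the vertical line. Adding back the
   image term, smooth there, would then make the logarithm continuous at its singularity. So the
   derivative has its default value 0. *)
rewrite /K1 e1 e2 partial1_derive; apply: derive_junk => dD.
have E1 : hasd (fun a => Efun (z.1 - y.1, a + y.2)) z.2
    (- ((z.2 + y.2) / (2 * pi * sqn (z.1 - y.1) (z.2 + y.2))) * (1 + 0)).
  by apply: (@hasd_comp _ (fun a => Efun (z.1 - y.1, a)) (fun a => a + y.2)); [isd|exact: hasd_Efun2].
have cE : {for z.2, continuous (fun a => Dfun (z.1, a) y + Efun (z.1 - y.1, a + y.2))}.
  apply: continuousD; first exact/differentiable_continuous/derivable1_diffP.
  exact: hasd_continuous E1.
have {}cE : {for z.2, continuous (fun a => - (ln ((a - y.2) ^+ 2) / (4 * pi)))}.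
  rewrite (_ : (fun a => _) = (fun a => Dfun (z.1, a) y + Efun (z.1 - y.1, a + y.2)))//.
  apply/funext => a; rewrite DfunE subrK EfunE (eqP e1) subrr expr0n/= add0r//.
exact: (ln_sqr_discontinuous (eqP e2) cE).
Qed.

Lemma partial0_Dfun z y : half_plane z -> half_plane y -> - partial 0 (Dfun ^~ y) z = K2 z y.
Proof.
rewrite /half_plane /= => z0 y0.
have c0 : 0 < sqn (z.1 - y.1) (z.2 + y.2) by rewrite sqn_gt0// gt_eqF// addr_gt0.
have [b0|] := ltP 0 (sqn (z.1 - y.1) (z.2 - y.2)).
  have H : hasd (fun s => Dfun (s, z.2) y) z.1 (- K2 z y).
    rewrite (_ : (fun a => _) = fun s => Efun (s - y.1, z.2 - y.2) - Efun (s - y.1, z.2 + y.2)); last first.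
      by apply/funext => s; exact: DfunE.
    eapply hasd_eq.
      apply: hasd_add; [|apply: hasd_opp].
      - apply: (@hasd_comp _ (fun s => Efun (s, z.2 - y.2)) (fun s => s - y.1)); [isd|exact: hasd_Efun1].
      - apply: (@hasd_comp _ (fun s => Efun (s, z.2 + y.2)) (fun s => s - y.1)); [isd|exact: hasd_Efun1].
    rewrite /= /K2; move: (sqn _ _) b0 (sqn _ _) c0 => B B0 C C0.
    by move: (@pi R) (pi_gt0 R) => q q0; field; rewrite (gt_eqF B0) (gt_eqF C0) (gt_eqF q0).
  by have [_ ->] := @partial0_hasd R (Dfun ^~ y) z _ H; rewrite opprK.
move=> b0.
have /andP[e1 e2] : (z.1 == y.1) && (z.2 == y.2).
  by rewrite -subr_eq0 -(subr_eq0 z.2); exact: sqn_le0.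
rewrite /K2 (eqP e1) subrr !mul0r subrr mul0r partial0_derive.
rewrite derive_junk ?oppr0// => dD.
have E1 : hasd (fun s => Efun (s - y.1, z.2 + y.2)) z.1
    (- ((z.1 - y.1) / (2 * pi * sqn (z.1 - y.1) (z.2 + y.2))) * (1 + 0)).
  by apply: (@hasd_comp _ (fun s => Efun (s, z.2 + y.2)) (fun s => s - y.1)); [isd|exact: hasd_Efun1].
have cE : {for z.1, continuous (fun s => Dfun (s, z.2) y + Efun (s - y.1, z.2 + y.2))}.
  apply: continuousD; first exact/differentiable_continuous/derivable1_diffP.
  exact: hasd_continuous E1.
have {}cE : {for z.1, continuous (fun a => - (ln ((a - y.1) ^+ 2) / (4 * pi)))}.
  rewrite (_ : (fun a => _) = (fun s => Dfun (s, z.2) y + Efun (s - y.1, z.2 + y.2)))//.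
  by apply/funext => a; rewrite DfunE subrK EfunE (eqP e2) subrr (expr0n _ 2)/= addr0.
exact: (ln_sqr_discontinuous (eqP e1) cE).
Qed.

End LogKernel.

(** * Closed form of the Stokes kernel and its vertical derivative *)

Section StokesKernel.
Context {R : realType}.
Local Notation leb := (@lebesgue_measure R).
Implicit Types (z : R * R) (t r a w s : R) (k : nat).

Lemma GammaE (x : R * R) t : 0 < t -> Gamma x t = Gamma0 x.1 t * Gamma0 x.2 t.
Proof.
move=> t0; rewrite /Gamma /Gamma0 /eucl sqr_sqrtr ?addr_ge0 ?sqr_ge0//.
have p := pi4_gt0 t0.
rewrite mulrACA -invfM -expr2 sqr_sqrtr ?(ltW p)// -expRD; congr (expR _ / _).
by rewrite mulrDl opprD.
Qed.

(** At the upper endpoint the distance to the singular height is 0 and the closed forms of the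
    derivatives of E fail; one point does not affect the integral. *)
Lemma eq_Rintegral_itv_co (f g : R -> R) (x : R) :
  (forall w, 0 <= w < x -> f w = g w) -> leb.-integrable `[0, x] (EFin \o g) ->
  \int[leb]_(w in `[0, x]) f w = \int[leb]_(w in `[0, x]) g w.
Proof.
move=> fg gi.
have gi' : leb.-integrable `[0, x[ (EFin \o g).
  apply: integrableS gi => //; exact: subset_itv_co_cc.
rewrite -!Rintegral_itv_bndo_bndc//.
  by apply: eq_Rintegral => w; rewrite inE/= in_itv/=; exact: fg.
apply: eq_integrable gi' => // w; rewrite inE/= in_itv/= => h.
by rewrite /= fg.
Qed.

(** The non-local part of the Stokes kernel once its horizontal integral is done: x is the height
    x_2, s the height z_2 and r the difference x_1 - z_1. *)
Definition Mc t k r (x : R) s : R :=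
  \int[leb]_(w in `[0, x]) (cosI t k r (x - w) * Gamma0 (w + s) t).
Definition Ms t k r (x : R) s : R :=
  \int[leb]_(w in `[0, x]) (sinI t k r (x - w) * Gamma0 (w + s) t).

Lemma integrable_Gamma0_shift t (x : R) s : 0 < t ->
  leb.-integrable `[0, x] (EFin \o (fun w => Gamma0 (w + s) t)).
Proof.
move=> t0; apply: integrable_itv_cc => w; rewrite /Gamma0.
eapply hasd_continuous; isd.
Qed.

Lemma integrable_Gamma0_shiftZ (M x : R) t s : 0 < t ->
  leb.-integrable `[0, x] (EFin \o (fun w => M * Gamma0 (w + s) t)).
Proof. by move=> t0; apply: integrableRZl => //; exact: integrable_Gamma0_shift. Qed.

Lemma integrable_Mc t k r (x : R) s : 0 < t ->
  leb.-integrable `[0, x] (EFin \o (fun w => cosI t k r (x - w) * Gamma0 (w + s) t)).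
Proof.
move=> t0; have [M M0 H] := trigI_bound k `|x| t0.
have Gi := integrable_Gamma0_shiftZ M x s t0.
apply: le_integrableR Gi => //.
  apply: measurable_funTS; apply: measurable_funM; last by rewrite /Gamma0; mfun.
  by apply: measurable_cosI; mfun.
move=> w /=; rewrite in_itv/= => /andP[w0 wx]; rewrite normrM (ger0_norm (Gamma0_ge0 _ _)).
rewrite ler_wpM2r ?Gamma0_ge0//; have [] := H r (x - w) => //.
by rewrite !ger0_norm; lra.
Qed.

Lemma integrable_Ms t k r (x : R) s : 0 < t ->
  leb.-integrable `[0, x] (EFin \o (fun w => sinI t k r (x - w) * Gamma0 (w + s) t)).
Proof.
move=> t0; have [M M0 H] := trigI_bound k `|x| t0.
have Gi := integrable_Gamma0_shiftZ M x s t0.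
apply: le_integrableR Gi => //.
  apply: measurable_funTS; apply: measurable_funM; last by rewrite /Gamma0; mfun.
  by apply: measurable_sinI; mfun.
move=> w /=; rewrite in_itv/= => /andP[w0 wx]; rewrite normrM (ger0_norm (Gamma0_ge0 _ _)).
rewrite ler_wpM2r ?Gamma0_ge0//; have [] := H r (x - w) => //.
by rewrite !ger0_norm; lra.
Qed.

Lemma hasd_Ms_r t k r (x : R) s : 0 < t ->
  hasd (fun r => Ms t k r x s) r (Mc t k.+1 r x s).
Proof.
move=> t0; have [M M0 H] := trigI_bound k.+1 `|x| t0.
have Gi := integrable_Gamma0_shiftZ M x s t0.
apply: (@hasd_Rintegral R _ _ leb (fun r w => sinI t k r (x - w) * Gamma0 (w + s) t)
  (fun r w => cosI t k.+1 r (x - w) * Gamma0 (w + s) t) _ r (r - 1) (r + 1)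
  (fun w => M * Gamma0 (w + s) t)) => //.
- by apply/andP; split; lra.
- by move=> u _; exact: integrable_Ms.
- move=> u w _ _; eapply hasd_eq.
    apply: hasd_mul; [exact/hasd_sinI_r/admt|exact: hasd_cst].
  by rewrite mulr0 addr0.
- move=> u w _ /=; rewrite in_itv/= => /andP[w0 wx]; rewrite normrM (ger0_norm (Gamma0_ge0 _ _)).
  rewrite ler_wpM2r ?Gamma0_ge0//; have [] := H u (x - w) => //.
  by rewrite !ger0_norm; lra.
Qed.

Lemma hasd_Mc_r t k r (x : R) s : 0 < t ->
  hasd (fun r => Mc t k r x s) r (- Ms t k.+1 r x s).
Proof.
move=> t0; have [M M0 H] := trigI_bound k.+1 `|x| t0.
have Gi := integrable_Gamma0_shiftZ M x s t0.
rewrite /Ms -RintegralN//; last exact: integrable_Ms.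
apply: (@hasd_Rintegral R _ _ leb (fun r w => cosI t k r (x - w) * Gamma0 (w + s) t)
  (fun r w => - (sinI t k.+1 r (x - w) * Gamma0 (w + s) t)) _ r (r - 1) (r + 1)
  (fun w => M * Gamma0 (w + s) t)) => //.
- by apply/andP; split; lra.
- by move=> u _; exact: integrable_Mc.
- move=> u w _ _; eapply hasd_eq.
    apply: hasd_mul; [exact/hasd_cosI_r/admt|exact: hasd_cst].
  by rewrite mulr0 addr0 mulNr.
- move=> u w _ /=; rewrite in_itv/= => /andP[w0 wx].
  rewrite normrN normrM (ger0_norm (Gamma0_ge0 _ _)).
  rewrite ler_wpM2r ?Gamma0_ge0//; have [] := H u (x - w) => //.
  by rewrite !ger0_norm; lra.
Qed.

Lemma measurable_Mc t k (x : R) :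
  measurable_fun setT (fun p : R * R => Mc t k p.1 x p.2).
Proof.
rewrite /Mc; apply: (@measurable_Rintegral_param_on _ _ _ _ R leb
  (fun q : (R * R) * R => cosI t k q.1.1 (x - q.2) * Gamma0 (q.2 + q.1.2) t)) => //.
apply: measurable_funM; last by rewrite /Gamma0; mfun.
by apply: measurable_cosI; mfun.
Qed.

Lemma measurable_Ms t k (x : R) :
  measurable_fun setT (fun p : R * R => Ms t k p.1 x p.2).
Proof.
rewrite /Ms; apply: (@measurable_Rintegral_param_on _ _ _ _ R leb
  (fun q : (R * R) * R => sinI t k q.1.1 (x - q.2) * Gamma0 (q.2 + q.1.2) t)) => //.
apply: measurable_funM; last by rewrite /Gamma0; mfun.
by apply: measurable_sinI; mfun.
Qed.

Lemma sinI0_bounded a : 0 < a -> exists M, forall s, `|sinI 0 0 s a| <= M.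
Proof.
move=> a0; exists (\int[leb]_(xi in `[0, +oo[) kap 0 0 a xi) => s.
exact/normr_sinI_le/adm0.
Qed.

Lemma cosI0_bounded k a : 0 < a -> exists M, forall s, `|cosI 0 k s a| <= M.
Proof.
move=> a0; exists (\int[leb]_(xi in `[0, +oo[) kap 0 k a xi) => s.
exact/normr_cosI_le/adm0.
Qed.

Lemma integrable_Gamma0_conv t r (h : R -> R) : 0 < t -> measurable_fun setT h ->
  (exists M, forall s, `|h s| <= M) ->
  leb.-integrable setT (EFin \o (fun s => Gamma0 (r - s) t * h s)).
Proof.
move=> t0 mh [M H]; apply: (@integrableRMb _ _ _ _ _ _ _ _ M) => //.
exact: integrable_subl (integrable_Gamma0 t0).
Qed.

(** The derivative d_1 E at height x_2 - w > 0 is a multiple of the conjugate Poisson kernel, and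
    the heat kernel splits into a horizontal and a vertical factor; what remains is a
    one-dimensional convolution. *)
Lemma stokes_inner0 t (x : R * R) z w : 0 < t -> w < x.2 ->
  \int[leb]_v (partial 0 Efun (x - (v, w)) * Gamma ((v, w) - star z) t) =
  - (2 * pi)^-1 * (sinI t 0 (x.1 - z.1) (x.2 - w) * Gamma0 (w + z.2) t).
Proof.
move=> t0 wx; have a0 : 0 < x.2 - w by rewrite subr_gt0.
have [M HM] := sinI0_bounded a0.
transitivity (\int[leb]_v ((2 * pi)^-1 * Gamma0 (w + z.2) t *
    (Gamma0 (z.1 - v) t * sinI 0 0 (v - x.1) (x.2 - w)))).
  apply: eq_Rintegral => v _; rewrite (@partial0_Efun _ (x.1 - v)) ?gt_eqF//.
  rewrite gtr0_norm// GammaE//= opprK -(Gamma0N (z.1 - v)) opprB.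
  by rewrite -(opprB v) sinIN ?adm0//; ring.
rewrite RintegralZl//; last first.
  apply: integrable_Gamma0_conv => //; last by exists M.
  by apply: measurable_sinI; mfun.
rewrite Gamma0_conv_sinI// -(opprB x.1) sinIN ?admt//; ring.
Qed.

Lemma stokes_inner1 t (x : R * R) z w : 0 < t -> w < x.2 ->
  \int[leb]_v (partial 1 Efun (x - (v, w)) * Gamma ((v, w) - star z) t) =
  - (2 * pi)^-1 * (cosI t 0 (x.1 - z.1) (x.2 - w) * Gamma0 (w + z.2) t).
Proof.
move=> t0 wx; have a0 : 0 < x.2 - w by rewrite subr_gt0.
have [M HM] := cosI0_bounded 0 a0.
transitivity (\int[leb]_v (- (2 * pi)^-1 * Gamma0 (w + z.2) t *
    (Gamma0 (z.1 - v) t * cosI 0 0 (v - x.1) (x.2 - w)))).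
  apply: eq_Rintegral => v _; rewrite (@partial1_Efun _ (x.1 - v))//.
  rewrite GammaE//= opprK -(Gamma0N (z.1 - v)) opprB.
  by rewrite -(opprB v) cosIN; ring.
rewrite RintegralZl//; last first.
  apply: integrable_Gamma0_conv => //; last by exists M.
  by apply: measurable_cosI; mfun.
rewrite Gamma0_conv_cosI// -(opprB x.1) cosIN; ring.
Qed.

Lemma stokes_A0 t (x : R * R) z : 0 < t ->
  \int[leb]_(w in `[0, x.2]) \int[leb]_v
    (partial 0 Efun (x - (v, w)) * Gamma ((v, w) - star z) t) =
  - (2 * pi)^-1 * Ms t 0 (x.1 - z.1) x.2 z.2.
Proof.
move=> t0; have Mi := integrable_Ms 0 (x.1 - z.1) x.2 z.2 t0.
rewrite -RintegralZl//; apply: eq_Rintegral_itv_co; last exact: integrableRZl.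
by move=> w /andP[_ wx]; exact: stokes_inner0.
Qed.

Lemma stokes_A1 t (x : R * R) z : 0 < t ->
  \int[leb]_(w in `[0, x.2]) \int[leb]_v
    (partial 1 Efun (x - (v, w)) * Gamma ((v, w) - star z) t) =
  - (2 * pi)^-1 * Mc t 0 (x.1 - z.1) x.2 z.2.
Proof.
move=> t0; have Mi := integrable_Mc 0 (x.1 - z.1) x.2 z.2 t0.
rewrite -RintegralZl//; apply: eq_Rintegral_itv_co; last exact: integrableRZl.
by move=> w /andP[_ wx]; exact: stokes_inner1.
Qed.

Lemma stokes_ker00 t (x : R * R) z : 0 < t -> stokes_ker 0 0 x z t =
  Gamma (x - z) t - Gamma (x - star z) t + 2 / pi * Mc t 1 (x.1 - z.1) x.2 z.2.
Proof.
move=> t0; rewrite /stokes_ker /= mulr1 subr0 mulr1.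
under [in X in partial 0 X]eq_fun do rewrite stokes_A0//.
have H : hasd (fun s => - (2 * pi)^-1 * Ms t 0 (s - z.1) x.2 z.2) x.1
    (- (2 * pi)^-1 * Mc t 1 (x.1 - z.1) x.2 z.2).
  eapply hasd_eq.
    apply: hasd_mul; first exact: hasd_cst.
    apply: (@hasd_comp _ (fun r => Ms t 0 r x.2 z.2) (fun s => s - z.1)); [isd|exact: hasd_Ms_r].
  by rewrite /=; ring.
have [_ ->] := @partial0_hasd R (fun x' => - (2 * pi)^-1 * Ms t 0 (x'.1 - z.1) x'.2 z.2) x _ H.
by move: (@pi R) (pi_gt0 R) => q q0; field; rewrite gt_eqF.
Qed.

Lemma stokes_ker10 t (x : R * R) z : 0 < t -> stokes_ker 1 0 x z t =
  - (2 / pi * Ms t 1 (x.1 - z.1) x.2 z.2).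
Proof.
move=> t0; rewrite /stokes_ker /= mulr0 sub0r subr0 mulr1.
under [in X in partial 0 X]eq_fun do rewrite stokes_A1//.
have H : hasd (fun s => - (2 * pi)^-1 * Mc t 0 (s - z.1) x.2 z.2) x.1
    ((2 * pi)^-1 * Ms t 1 (x.1 - z.1) x.2 z.2).
  eapply hasd_eq.
    apply: hasd_mul; first exact: hasd_cst.
    apply: (@hasd_comp _ (fun r => Mc t 0 r x.2 z.2) (fun s => s - z.1)); [isd|exact: hasd_Mc_r].
  by rewrite /=; ring.
have [_ ->] := @partial0_hasd R (fun x' => - (2 * pi)^-1 * Mc t 0 (x'.1 - z.1) x'.2 z.2) x _ H.
by move: (@pi R) (pi_gt0 R) => q q0; field; rewrite gt_eqF.
Qed.

Lemma stokes_ker01 t (x : R * R) z : stokes_ker 0 1 x z t = 0.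
Proof. by rewrite /stokes_ker /= subrr mulr0 mulr0 mul0r subr0. Qed.

Lemma stokes_ker11 t (x : R * R) z : stokes_ker 1 1 x z t = Gamma (x - z) t - Gamma (x - star z) t.
Proof. by rewrite /stokes_ker /= subrr mulr0 mul0r subr0 mulr1. Qed.

End StokesKernel.

Section VerticalDerivative.
Context {R : realType}.
Local Notation leb := (@lebesgue_measure R).
Implicit Types (t r a w s x xi : R) (k : nat).

(** The w-integral of [Mc] at a fixed frequency xi. In [Mc] the variable x occurs in the upper limit
    and in the integrand; with the frequency integral outside, only this elementary function has to
    be differentiated. *)
Definition Bexp t xi x s : R :=
  \int[leb]_(w in `[0, x]) (expR (- ((x - w) * xi)) * Gamma0 (w + s) t).

Definition Gmax t : R := (Num.sqrt (4 * pi * t))^-1.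

Lemma Gmax_ge0 t : 0 <= Gmax t.
Proof. by rewrite invr_ge0 sqrtr_ge0. Qed.

Lemma Gamma0_le_max r t : 0 < t -> Gamma0 r t <= Gmax t.
Proof.
move=> t0; rewrite /Gamma0 ler_piMl ?Gmax_ge0//.
by rewrite -[leRHS]expR0 ler_expR oppr_le0 divr_ge0 ?sqr_ge0//; lra.
Qed.

Lemma Rintegral_itv_cst (c x : R) : 0 <= x -> \int[leb]_(w in `[0, x]) c = c * x.
Proof.
move=> x0; rewrite Rintegral_cst//= lebesgue_measure_itv/= lte_fin.
by case: ltP => [_|x1]; rewrite /= ?subr0//; congr (_ * _); apply/eqP; rewrite eq_le x0 x1.
Qed.

Lemma Bexp_le t xi x s : 0 < t -> 0 <= xi -> 0 <= x -> `|Bexp t xi x s| <= x * Gmax t.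
Proof.
move=> t0 xi0 x0; rewrite mulrC -Rintegral_itv_cst//.
apply: normr_Rintegral_le => //.
- by apply: measurable_funTS; rewrite /Gamma0; mfun.
- by apply: integrable_itv_cc => w; exact: cst_continuous.
- move=> w /=; rewrite in_itv/= => /andP[w0 wx].
  rewrite normrM (ger0_norm (expR_ge0 _)) (ger0_norm (Gamma0_ge0 _ _)).
  rewrite -[leRHS]mul1r ler_pM ?expR_ge0 ?Gamma0_ge0 ?Gamma0_le_max//.
  by rewrite -expR0 ler_expR oppr_le0 mulr_ge0//; lra.
Qed.

(** Duhamel: with exp(- x xi) pulled out, the fundamental theorem gives the source term and the
    factor gives - xi B. *)
Lemma hasd_Bexp t xi x s : 0 < t -> 0 < x ->
  hasd (fun x => Bexp t xi x s) x (Gamma0 (x + s) t - xi * Bexp t xi x s).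
Proof.
move=> t0 x0.
pose f w := expR (w * xi) * Gamma0 (w + s) t.
have cf : continuous f by move=> w; rewrite /f /Gamma0; eapply hasd_continuous; isd.
have BE y : Bexp t xi y s = expR (- (y * xi)) * \int[leb]_(w in `[0, y]) f w.
  rewrite -RintegralZl//; last exact: integrable_itv_cc.
  apply: eq_Rintegral => w _; rewrite /f mulrA -expRD; congr (expR _ * _); lra.
have x1 : x < x + 1 by lra.
have [dF F'] := continuous_FTC1_closed x1 (integrable_itv_cc 0 (x + 1) cf) x0 (cf x).
have Fd : hasd (fun y => \int[leb]_(w in `[0, y]) f w) x (f x).
  by split; [exact: dF|rewrite -derive1E; exact: F'].
rewrite (_ : (fun x => Bexp t xi x s) = fun y => expR (- (y * xi)) * \int[leb]_(w in `[0, y]) f w); last exact/funext.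
eapply hasd_eq; first (apply: hasd_mul; [isd|exact: Fd]).
rewrite /= BE /f mul1r mulr0 addr0.
have e : expR (- (x * xi)) * expR (x * xi) = 1 by rewrite -expRD addNr expR0.
rewrite (mulrA _ (expR (x * xi))) e; ring.
Qed.

Lemma kap_split t k a xi : kap t k a xi = kap t k 0 xi * expR (- (a * xi)).
Proof. by rewrite /kap mul0r oppr0 sub0r -mulrA -expRD addrC. Qed.

Lemma Mc_Bexp t k r x s : 0 < t -> 0 <= x ->
  Mc t k r x s = \int[leb]_(xi in `[0, +oo[) (kap t k 0 xi * cos (r * xi) * Bexp t xi x s).
Proof.
move=> t0 x0.
transitivity (\int[leb]_(w in `[0, x]) \int[leb]_(xi in `[0, +oo[)
   (kap t k (x - w) xi * cos (r * xi) * Gamma0 (w + s) t)).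
  apply: eq_Rintegral => w _; rewrite RintegralZr//.
  exact/integrable_kap_cos/admt.
rewrite (@Rfubini_on _ _ _ _ _ leb leb `[0, x]%classic `[0, +oo[%classic _ _
  (fun z => kap t k (x - z.1) z.2 * cos (r * z.2) * Gamma0 (z.1 + s) t))//; last first.
  apply: (@integrable_prod_dom _ _ _ _ _ leb leb _ _ _ _ _
    (fun w => Gamma0 (w + s) t) (kap t k 0)) => //.
  - by apply: measurable_funTS; rewrite /Gamma0 /kap; mfun.
  - exact: integrable_Gamma0_shift.
  - exact/integrable_kap/admt.
  - move=> w xi /=; rewrite !in_itv/= andbT => /andP[w0 wx] xi0.
    rewrite normrM (ger0_norm (Gamma0_ge0 _ _)) mulrC ler_wpM2l ?Gamma0_ge0//.
    rewrite normrM (ger0_norm (kap_ge0 _ _ _ xi0)) (@le_trans _ _ (kap t k (x - w) xi))//.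
      by rewrite ler_piMr ?kap_ge0// cos_max.
    rewrite (kap_split _ _ (x - w)) ler_piMr ?kap_ge0//.
    by rewrite -expR0 ler_expR oppr_le0 mulr_ge0//; lra.
apply: eq_Rintegral => xi _ /=; rewrite -RintegralZl//; last first.
  by apply: integrable_itv_cc => w; rewrite /Gamma0; eapply hasd_continuous; isd.
apply: eq_Rintegral => w _; rewrite (kap_split _ _ (x - w)); ring.
Qed.

Lemma measurable_Bexp t x s : measurable_fun setT (fun xi => Bexp t xi x s).
Proof.
rewrite /Bexp; apply: (@measurable_Rintegral_param_on _ _ _ _ R leb
  (fun q : R * R => expR (- ((x - q.2) * q.1)) * Gamma0 (q.2 + s) t)) => //.
rewrite /Gamma0; mfun.
Qed.

Lemma integrable_kap_Bexp t k r x s : 0 < t -> 0 <= x ->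
  leb.-integrable `[0, +oo[ (EFin \o (fun xi => kap t k 0 xi * cos (r * xi) * Bexp t xi x s)).
Proof.
move=> t0 x0.
have ki : leb.-integrable `[0, +oo[ (EFin \o (fun xi => x * Gmax t * kap t k 0 xi)).
  by apply: integrableRZl => //; exact/integrable_kap/admt.
apply: le_integrableR ki => //.
  apply: measurable_funTS; apply: measurable_funM; last exact: measurable_Bexp.
  by rewrite /kap; mfun.
move=> xi /=; rewrite in_itv/= andbT => xi0.
rewrite normrM mulrC ler_pM ?Bexp_le// normrM (ger0_norm (kap_ge0 _ _ _ xi0)).
by rewrite ler_piMr ?kap_ge0// cos_max.
Qed.

(** The source term of [hasd_Bexp] does not depend on xi and integrates to [cosI t k r 0]; the
    factor xi in the other term raises the exponent. *)
Lemma hasd_Mc_x t k r x s : 0 < t -> 0 < x ->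
  hasd (fun x => Mc t k r x s) x (cosI t k r 0 * Gamma0 (x + s) t - Mc t k.+1 r x s).
Proof.
move=> t0 x0.
have H : hasd (fun x => \int[leb]_(xi in `[0, +oo[) (kap t k 0 xi * cos (r * xi) * Bexp t xi x s)) x
   (\int[leb]_(xi in `[0, +oo[) (kap t k 0 xi * cos (r * xi) * (Gamma0 (x + s) t - xi * Bexp t xi x s))).
  pose N := Gmax t; have N0 : 0 <= N := Gmax_ge0 t.
  (* For 0 < u < x + 1 the derivative of [Bexp] is at most N + xi (x + 1) N, by [Bexp_le];
     multiplied by [kap t k 0 xi] this is the majorant. *)
  have Gi : leb.-integrable `[0, +oo[
     (EFin \o (fun xi => N * kap t k 0 xi + (x + 1) * N * kap t k.+1 0 xi)).
    apply: integrableRD => //; apply: integrableRZl => //; exact/integrable_kap/admt.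
  apply: (@hasd_Rintegral R _ _ leb (fun x xi => kap t k 0 xi * cos (r * xi) * Bexp t xi x s)
    (fun x xi => kap t k 0 xi * cos (r * xi) * (Gamma0 (x + s) t - xi * Bexp t xi x s))
    _ x 0 (x + 1) (fun xi => N * kap t k 0 xi + (x + 1) * N * kap t k.+1 0 xi)).
  - exact: measurable_itv.
  - by apply/andP; split; lra.
  - by move=> u /andP[u0 _]; apply: integrable_kap_Bexp => //; exact: ltW.
  - move=> u xi /andP[u0 _] _; eapply hasd_eq.
      by apply: hasd_mul; [exact: hasd_cst|exact: hasd_Bexp].
    by rewrite mul0r add0r.
  - exact: Gi.
  - move=> u xi /andP[u0 u1] /=; rewrite in_itv/= andbT => xi0.
    rewrite normrM normrM (ger0_norm (kap_ge0 _ _ _ xi0)).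
    have c1 : `|cos (r * xi)| <= 1 by exact: cos_max.
    have B1 : `|Gamma0 (u + s) t - xi * Bexp t xi u s| <= N + xi * ((x + 1) * N).
      apply: le_trans (ler_normB _ _) _; apply: lerD.
        by rewrite ger0_norm ?Gamma0_ge0// Gamma0_le_max.
      rewrite normrM (ger0_norm xi0) ler_wpM2l//; apply: le_trans (Bexp_le _ t0 xi0 (ltW u0)) _.
      by rewrite ler_wpM2r//; lra.
    have k0 : 0 <= kap t k 0 xi := kap_ge0 _ _ _ xi0.
    rewrite kapSr.
    have -> : N * kap t k 0 xi + (x + 1) * N * (xi * kap t k 0 xi) =
      kap t k 0 xi * 1 * (N + xi * ((x + 1) * N)) by ring.
    by apply: ler_pM => //; [exact: mulr_ge0|rewrite mulr1; exact: ler_piMr].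
have E : \int[leb]_(xi in `[0, +oo[) (kap t k 0 xi * cos (r * xi) * (Gamma0 (x + s) t - xi * Bexp t xi x s))
   = cosI t k r 0 * Gamma0 (x + s) t - Mc t k.+1 r x s.
  rewrite Mc_Bexp ?(ltW x0)// mulrC /cosI -RintegralZl//; last exact/integrable_kap_cos/admt.
  rewrite -RintegralB//; last 2 first.
  - by apply: integrableRZl => //; exact/integrable_kap_cos/admt.
  - by apply: integrable_kap_Bexp => //; exact: ltW.
  - by apply: eq_Rintegral => xi _; rewrite kapSr; ring.
rewrite E in H; apply: hasd_near H; near=> u.
rewrite Mc_Bexp//; apply: ltW; near: u; exact: lt_nbhsr.
Unshelve. all: end_near. Qed.

End VerticalDerivative.

(** * Majorants, and the uniform bound for the Biot-Savart singularity *)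

Section Majorants.
Context {R : realType}.
Local Notation leb := (@lebesgue_measure R).
Implicit Types (t r a w s u v x xi : R) (k : nat).

(** The weight for all kernel bounds: pi times the Poisson kernel of height 1. It is integrable and,
    unlike a Gaussian, stable under bounded shifts up to a constant. *)
Definition qm u : R := (1 + u ^+ 2)^-1.

Lemma qm_gt0 u : 0 < qm u.
Proof. by rewrite invr_gt0 ltr_wpDr ?sqr_ge0. Qed.

Lemma qm_ge0 u : 0 <= qm u. Proof. exact: ltW (qm_gt0 u). Qed.

Lemma qmN u : qm (- u) = qm u. Proof. by rewrite /qm sqrrN. Qed.

Lemma qm_le1 u : qm u <= 1.
Proof. by rewrite invf_le1 ?lerDl ?sqr_ge0// ltr_wpDr ?sqr_ge0. Qed.

Lemma qmE u : qm u = cosI 0 0 u 1.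
Proof. by rewrite cosI00// /qm mul1r expr1n addrC. Qed.

Lemma integrable_qm : leb.-integrable setT (EFin \o qm).
Proof.
have := @integrable_cosI00 R 1 ltr01; apply: eq_integrable => // u _ /=.
by rewrite qmE.
Qed.

(** From u^2 <= 2 v^2 + 2 (v - u)^2, the difference of the two sides being (2 v - u)^2. *)
Lemma qm_shift S u v : `|v| <= S -> qm (v - u) <= (2 + 2 * S ^+ 2) * qm u.
Proof.
move=> vS.
have v2 : v ^+ 2 <= S ^+ 2.
  by rewrite -(real_normK (num_real v)) ler_sqr ?nnegrE// (le_trans _ vS).
have p : 0 < 1 + u ^+ 2 by rewrite ltr_wpDr ?sqr_ge0.
have p' : 0 < 1 + (v - u) ^+ 2 by rewrite ltr_wpDr ?sqr_ge0.
rewrite /qm ler_pdivlMr// ler_pdivrMl//.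
have : 0 <= (2 * v - u) ^+ 2 by exact: sqr_ge0.
have : 0 <= S ^+ 2 by exact: sqr_ge0.
have : 0 <= (v - u) ^+ 2 by exact: sqr_ge0.
nra.
Qed.

Lemma Gamma0_qm t : 0 < t -> exists2 C, 0 <= C & forall v, Gamma0 v t <= C * qm v.
Proof.
move=> t0; exists ((1 + 8 * t) * Num.sqrt 2 * Gmax (2 * t)).
  by rewrite !mulr_ge0 ?sqrtr_ge0 ?Gmax_ge0//; lra.
move=> v; rewrite /qm ler_pdivlMr; last by rewrite ltr_wpDr ?sqr_ge0.
rewrite mulrC; apply: le_trans (Gamma0_moment v t0) _.
rewrite ler_wpM2l ?Gamma0_le_max//; last lra.
by rewrite mulr_ge0 ?sqrtr_ge0//; lra.
Qed.

Lemma dGamma0_qm t : 0 < t -> exists2 C, 0 <= C & forall v, `|dGamma0 v t| <= C * qm v.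
Proof.
move=> t0; have t20 : 0 < 2 * t by lra.
have [C C0 H] := Gamma0_qm t20.
pose K := (1 + 8 * t) * Num.sqrt 2 / (2 * t).
have K0 : 0 <= K by rewrite divr_ge0 ?mulr_ge0 ?sqrtr_ge0//; lra.
exists (K * C); first exact: mulr_ge0.
move=> v; apply: (@le_trans _ _ (K * Gamma0 v (2 * t))); last by rewrite -[leRHS]mulrA ler_wpM2l.
rewrite /dGamma0 normrM normrN normrM (ger0_norm (Gamma0_ge0 _ _)) normfV (gtr0_norm t20).
have -> : K * Gamma0 v (2 * t) = (2 * t)^-1 * ((1 + 8 * t) * Num.sqrt 2 * Gamma0 v (2 * t)).
  by rewrite /K; ring.
rewrite mulrAC (mulrC _ (2 * t)^-1) ler_pM2l ?invr_gt0//.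
apply: le_trans (Gamma0_moment v t0); rewrite ler_wpM2r ?Gamma0_ge0//.
by rewrite ler_norml; nra.
Qed.

Lemma Gamma0_le t w s : 0 < t -> 0 <= w -> 0 <= s -> Gamma0 (w + s) t <= Gamma0 s t.
Proof.
move=> t0 w0 s0; rewrite /Gamma0 ler_pM2r ?invr_gt0 ?sqrtr_gt0 ?pi4_gt0//.
rewrite ler_expR lerN2 ler_pM2r ?invr_gt0; last lra.
by rewrite ler_sqr ?nnegrE ?addr_ge0// lerDr.
Qed.

(** The decay in r comes from [trigI_decay], uniform because x - w stays in [0, X]; the decay in s
    from Gamma0 (w + s) <= Gamma0 s for w, s >= 0. *)
Lemma Mc_qm t k X : 0 < t -> exists2 C, 0 <= C & forall r x s, 0 <= x <= X -> 0 <= s ->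
  `|Mc t k.+1 r x s| <= C * (qm r * qm s) /\ `|Ms t k.+1 r x s| <= C * (qm r * qm s).
Proof.
move=> t0; have [M M0 HM] := trigI_decay k `|X| t0; have [C C0 HC] := Gamma0_qm t0.
exists (M * C * `|X|); first by rewrite !mulr_ge0.
move=> r x s /andP[x0 xX] s0.
have main (f : R -> R) : measurable_fun setT f ->
    (forall w, 0 <= w <= x -> `|f w| <= M * qm r) ->
    `|\int[leb]_(w in `[0, x]) (f w * Gamma0 (w + s) t)| <= M * C * `|X| * (qm r * qm s).
  move=> mf fM; apply: (@le_trans _ _ (M * qm r * (C * qm s) * x)); last first.
    have -> : M * qm r * (C * qm s) * x = M * C * (qm r * qm s) * x by ring.
    have -> : M * C * `|X| * (qm r * qm s) = M * C * (qm r * qm s) * `|X| by ring.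
    rewrite ler_wpM2l ?mulr_ge0 ?qm_ge0//; apply: le_trans (ler_norm _).
    exact: xX.
  rewrite -Rintegral_itv_cst//; apply: normr_Rintegral_le => //.
  - by apply: measurable_funTS; apply: measurable_funM => //; rewrite /Gamma0; mfun.
  - by apply: integrable_itv_cc => w; exact: cst_continuous.
  - move=> w /=; rewrite in_itv/= => /andP[w0 wx].
    rewrite normrM (ger0_norm (Gamma0_ge0 _ _)) ler_pM ?Gamma0_ge0//.
      by apply: fM; rewrite w0.
    exact: le_trans (Gamma0_le t0 w0 s0) (HC _).
have aX w : 0 <= w <= x -> `|x - w| <= `|X|.
  move=> /andP[w0 wx]; rewrite ger0_norm; last lra.
  by apply: le_trans (ler_norm X); lra.
split; apply: main.
- by apply: measurable_cosI; mfun.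
- by move=> w /aX h; have [] := HM r (x - w) h.
- by apply: measurable_sinI; mfun.
- by move=> w /aX h; have [] := HM r (x - w) h.
Qed.

End Majorants.

Section SingularBound.
Context {R : realType}.
Local Notation leb := (@lebesgue_measure R).
Local Notation leb2 := (@lebm2 R).
Implicit Types (y z : R * R) (v : R).

Lemma Rintegral_expR_sqr (e : R) : 0 < e ->
  \int[leb]_s expR (- (e * s ^+ 2)) = Num.sqrt (pi / e).
Proof.
move=> e0; have t0 : 0 < (4 * e)^-1 by rewrite invr_gt0; lra.
under eq_Rintegral do rewrite expR_sqr_Gamma0//.
by rewrite RintegralZl ?Rintegral_Gamma0 ?mulr1//; exact: integrable_Gamma0.
Qed.

(** The value at height 0, through which the jump of the primitive at z_2 = y_2 becomes a heat
    kernel. *)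
Lemma cosI_gauss0 (t r : R) : 0 < t -> cosI t 0 r 0 = pi * Gamma0 r t.
Proof.
move=> t0; have th0 : 0 < (4 * t)^-1 by rewrite invr_gt0; lra.
have H : \int[leb]_s (expR (- (t * s ^+ 2)) * cos (s * r)) = 2 * cosI t 0 r 0.
  rewrite Rintegral_fold; last first.
    by apply: integrable_trig; [exact: integrable_expR_sqr|mfun|move=> x; exact: cos_max].
  rewrite -RintegralZl//; last exact/integrable_kap_cos/admt.
  apply: eq_Rintegral => s _.
  by rewrite sqrrN mulNr cosN /kap expr0 mul0r oppr0 sub0r (mulrC s r); ring.
suff : 2 * cosI t 0 r 0 = 2 * (pi * Gamma0 r t) by lra.
rewrite -H.
have -> : \int[leb]_s (expR (- (t * s ^+ 2)) * cos (s * r)) =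
    Num.sqrt (pi / t) * \int[leb]_s (Gamma0 s (4 * t)^-1 * cos (s * r)).
  rewrite -RintegralZl//; last first.
    by apply: integrable_trig; [exact: integrable_Gamma0|mfun|move=> x; exact: cos_max].
  by apply: eq_Rintegral => s _; rewrite expR_sqr_Gamma0// mulrA.
rewrite Gamma0_cos// /Gamma0 (mulrC _ (r ^+ 2)).
have -> : 4 * pi * t = (2 * t) ^+ 2 * (pi / t) by field; rewrite gt_eqF.
rewrite (@sqrtrM _ ((2 * t) ^+ 2)) ?sqr_ge0// sqrtr_sqr ger0_norm; last lra.
have N0 : 0 < Num.sqrt (pi / t) by rewrite sqrtr_gt0 divr_gt0// pi_gt0.
have NN : Num.sqrt (pi / t) ^+ 2 = pi / t by rewrite sqr_sqrtr// divr_ge0 ?pi_ge0// ltW.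
move: (Num.sqrt (pi / t)) NN N0 => N NN N0.
have pE : pi = t * N ^+ 2 by rewrite NN; field; rewrite gt_eqF.
by rewrite pE; field; rewrite !gt_eqF.
Qed.

(* By Gauss, sing z y = sqrt pi / |z - y| off the diagonal. *)
Definition sing z y : R :=
  \int[leb]_v expR (- (sqn (z.1 - y.1) (z.2 - y.2) * v ^+ 2)).

Lemma sing_ge0 z y : 0 <= sing z y.
Proof. by apply: Rintegral_ge0 => v _; exact: expR_ge0. Qed.

Let gaussfac (c v a : R) : R := qm a * expR (- (v ^+ 2 * (a - c) ^+ 2)).

Let gaussfac_ge0 c v a : 0 <= gaussfac c v a.
Proof. by rewrite mulr_ge0 ?expR_ge0 ?qm_ge0. Qed.

Let gaussfac_int c v : leb.-integrable setT (EFin \o gaussfac c v).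
Proof.
have Q := @integrable_qm R.
apply: le_integrableR Q => //; first by rewrite /gaussfac /qm; mfun.
move=> a _; rewrite ger0_norm// ler_piMr ?qm_ge0//.
by rewrite -[leRHS]expR0 ler_expR oppr_le0 mulr_ge0 ?sqr_ge0.
Qed.

Let gaussfac_le1 c v : \int[leb]_a gaussfac c v a <= \int[leb]_a qm a.
Proof.
apply: le_Rintegral => //; first exact: integrable_qm.
move=> a _; rewrite ler_piMr ?qm_ge0//.
by rewrite -[leRHS]expR0 ler_expR oppr_le0 mulr_ge0 ?sqr_ge0.
Qed.

Let gaussfac_le2 c v : v != 0 -> \int[leb]_a gaussfac c v a <= Num.sqrt (pi / v ^+ 2).
Proof.
move=> v0; have v2 : 0 < v ^+ 2 by rewrite exprn_even_gt0.
have I1 := integrable_expR_sqr v2.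
have I2 := integrable_subl c I1.
rewrite -Rintegral_expR_sqr// -(Rintegral_subl c I1).
apply: le_Rintegral => // a _.
rewrite /gaussfac -(sqrrN (a - c)) opprB ler_piMl ?expR_ge0//.
exact: qm_le1.
Qed.

(** Each factor is bounded by the integral of [qm] and by sqrt pi / |v|. The first bound is used for
    |v| <= 1, the second for |v| > 1, where the two coordinates together give the integrable pi /
    v^2; the factor 2 comes from 1 + v^2 <= 2 max(1, v^2). *)
Let gaussfac_prod c1 c2 v :
  (\int[leb]_a gaussfac c1 v a) * (\int[leb]_a gaussfac c2 v a) <=
  2 * ((\int[leb]_a (@qm R) a) ^+ 2 + pi) * qm v.
Proof.
set Q := \int[leb]_a qm a.
have Q0 : 0 <= Q by apply: Rintegral_ge0 => a _; exact: qm_ge0.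
have J0 c : 0 <= \int[leb]_a gaussfac c v a by apply: Rintegral_ge0 => a _.
have p0 := pi_gt0 R.
rewrite /qm ler_pdivlMr; last by rewrite ltr_wpDr ?sqr_ge0.
have h1 : (\int[leb]_a gaussfac c1 v a) * (\int[leb]_a gaussfac c2 v a) <= Q ^+ 2.
  by rewrite expr2 ler_pM// gaussfac_le1.
have h0 : 0 <= (\int[leb]_a gaussfac c1 v a) * (\int[leb]_a gaussfac c2 v a) by exact: mulr_ge0.
have [v1|v1] := leP (v ^+ 2) 1.
  have : 0 <= v ^+ 2 by exact: sqr_ge0.
  move: h0 h1; move: (_ * _) => P; move: (Q ^+ 2) (v ^+ 2) v1 => Q2 V; nra.
have v0 : v != 0 by apply: contraTN v1 => /eqP ->; rewrite expr0n/= ltr10.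
have v20 : 0 < v ^+ 2 by rewrite exprn_even_gt0.
have h2 : (\int[leb]_a gaussfac c1 v a) * (\int[leb]_a gaussfac c2 v a) <= pi / v ^+ 2.
  have -> : pi / v ^+ 2 = Num.sqrt (pi / v ^+ 2) ^+ 2 by rewrite sqr_sqrtr// divr_ge0 ?sqr_ge0 ?ltW.
  by rewrite expr2 ler_pM// gaussfac_le2.
move: h2; rewrite ler_pdivlMr//; move: h0 h1; move: (_ * _) => P.
have : 0 <= Q ^+ 2 by exact: sqr_ge0.
move: (Q ^+ 2) (v ^+ 2) v1 v20 p0 => Q2 V; move: (@pi R) => q; nra.
Qed.

Let Phi y (p : (R * R) * R) : R :=
  qm p.1.1 * qm p.1.2 * expR (- (sqn (p.1.1 - y.1) (p.1.2 - y.2) * p.2 ^+ 2)).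

Let Phi_ge0 y p : 0 <= Phi y p.
Proof. by rewrite !mulr_ge0 ?expR_ge0 ?qm_ge0. Qed.

Let PhiE y z v : Phi y (z, v) = gaussfac y.1 v z.1 * gaussfac y.2 v z.2.
Proof.
rewrite /Phi /gaussfac /sqn /= mulrDl opprD expRD.
by rewrite (mulrC (v ^+ 2) (_ ^+ 2)) (mulrC (v ^+ 2) (_ ^+ 2)); ring.
Qed.

Let measurable_Phi y : measurable_fun setT (Phi y).
Proof. rewrite /Phi /qm /sqn; mfun. Qed.

Let prod_int (f g : R -> R) : leb.-integrable setT (EFin \o f) ->
  leb.-integrable setT (EFin \o g) ->
  leb2.-integrable setT (EFin \o (fun z => f z.1 * g z.2)).
Proof. by move=> fi gi; have := integrable_prod measurableT measurableT fi gi; rewrite setXTT. Qed.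

Let prod_Rint (f g : R -> R) : leb.-integrable setT (EFin \o f) ->
  leb.-integrable setT (EFin \o g) ->
  \int[leb2]_z (f z.1 * g z.2) = (\int[leb]_a f a) * (\int[leb]_a g a).
Proof.
move=> fi gi; have pi_ := prod_int fi gi.
have <- := @Rintegral_fubini1 _ _ _ _ _ leb leb (fun z => f z.1 * g z.2) pi_.
under eq_Rintegral do rewrite /= RintegralZl//.
by rewrite RintegralZr.
Qed.

Let Cs : R := 2 * ((\int[leb]_a (@qm R) a) ^+ 2 + pi).

Let Phi_slice y v : leb2.-integrable setT (EFin \o (fun z => Phi y (z, v))) /\
  \int[leb2]_z Phi y (z, v) <= Cs * qm v.
Proof.
split.
  apply: eq_integrable (prod_int (gaussfac_int y.1 v) (gaussfac_int y.2 v)) => // z _.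
  by rewrite /= PhiE.
under eq_Rintegral do rewrite PhiE.
by rewrite prod_Rint//; exact: gaussfac_prod.
Qed.

Let integrable_Phi y : (leb2 \x leb)%E.-integrable setT (EFin \o Phi y).
Proof.
apply/(integrable21ltyP leb2 leb); first by apply/measurable_EFinP; exact: measurable_Phi.
have Qi := @integrableRZl _ _ _ leb _ measurableT Cs _ (@integrable_qm R).
apply: (@le_lt_trans _ _ (\int[leb]_v (Cs * qm v)%:E)%E); last exact: integrable_lty Qi.
apply: ge0_le_integral => //.
- by move=> v _; apply: integral_ge0.
- apply: (@measurable_fun_fubini_tonelli_G _ _ _ _ _ leb2 (fun p => `|(Phi y p)%:E|)%E) => //.
  by apply: measurableT_comp => //; apply/measurable_EFinP; exact: measurable_Phi.
- exact: measurable_int Qi.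
- move=> v _; have [Pi Pl] := Phi_slice y v.
  under eq_integral do rewrite /= ger0_norm//.
  by rewrite -(fineK (integrable_fin_num measurableT Pi)) lee_fin.
Qed.

(** With the v-integral of [sing] outside, the z-integral at fixed v is a product of two
    one-dimensional integrals, bounded by a multiple of [qm v] that does not depend on y. *)
Lemma singular_bound : exists2 C : R, 0 <= C & forall y,
  leb2.-integrable setT (EFin \o (fun z => qm z.1 * qm z.2 * sing z y)) /\
  \int[leb2]_z (qm z.1 * qm z.2 * sing z y) <= C.
Proof.
have Qi := @integrableRZl _ _ _ leb _ measurableT Cs _ (@integrable_qm R).
exists `|\int[leb]_v (Cs * qm v)| => // y.
have sE z : qm z.1 * qm z.2 * sing z y = \int[leb]_v Phi y (z, v).
  rewrite /sing.
  have [s0|s0] := ltP 0 (sqn (z.1 - y.1) (z.2 - y.2)).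
    by rewrite -RintegralZl//; exact: integrable_expR_sqr.
  (* On the diagonal the integrand is constant in v; its integral over the line is infinite, and
     both sides have the default value 0. *)
  have sq0 : sqn (z.1 - y.1) (z.2 - y.2) = 0.
    by apply/eqP; rewrite eq_le s0/= addr_ge0 ?sqr_ge0.
  rewrite /Phi /= sq0; under eq_Rintegral do rewrite mul0r oppr0 expR0.
  under [in RHS]eq_Rintegral do rewrite mul0r oppr0 expR0 mulr1.
  by rewrite !Rintegral_cst// mul1r.
have iP := integrable_Phi y.
split.
  apply: eq_integrable (integrable_fubini1 iP) => // z _; by rewrite /= sE.
under eq_Rintegral do rewrite sE.
rewrite (Rfubini iP); apply: le_trans (ler_norm _).
apply: le_Rintegral => //; first exact: integrable_fubini2 iP.
by move=> v _; have [] := Phi_slice y v.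
Qed.

Lemma sing_offdiag z y : 0 < sqn (z.1 - y.1) (z.2 - y.2) ->
  sing z y = Num.sqrt pi / Num.sqrt (sqn (z.1 - y.1) (z.2 - y.2)).
Proof.
move=> s0; rewrite /sing Rintegral_expR_sqr// sqrtrM ?pi_ge0//.
by rewrite sqrtrV ?(ltW s0).
Qed.

Lemma measurable_sing : measurable_fun setT (fun p : (R * R) * (R * R) => sing p.1 p.2).
Proof.
rewrite /sing; apply: (@measurable_Rintegral_param_on _ _ _ _ R leb
  (fun q : ((R * R) * (R * R)) * R =>
    expR (- (sqn (q.1.1.1 - q.1.2.1) (q.1.1.2 - q.1.2.2) * q.2 ^+ 2)))) => //.
rewrite /sqn; mfun.
Qed.

Lemma measurable_K1 : measurable_fun setT (fun p : (R * R) * (R * R) => K1 p.1 p.2).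
Proof. rewrite /K1 /sqn; mfun. Qed.

Lemma measurable_K2 : measurable_fun setT (fun p : (R * R) * (R * R) => K2 p.1 p.2).
Proof. rewrite /K2 /sqn; mfun. Qed.

Let frac_le (n m : R) : `|n / sqn m n| <= (Num.sqrt (sqn m n))^-1.
Proof.
have [s0|s0] := ltP 0 (sqn m n); last first.
  by rewrite ler0_sqrtr// invr0 (_ : sqn m n = 0) ?invr0 ?mulr0 ?normr0//;
    apply/eqP; rewrite eq_le s0/= addr_ge0 ?sqr_ge0.
have N0 : 0 < Num.sqrt (sqn m n) by rewrite sqrtr_gt0.
rewrite -[in X in X <= _](sqr_sqrtr (ltW s0)) normrM normfV (ger0_norm (sqr_ge0 _)).
rewrite expr2 invfM mulrA ler_piMl ?invr_ge0 ?(ltW N0)// ler_pdivrMr// mul1r.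
by rewrite -sqrtr_sqr ler_wsqrtr// lerDr sqr_ge0.
Qed.

Let sqn_mono (s b c : R) : `|b| <= `|c| -> 0 < sqn s b ->
  (Num.sqrt (sqn s c))^-1 <= (Num.sqrt (sqn s b))^-1.
Proof.
move=> bc s0; have bc2 : sqn s b <= sqn s c.
  by rewrite lerD2l -(real_normK (num_real b)) -(real_normK (num_real c)) ler_sqr ?nnegrE.
have s0' := lt_le_trans s0 bc2.
by rewrite lef_pV2 ?posrE ?sqrtr_gt0// ler_wsqrtr.
Qed.

(** The image term is no larger than the bound for the direct one, since |z_2 - y_2| <= z_2 + y_2 in
    the half plane. The constants fit because 2 / (2 pi) <= sqrt pi; on the diagonal both components
    are 0. *)
Lemma K_bound z y : half_plane z -> half_plane y ->
  `|K1 z y| <= sing z y /\ `|K2 z y| <= sing z y.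
Proof.
rewrite /half_plane /= => z0 y0.
have bc : `|z.2 - y.2| <= `|z.2 + y.2|.
  by rewrite (gtr0_norm (addr_gt0 z0 y0)) ler_norml; apply/andP; split; lra.
have p0 := pi_gt0 R; have p2 : 2 <= pi :> R := pi_ge2 R.
have [s0|s0] := ltP 0 (sqn (z.1 - y.1) (z.2 - y.2)); last first.
  have /andP[e1 e2] : (z.1 == y.1) && (z.2 == y.2).
    rewrite -subr_eq0 -(subr_eq0 z.2) -(sqrf_eq0 (z.1 - y.1)) -(sqrf_eq0 (z.2 - y.2)).
    by rewrite -paddr_eq0 ?sqr_ge0// eq_le s0 addr_ge0 ?sqr_ge0.
  rewrite /K1 e1 e2 normr0 sing_ge0; split => //.
  by rewrite /K2 (eqP e1) subrr !mul0r subrr mul0r normr0 sing_ge0.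
set N := Num.sqrt (sqn (z.1 - y.1) (z.2 - y.2)).
have N0 : 0 < N by rewrite sqrtr_gt0.
have Ni0 : 0 <= N^-1 by rewrite invr_ge0 ltW.
have main (a b : R) : `|a| <= N^-1 -> `|b| <= N^-1 ->
    `|(a - b) / (2 * pi)| <= sing z y.
  move=> aN bN; rewrite sing_offdiag// -/N normrM normfV (gtr0_norm (_ : 0 < 2 * pi)) ?mulr_gt0//.
  have h : `|a - b| <= 2 * N^-1.
    by apply: le_trans (ler_normB _ _) _; lra.
  rewrite ler_pdivrMr ?mulr_gt0//; apply: le_trans h _.
  have sp : 1 <= Num.sqrt pi :> R by rewrite -sqrtr1 ler_wsqrtr//; lra.
  have -> : Num.sqrt pi / N * (2 * pi) = (Num.sqrt pi * pi) * (2 * N^-1) by ring.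
  by rewrite ler_peMl ?mulr_ge0//; nra.
have f1 := frac_le (z.2 - y.2) (z.1 - y.1).
have f2 := frac_le (z.2 + y.2) (z.1 - y.1).
have f2' := le_trans f2 (sqn_mono bc s0).
have sw (a b : R) : sqn a b = sqn b a by rewrite /sqn addrC.
have g1 : `|(z.1 - y.1) / sqn (z.1 - y.1) (z.2 - y.2)| <= N^-1.
  by rewrite /N (sw _ (z.2 - y.2)); exact: frac_le.
have g2 : `|(z.1 - y.1) / sqn (z.1 - y.1) (z.2 + y.2)| <= N^-1.
  apply: le_trans (sqn_mono bc s0).
  by rewrite (sw _ (z.2 + y.2)); exact: frac_le.
split; last by rewrite /K2; exact: main.
have H : `|- ((z.2 - y.2) / sqn (z.1 - y.1) (z.2 - y.2)
     - (z.2 + y.2) / sqn (z.1 - y.1) (z.2 + y.2)) / (2 * pi)| <= sing z y.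
  by rewrite mulNr normrN; exact: main.
by rewrite /K1; case: ifP => // _; case: ifP => // _; rewrite normr0 sing_ge0.
Qed.

Lemma measurable_half_plane : measurable (@half_plane R).
Proof.
have -> : @half_plane R = setT `*` `]0, +oo[%classic.
  by apply/seteqP; split => z /=; rewrite in_itv/= andbT; [split|case].
exact: measurableX.
Qed.

Section FiniteMeasure.
Variable mu : {finite_measure set (R * R)%type -> \bar R}.

(** Tonelli with z inside: by [singular_bound] the z-integral is bounded uniformly in y, and mu is
    finite. *)
Lemma integrable_gK (g : R * R -> R) (K : R * R -> R * R -> R) (C : R) :
  measurable_fun setT g -> measurable_fun setT (fun p => K p.1 p.2) ->
  (forall z y, half_plane z -> half_plane y -> `|K z y| <= sing z y) ->
  (forall z, half_plane z -> `|g z| <= C * (qm z.1 * qm z.2)) ->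
  (leb2 \x mu)%E.-integrable (half_plane `*` half_plane) (EFin \o (fun p => g p.1 * K p.1 p.2)).
Proof.
move=> mg mK HK Hg.
have mH := measurable_half_plane.
have mHH : measurable (@half_plane R `*` @half_plane R) by exact: measurableX.
have mf : measurable_fun setT (fun p : (R * R) * (R * R) => g p.1 * K p.1 p.2).
  by apply: measurable_funM => //; exact: (measurableT_comp mg measurable_fst).
have [M M0 HM] := singular_bound.
pose h (p : (R * R) * (R * R)) := `|C| * (qm p.1.1 * qm p.1.2 * sing p.1 p.2).
have mh : measurable_fun setT h.
  apply: measurable_funM => //; apply: measurable_funM; last exact: measurable_sing.
  rewrite /qm; mfun.
have h0 p : 0 <= h p by rewrite !mulr_ge0 ?qm_ge0 ?sing_ge0.
have hi : (leb2 \x mu)%E.-integrable setT (EFin \o h).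
  apply/(integrable21ltyP leb2 mu); first exact/measurable_EFinP.
  apply: (@le_lt_trans _ _ (\int[mu]_y (`|C| * M)%:E)%E).
    apply: ge0_le_integral => //.
    - by move=> y _; apply: integral_ge0.
    - apply: (@measurable_fun_fubini_tonelli_G _ _ _ _ _ leb2 (fun p => `|(h p)%:E|)%E) => //.
      by apply: measurableT_comp => //; exact/measurable_EFinP.
    - move=> y _; have [Pi Pl] := HM y.
      have Pi' := integrableRZl measurableT `|C| Pi.
      under eq_integral do rewrite /= (ger0_norm (h0 _)).
      rewrite -(fineK (integrable_fin_num measurableT Pi')) lee_fin.
      rewrite -[leLHS]/(\int[leb2]_x (`|C| * (qm x.1 * qm x.2 * sing x y))).
      by rewrite RintegralZl// ler_wpM2l.
  by rewrite integral_cst// lte_mul_pinfty// ?lee_fin ?mulr_ge0// ltey_eq fin_num_measure.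
have hi' : (leb2 \x mu)%E.-integrable (half_plane `*` half_plane) (EFin \o h).
  exact: integrableS hi.
apply: le_integrableR hi' => //; first exact: measurable_funTS.
move=> [z y] [/= zH yH]; rewrite /h /= mulrA normrM ler_pM ?HK//.
apply: le_trans (Hg _ zH) _.
by rewrite ler_wpM2r ?mulr_ge0 ?qm_ge0// ler_norm.
Qed.

End FiniteMeasure.

End SingularBound.

(** * Kernels of the velocity and of its derivatives *)

Section VorticityKernels.
Context {R : realType}.
Local Notation leb := (@lebesgue_measure R).
Local Notation leb2 := (@lebm2 R).
Variable t : R.
Hypothesis t0 : 0 < t.
Implicit Types (x y z : R * R).

(** Entries of the Stokes kernel, with indices counted from 0: [g00], [g10], [g11] are G_11, G_21,
    G_22, while G_12 vanishes. The prefixes [d1] and [d2] stand for derivatives in x_1 and x_2. *)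
Definition g11 x z : R := Gamma0 (x.1 - z.1) t * (Gamma0 (x.2 - z.2) t - Gamma0 (x.2 + z.2) t).
Definition g00 x z : R := g11 x z + 2 / pi * Mc t 1 (x.1 - z.1) x.2 z.2.
Definition g10 x z : R := - (2 / pi * Ms t 1 (x.1 - z.1) x.2 z.2).
Definition d1g11 x z : R := dGamma0 (x.1 - z.1) t * (Gamma0 (x.2 - z.2) t - Gamma0 (x.2 + z.2) t).
Definition d1g10 x z : R := - (2 / pi * Mc t 2 (x.1 - z.1) x.2 z.2).
Definition d2g00 x z : R :=
  Gamma0 (x.1 - z.1) t * (dGamma0 (x.2 - z.2) t - dGamma0 (x.2 + z.2) t) +
  2 / pi * (cosI t 1 (x.1 - z.1) 0 * Gamma0 (x.2 + z.2) t - Mc t 2 (x.1 - z.1) x.2 z.2).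

Lemma g11E x z : Gamma (x - z) t - Gamma (x - star z) t = g11 x z.
Proof. by rewrite !GammaE//= opprK /g11 mulrBr. Qed.

Lemma stokes_ker00E x z : stokes_ker 0 0 x z t = g00 x z.
Proof. by rewrite stokes_ker00// g11E. Qed.

Lemma stokes_ker11E x z : stokes_ker 1 1 x z t = g11 x z.
Proof. by rewrite stokes_ker11 g11E. Qed.

Lemma stokes_ker10E x z : stokes_ker 1 0 x z t = g10 x z.
Proof. by rewrite stokes_ker10. Qed.

Lemma hasd_g11 x z : hasd (fun s => g11 (s, x.2) z) x.1 (d1g11 x z).
Proof.
rewrite /g11 /=; eapply hasd_eq.
  apply: hasd_mul; last exact: hasd_cst.
  by apply: (@hasd_comp _ (fun r => Gamma0 r t) (fun s => s - z.1)); [isd|exact: hasd_Gamma0].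
by rewrite /d1g11 /=; ring.
Qed.

Lemma hasd_g10 x z : hasd (fun s => g10 (s, x.2) z) x.1 (d1g10 x z).
Proof.
rewrite /g10 /=; eapply hasd_eq.
  apply: hasd_opp; apply: hasd_mul; first exact: hasd_cst.
  by apply: (@hasd_comp _ (fun r => Ms t 1 r x.2 z.2) (fun s => s - z.1)); [isd|exact: hasd_Ms_r].
by rewrite /d1g10 /=; move: (2 / pi) => P; ring.
Qed.

Lemma hasd_g00 x z : half_plane x -> hasd (fun s => g00 (x.1, s) z) x.2 (d2g00 x z).
Proof.
rewrite /half_plane /g00 /g11 /= => x0; eapply hasd_eq.
  apply: hasd_add; apply: hasd_mul; try exact: hasd_cst.
    apply: hasd_add; last apply: hasd_opp.
      by apply: (@hasd_comp _ (fun r => Gamma0 r t) (fun s => s - z.2)); [isd|exact: hasd_Gamma0].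
    by apply: (@hasd_comp _ (fun r => Gamma0 r t) (fun s => s + z.2)); [isd|exact: hasd_Gamma0].
  exact: hasd_Mc_x.
rewrite /d2g00 /=; move: (2 / pi) (Gamma0 (x.1 - z.1) t) (dGamma0 (x.2 - z.2) t)
  (dGamma0 (x.2 + z.2) t) (Gamma0 (x.2 + z.2) t) (Gamma0 (x.2 - z.2) t)
  (cosI t 1 (x.1 - z.1) 0) (Mc t 2 (x.1 - z.1) x.2 z.2) (Mc t 1 (x.1 - z.1) x.2 z.2) => *.
ring.
Qed.

Lemma measurable_g11 x : measurable_fun setT (g11 x).
Proof. by rewrite /g11 /Gamma0; mfun. Qed.

Lemma measurable_d1g11 x : measurable_fun setT (d1g11 x).
Proof. by rewrite /d1g11 /dGamma0 /Gamma0; mfun. Qed.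

Let measurable_Mcz k x : measurable_fun setT (fun z => Mc t k (x.1 - z.1) x.2 z.2).
Proof.
apply: (measurableT_comp (measurable_Mc t k x.2)
  (_ : measurable_fun setT (fun z : R * R => (x.1 - z.1, z.2)))).
by apply: measurable_fun_pair; mfun.
Qed.

Let measurable_Msz k x : measurable_fun setT (fun z => Ms t k (x.1 - z.1) x.2 z.2).
Proof.
apply: (measurableT_comp (measurable_Ms t k x.2)
  (_ : measurable_fun setT (fun z : R * R => (x.1 - z.1, z.2)))).
by apply: measurable_fun_pair; mfun.
Qed.

Lemma measurable_g00 x : measurable_fun setT (g00 x).
Proof.
apply: measurable_funD; first exact: measurable_g11.
by apply: measurable_funM; [mfun|exact: measurable_Mcz].
Qed.

Lemma measurable_g10 x : measurable_fun setT (g10 x).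
Proof.
by apply: measurable_funN; apply: measurable_funM; [mfun|exact: measurable_Msz].
Qed.

Lemma measurable_d1g10 x : measurable_fun setT (d1g10 x).
Proof.
by apply: measurable_funN; apply: measurable_funM; [mfun|exact: measurable_Mcz].
Qed.

Lemma measurable_d2g00 x : measurable_fun setT (d2g00 x).
Proof.
apply: measurable_funD; first by rewrite /dGamma0 /Gamma0; mfun.
apply: measurable_funM; first mfun.
apply: measurable_funB; last exact: measurable_Mcz.
apply: measurable_funM; last by rewrite /Gamma0; mfun.
by apply: measurable_cosI; mfun.
Qed.

Let bnd2 (a b A B p q : R) : 0 <= p -> 0 <= q -> `|a| <= A * p -> `|b| <= B * q ->
  `|a * b| <= A * B * (p * q).
Proof.
move=> p0 q0 aA bB; rewrite normrM (_ : A * B * (p * q) = A * p * (B * q)); last ring.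
exact: ler_pM.
Qed.

Let le6 (a b c d e f : R) : 0 <= a -> 0 <= b -> 0 <= c -> 0 <= d -> 0 <= e -> 0 <= f ->
  [/\ a + d <= a + b + c + d + e + f, d <= a + b + c + d + e + f,
      a <= a + b + c + d + e + f, b + (f + e) <= a + b + c + d + e + f &
      e <= a + b + c + d + e + f /\ c <= a + b + c + d + e + f].
Proof. by move=> *; do !split; lra. Qed.

(** Uniformity in x over a bounded set is what differentiation under the integral requires. The
    constant adds up the bounds of the six elementary terms, so that one C serves every kernel. *)
Lemma kernel_bound S : exists2 C : R, 0 <= C & forall x z,
  `|x.1| <= S -> 0 <= x.2 <= S -> half_plane z ->
  [/\ `|g00 x z| <= C * (qm z.1 * qm z.2), `|g10 x z| <= C * (qm z.1 * qm z.2),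
      `|g11 x z| <= C * (qm z.1 * qm z.2), `|d2g00 x z| <= C * (qm z.1 * qm z.2) &
      `|d1g10 x z| <= C * (qm z.1 * qm z.2) /\ `|d1g11 x z| <= C * (qm z.1 * qm z.2)].
Proof.
have [CG CG0 HG] := Gamma0_qm t0; have [CD CD0 HD] := dGamma0_qm t0.
have [C1 C10 H1] := Mc_qm 0 S t0; have [C2 C20 H2] := Mc_qm 1 S t0.
have [CL CL0 HL] := trigI_decay 0 0 t0.
(* The constant of [qm_shift], which turns bounds in x - z into bounds in z. *)
pose L := 2 + 2 * S ^+ 2.
have L0 : 0 <= L by rewrite addr_ge0// mulr_ge0 ?sqr_ge0.
pose A11 := (CG * L) * (2 * CG * L).
pose AD := (CG * L) * (2 * CD * L).
pose A1 := (CD * L) * (2 * CG * L).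
pose P := 2 / pi : R.
have P0 : 0 <= P by rewrite divr_ge0// pi_ge0.
pose M1 := P * (C1 * L); pose M2 := P * (C2 * L); pose ML := P * ((CL * L) * (CG * L)).
have A110 : 0 <= A11 by rewrite !mulr_ge0.
have AD0 : 0 <= AD by rewrite !mulr_ge0.
have A10 : 0 <= A1 by rewrite !mulr_ge0.
have M10 : 0 <= M1 by rewrite mulr_ge0// mulr_ge0.
have M20 : 0 <= M2 by rewrite mulr_ge0// mulr_ge0.
have ML0 : 0 <= ML by rewrite mulr_ge0// !mulr_ge0.
exists (A11 + AD + A1 + M1 + M2 + ML); first by rewrite !addr_ge0.
move=> x z xS /andP[x20 x2S]; rewrite /half_plane /= => z0.
have z00 : 0 <= z.2 := ltW z0.
have x2S' : `|x.2| <= S by rewrite ger0_norm.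
set Q := qm z.1 * qm z.2.
have q1 := qm_ge0 z.1; have q2 := qm_ge0 z.2.
have Q0 : 0 <= Q by exact: mulr_ge0.
have s1 : qm (x.1 - z.1) <= L * qm z.1 := qm_shift z.1 xS.
have s2 : qm (x.2 - z.2) <= L * qm z.2 := qm_shift z.2 x2S'.
have s3 : qm (x.2 + z.2) <= L * qm z.2.
  have -> : x.2 + z.2 = x.2 - - z.2 by rewrite opprK.
  by rewrite -(qmN z.2); exact: qm_shift.
have G1 : `|Gamma0 (x.1 - z.1) t| <= CG * L * qm z.1.
  rewrite ger0_norm ?Gamma0_ge0//; apply: le_trans (HG _) _.
  by rewrite -mulrA ler_wpM2l.
have dG1 : `|dGamma0 (x.1 - z.1) t| <= CD * L * qm z.1.
  by apply: le_trans (HD _) _; rewrite -mulrA ler_wpM2l.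
have G3 : `|Gamma0 (x.2 + z.2) t| <= CG * L * qm z.2.
  rewrite ger0_norm ?Gamma0_ge0//; apply: le_trans (HG _) _.
  by rewrite -mulrA ler_wpM2l.
have G2 : `|Gamma0 (x.2 - z.2) t - Gamma0 (x.2 + z.2) t| <= 2 * CG * L * qm z.2.
  apply: le_trans (ler_normB _ _) _.
  have : `|Gamma0 (x.2 - z.2) t| <= CG * L * qm z.2.
    rewrite ger0_norm ?Gamma0_ge0//; apply: le_trans (HG _) _.
    by rewrite -mulrA ler_wpM2l.
  by move: G3; lra.
have dG2 : `|dGamma0 (x.2 - z.2) t - dGamma0 (x.2 + z.2) t| <= 2 * CD * L * qm z.2.
  apply: le_trans (ler_normB _ _) _.
  have : `|dGamma0 (x.2 - z.2) t| <= CD * L * qm z.2.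
    by apply: le_trans (HD _) _; rewrite -mulrA ler_wpM2l.
  have : `|dGamma0 (x.2 + z.2) t| <= CD * L * qm z.2.
    by apply: le_trans (HD _) _; rewrite -mulrA ler_wpM2l.
  lra.
have xS2 : 0 <= x.2 <= S by rewrite x20.
have [m1c m1s] := H1 (x.1 - z.1) x.2 z.2 xS2 z00.
have [m2c _] := H2 (x.1 - z.1) x.2 z.2 xS2 z00.
have lift (C : R) : 0 <= C -> C * (qm (x.1 - z.1) * qm z.2) <= C * L * Q.
  by move=> C0; rewrite /Q -mulrA ler_wpM2l// mulrA ler_wpM2r.
have cl : `|cosI t 1 (x.1 - z.1) 0| <= CL * L * qm z.1.
  have h0 : `|0 : R| <= 0 by rewrite normr0.
  have [h _] := HL (x.1 - z.1) 0 h0.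
  by apply: le_trans h _; rewrite -mulrA ler_wpM2l.
have b11 : `|g11 x z| <= A11 * Q := bnd2 q1 q2 G1 G2.
have bD : `|Gamma0 (x.1 - z.1) t * (dGamma0 (x.2 - z.2) t - dGamma0 (x.2 + z.2) t)| <= AD * Q.
  exact: bnd2 q1 q2 G1 dG2.
have b1 : `|d1g11 x z| <= A1 * Q := bnd2 q1 q2 dG1 G2.
have bM1c : `|P * Mc t 1 (x.1 - z.1) x.2 z.2| <= M1 * Q.
  by rewrite normrM (ger0_norm P0) -[leRHS]mulrA ler_wpM2l//; apply: le_trans m1c _; exact: lift.
have bM1s : `|P * Ms t 1 (x.1 - z.1) x.2 z.2| <= M1 * Q.
  by rewrite normrM (ger0_norm P0) -[leRHS]mulrA ler_wpM2l//; apply: le_trans m1s _; exact: lift.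
have bM2c : `|P * Mc t 2 (x.1 - z.1) x.2 z.2| <= M2 * Q.
  by rewrite normrM (ger0_norm P0) -[leRHS]mulrA ler_wpM2l//; apply: le_trans m2c _; exact: lift.
have bL : `|P * (cosI t 1 (x.1 - z.1) 0 * Gamma0 (x.2 + z.2) t)| <= ML * Q.
  by rewrite normrM (ger0_norm P0) -[leRHS]mulrA ler_wpM2l//; exact: bnd2 q1 q2 cl G3.
have n1 := mulr_ge0 A110 Q0; have n2 := mulr_ge0 AD0 Q0; have n3 := mulr_ge0 A10 Q0.
have n4 := mulr_ge0 M10 Q0; have n5 := mulr_ge0 M20 Q0; have n6 := mulr_ge0 ML0 Q0.
have [l1 l2 l3 l4 [l5 l6]] := le6 n1 n2 n3 n4 n5 n6.
rewrite !mulrDl; split; last split.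
- by apply: le_trans l1; apply: le_trans (ler_normD _ _) _; exact: (lerD b11 bM1c).
- by rewrite /g10 normrN; exact: le_trans bM1s l2.
- exact: le_trans b11 l3.
- apply: le_trans l4; rewrite /d2g00 (mulrBr (2 / pi)); apply: le_trans (ler_normD _ _) _.
  by apply: (lerD bD); apply: le_trans (ler_normB _ _) _; exact: (lerD bL bM2c).
- by rewrite /d1g10 normrN; exact: le_trans bM2c l5.
- exact: le_trans b1 l6.
Qed.

End VorticityKernels.

(** * Integration of the vorticity kernel over the half plane *)

Section FibreIdentity.
Context {R : realType}.
Local Notation leb := (@lebesgue_measure R).
Variable t : R.
Hypothesis t0 : 0 < t.
Implicit Types (x y z : R * R).

Lemma K1E z y : half_plane z -> half_plane y -> z.2 != y.2 ->
  K1 z y = - (Num.sg (z.2 - y.2) * cosI 0 0 (z.1 - y.1) `|z.2 - y.2|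
    - cosI 0 0 (z.1 - y.1) (z.2 + y.2)) / (2 * pi).
Proof.
rewrite /half_plane /= => z0 y0 zy.
have b0 : z.2 - y.2 != 0 by rewrite subr_eq0.
rewrite /K1 (negbTE zy) if_same !cosI00 ?addr_gt0 ?normr_gt0// real_normK ?num_real//.
by rewrite [in RHS]mulrA -numEsg.
Qed.

Lemma K2E z y : half_plane z -> half_plane y -> z.2 != y.2 ->
  K2 z y = (sinI 0 0 (z.1 - y.1) `|z.2 - y.2| - sinI 0 0 (z.1 - y.1) (z.2 + y.2)) / (2 * pi).
Proof.
rewrite /half_plane /= => z0 y0 zy.
have b0 : z.2 - y.2 != 0 by rewrite subr_eq0.
by rewrite /K2 !sinI00 ?addr_gt0 ?normr_gt0// real_normK ?num_real.
Qed.

Lemma integrable_cosI1 : leb.-integrable setT (EFin \o (fun s => cosI t 1 s 0)).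
Proof.
have [M M0 HM] := trigI_decay 0 0 t0.
have qi := @integrableRZl _ _ _ leb _ measurableT M _ (@integrable_qm R).
apply: le_integrableR qi => //; first by apply: measurable_cosI; mfun.
move=> s _; have h0 : `|0 : R| <= 0 by rewrite normr0.
have [h _] := HM s 0 h0; exact: h.
Qed.

(* The kernel of d_1 (S u)^2 - d_2 (S u)^1 for u = grad_perp D(., y). *)
Definition vort_ker x z y : R :=
  d1g11 t x z * K2 z y + d1g10 t x z * K1 z y - d2g00 t x z * K1 z y.

(** Here m and m' are the direct and the reflected vertical heat kernel, and b and c the heights
    relative to y and to its mirror image. The three lines come from [d1g11], from the heat part of
    [d2g00], and from the boundary term [cosI t 1 r 0] of its non-local part. *)
Definition vort_fibre x y (a : R) : R :=
  let r := x.1 - y.1 in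
  let m := Gamma0 (x.2 - a) t in let m' := Gamma0 (x.2 + a) t in
  let dm := dGamma0 (x.2 - a) t in let dm' := dGamma0 (x.2 + a) t in
  let b := a - y.2 in let c := a + y.2 in
  (m - m') / (2 * pi) * (cosI t 1 r `|b| - cosI t 1 r c)
  + (dm - dm') / (2 * pi) * (Num.sg b * cosI t 0 r `|b| - cosI t 0 r c)
  + m' / pi * (Num.sg b * cosI t 1 r `|b| - cosI t 1 r c).

Lemma Rintegral_vort_ker x y (a : R) : half_plane y -> 0 < a -> a != y.2 ->
  \int[leb]_u vort_ker x (u, a) y = vort_fibre x y a.
Proof.
rewrite /half_plane /= => y0 a0 ay.
have b0 : 0 < `|a - y.2| by rewrite normr_gt0 subr_eq0.
have c0 : 0 < a + y.2 by rewrite addr_gt0.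
rewrite /vort_fibre; move sgE : (Num.sg (a - y.2)) => s.
set b := `|a - y.2|; set c := a + y.2.
set m := Gamma0 (x.2 - a) t; set m' := Gamma0 (x.2 + a) t.
set dm := dGamma0 (x.2 - a) t; set dm' := dGamma0 (x.2 + a) t.
pose S u := sinI 0 0 (u - y.1) b - sinI 0 0 (u - y.1) c.
pose P u := s * cosI 0 0 (u - y.1) b - cosI 0 0 (u - y.1) c.
pose L u := cosI t 1 (x.1 - u) 0.
(* The [Mc t 2] terms of [d1g10] and [d2g00] cancel; what is left is a combination of convolutions
   in u. *)
have E u : vort_ker x (u, a) y =
    (m - m') / (2 * pi) * (dGamma0 (x.1 - u) t * S u) +
    (dm - dm') / (2 * pi) * (Gamma0 (x.1 - u) t * P u) +
    m' / pi / pi * (L u * P u).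
  rewrite /vort_ker K1E// K2E//= sgE -/b -/c -/(S u) -/(P u).
  rewrite /d1g11 /d1g10 /d2g00 /= -/m -/m' -/dm -/dm' -/(L u).
  move: (@pi R) (pi_gt0 R) => q q0.
  move: m m' dm dm' (L u) (S u) (P u) (Gamma0 _ _) (dGamma0 _ _) (Mc _ _ _ _ _) => *.
  by field; rewrite gt_eqF.
rewrite -/b in b0; rewrite -/c in c0; clearbody b c; move: m m' dm dm' E => m m' dm dm' E.
have [Bs HBs] := sinI0_bounded b0; have [Cs HCs] := sinI0_bounded c0.
have [Bc HBc] := cosI0_bounded 0 b0; have [Cc HCc] := cosI0_bounded 0 c0.
have Gi := integrable_subl x.1 (integrable_Gamma0 t0).
have dGi := integrable_subl x.1 (integrable_dGamma0 t0).
have Li : leb.-integrable setT (EFin \o L) := integrable_subl x.1 integrable_cosI1.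
have int (f h : R -> R) (M : R) : leb.-integrable setT (EFin \o f) -> measurable_fun setT h ->
    (forall v, `|h v| <= M) -> leb.-integrable setT (EFin \o (fun u => f u * h (u - y.1))).
  move=> fi mh hM; apply: (@integrableRMb _ _ _ _ _ _ _ _ M) => //.
  by apply: (measurableT_comp mh); mfun.
have mI' (d : R) : measurable_fun setT (fun u => sinI 0 0 u d) by apply: measurable_sinI; mfun.
have mJ' (d : R) : measurable_fun setT (fun u => cosI 0 0 u d) by apply: measurable_cosI; mfun.
have dGb := int _ _ _ dGi (mI' b) HBs; have dGc := int _ _ _ dGi (mI' c) HCs.
have Gb := int _ _ _ Gi (mJ' b) HBc; have Gc := int _ _ _ Gi (mJ' c) HCc.
have Lb := int _ _ _ Li (mJ' b) HBc; have Lc := int _ _ _ Li (mJ' c) HCc.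
have SE u : dGamma0 (x.1 - u) t * S u =
    dGamma0 (x.1 - u) t * sinI 0 0 (u - y.1) b - dGamma0 (x.1 - u) t * sinI 0 0 (u - y.1) c.
  by rewrite mulrBr.
have PE (f : R -> R) (u : R) : f u * P u =
    s * (f u * cosI 0 0 (u - y.1) b) - f u * cosI 0 0 (u - y.1) c.
  by rewrite mulrBr mulrCA.
have I1 : leb.-integrable setT (EFin \o (fun u => dGamma0 (x.1 - u) t * S u)).
  have := integrableRB measurableT dGb dGc; apply: eq_integrable => // u _ /=.
  by rewrite SE.
have I2 (f : R -> R) : leb.-integrable setT (EFin \o (fun u => f u * cosI 0 0 (u - y.1) b)) ->
    leb.-integrable setT (EFin \o (fun u => f u * cosI 0 0 (u - y.1) c)) ->
    leb.-integrable setT (EFin \o (fun u => f u * P u)).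
  move=> fb fc; have := integrableRB measurableT (integrableRZl measurableT s fb) fc.
  by apply: eq_integrable => // u _ /=; rewrite PE.
have J2 (f : R -> R) : leb.-integrable setT (EFin \o (fun u => f u * cosI 0 0 (u - y.1) b)) ->
    leb.-integrable setT (EFin \o (fun u => f u * cosI 0 0 (u - y.1) c)) ->
    \int[leb]_u (f u * P u) = s * \int[leb]_u (f u * cosI 0 0 (u - y.1) b) -
      \int[leb]_u (f u * cosI 0 0 (u - y.1) c).
  move=> fb fc; rewrite -(RintegralZB measurableT s fb fc).
  by apply: eq_Rintegral => u _; rewrite PE.
have GPi := I2 _ Gb Gc; have LPi := I2 _ Lb Lc.
under eq_Rintegral do rewrite E.
rewrite RintegralD//; last 2 first.
- by apply: integrableRD => //; exact: integrableRZl.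
- exact: integrableRZl.
rewrite RintegralD//; last 2 first.
- exact: integrableRZl.
- exact: integrableRZl.
rewrite !RintegralZl//.
transitivity ((m - m') / (2 * pi) * (cosI t 1 (x.1 - y.1) b - cosI t 1 (x.1 - y.1) c) +
    (dm - dm') / (2 * pi) * (s * cosI t 0 (x.1 - y.1) b - cosI t 0 (x.1 - y.1) c) +
    m' / pi / pi * (s * (pi * cosI t 1 (x.1 - y.1) b) - pi * cosI t 1 (x.1 - y.1) c)).
  congr (_ * _ + _ * _ + _ * _).
  - rewrite -(dGamma0_conv_sinI x.1 y.1 t0 b0) -(dGamma0_conv_sinI x.1 y.1 t0 c0).
    rewrite -[X in _ = X - _]mul1r -(RintegralZB measurableT 1 dGb dGc).
    by apply: eq_Rintegral => u _; rewrite SE mul1r.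
  - exact: etrans (J2 _ Gb Gc) (congr2 (fun A B => s * A - B)
      (Gamma0_conv_cosI 0 x.1 y.1 t0 b0) (Gamma0_conv_cosI 0 x.1 y.1 t0 c0)).
  - exact: etrans (J2 _ Lb Lc) (congr2 (fun A B => s * A - B)
      (cosI1_conv_poisson x.1 y.1 t0 b0) (cosI1_conv_poisson x.1 y.1 t0 c0)).
move: (@pi R) (pi_gt0 R) => q q0.
clear E; move: (cosI t 0 _ b) (cosI t 0 _ c) (cosI t 1 _ b) (cosI t 1 _ c) => *.
by congr (_ + _); field; rewrite gt_eqF.
Qed.

End FibreIdentity.

(** * Vertical integration: splitting at a height and decay at infinity *)

Section HalfLine.
Context {R : realType}.
Local Notation leb := (@lebesgue_measure R).

Lemma integrable_itv_cy (g : R -> R) (c : R) : continuous g ->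
  leb.-integrable `]c, +oo[ (EFin \o g) -> leb.-integrable `[c, +oo[ (EFin \o g).
Proof.
move=> cg /integrableP[_ gi].
have mg : measurable_fun setT g := continuous_measurable_fun cg.
apply/integrableP; split; first exact/measurable_EFinP/measurable_funTS.
rewrite -integral_itv_obnd_cbnd//.
exact/measurable_EFinP/measurableT_comp/measurable_funTS.
Qed.

Lemma Rintegral_split (f g1 g2 : R -> R) (c : R) : 0 < c ->
  continuous g1 -> continuous g2 -> leb.-integrable `]0, +oo[ (EFin \o f) ->
  (forall a, 0 < a < c -> f a = g1 a) -> (forall a, c < a -> f a = g2 a) ->
  leb.-integrable `[c, +oo[ (EFin \o g2) /\
  \int[leb]_(a in `]0, +oo[) f a =
    \int[leb]_(a in `[0, c]) g1 a + \int[leb]_(a in `[c, +oo[) g2 a.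
Proof.
move=> c0 cg1 cg2 fi f1 f2.
have fi2 : leb.-integrable `]c, +oo[ (EFin \o f).
  apply: integrableS fi => //; apply: subset_itvr; rewrite bnd_simp; exact: ltW.
have gi2' : leb.-integrable `]c, +oo[ (EFin \o g2).
  apply: eq_integrable fi2 => // a; rewrite inE/= in_itv/= andbT => ca.
  by rewrite /= f2.
have gi2 := integrable_itv_cy cg2 gi2'; split => //.
have gi1 : leb.-integrable `[0, c] (EFin \o g1) := integrable_itv_cc 0 c cg1.
have gi1o : leb.-integrable `]0, c[ (EFin \o g1).
  apply: integrableS gi1 => //; exact: subset_itv_oo_cc.
have gi1c : leb.-integrable `[0, c[ (EFin \o g1).
  apply: integrableS gi1 => //; exact: subset_itv_co_cc.
have fi1 : leb.-integrable `]0, c[ (EFin \o f).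
  apply: integrableS fi => //; apply: subset_itvl; by rewrite bnd_simp.
have c1 : (BRight 0 <= BRight c)%O by rewrite bnd_simp ltW.
have c2 : (BRight c <= +oo)%O by [].
have := Rintegral_itvB fi c1 c2.
rewrite -(Rintegral_itv_bndo_bndc fi1).
have -> : \int[leb]_(a in `]0, c[) f a = \int[leb]_(a in `[0, c]) g1 a.
  rewrite -(Rintegral_itv_bndo_bndc gi1c) -(Rintegral_itv_obnd_cbnd gi1o).
  by apply: eq_Rintegral => a; rewrite inE/= in_itv/=; exact: f1.
have -> : \int[leb]_(a in `]c, +oo[) f a = \int[leb]_(a in `[c, +oo[) g2 a.
  rewrite -(Rintegral_itv_obnd_cbnd gi2').
  by apply: eq_Rintegral => a; rewrite inE/= in_itv/= andbT; exact: f2.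
by move=> <-; rewrite addrC subrK.
Qed.

Variable t : R.
Hypothesis t0 : 0 < t.

Lemma normr_cosI_le0 k (r b : R) : 0 <= b ->
  `|cosI t k r b| <= \int[leb]_(xi in `[0, +oo[) kap t k 0 xi.
Proof.
move=> b0; apply: le_trans (normr_cosI_le _ _ (admt b t0)) _.
apply: le_Rintegral; [by []|exact/integrable_kap/admt|exact/integrable_kap/admt|].
move=> xi /=; rewrite in_itv/= andbT => xi0; rewrite ler_wpM2l ?exprn_ge0//.
by rewrite ler_expR mul0r oppr0 lerD2r oppr_le0 mulr_ge0.
Qed.

(** Expanding (a + s)^2 turns a shift of the Gaussian into a height s / (2 t), so that the decay of
    [kap] applies. *)
Lemma Gamma0_shift_kap (a s : R) : Gamma0 (a + s) t =
  Gamma0 s t * kap (4 * t)^-1 0 (s / (2 * t)) a.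
Proof.
rewrite /Gamma0 /kap expr0 mul1r [RHS]mulrAC -expRD; congr (expR _ / _).
by field; rewrite gt_eqF.
Qed.

Lemma Gamma0_shift_cvg0 (h : R -> R) (s A M : R) : (forall a, A <= a -> `|h a| <= M) ->
  Gamma0 (a + s) t * h a @[a --> +oo] --> 0.
Proof.
move=> hM; have N0 : 0 < `|M| + 1 by rewrite ltr_wpDl.
(* [kap_cvg0] asks for a bound by 1 on the whole line, hence the cut-off below A and the
   normalisation; the +1 keeps the divisor positive. *)
pose h' a := if A <= a then h a / (`|M| + 1) else 0.
have h1 a : `|h' a| <= 1.
  rewrite /h'; case: ifPn => [Aa|_]; last by rewrite normr0.
  rewrite normrM normfV (gtr0_norm N0) ler_pdivrMr// mul1r.
  apply: le_trans (hM _ Aa) _; have := ler_norm M; lra.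
have T0 : 0 < (4 * t)^-1 by rewrite invr_gt0 mulr_gt0.
have := @kap_cvg0 R _ 0 _ _ (admt (s / (2 * t)) T0) h1.
move=> /(@cvgMl_tmp _ _ _ _ _ (Gamma0 s t * (`|M| + 1))); rewrite mulr0; apply: cvg_trans.
apply: near_eq_cvg; near=> a.
have Aa : A <= a by near: a; apply: nbhs_pinfty_ge; exact: num_real.
rewrite /h' Aa Gamma0_shift_kap; move: (kap _ _ _ _) (Gamma0 _ _) (h a) (`|M| + 1) N0 => K G H N N0.
by field; rewrite gt_eqF.
Unshelve. all: end_near. Qed.

End HalfLine.

Section VorticityKernelIntegral.
Context {R : realType}.
Local Notation leb := (@lebesgue_measure R).
Local Notation leb2 := (@lebm2 R).
Variable t : R.
Hypothesis t0 : 0 < t.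
Implicit Types (x y z : R * R).

Let hasd_Gamma0_comp (f : R -> R) (x df : R) : hasd f x df ->
  hasd (fun a => Gamma0 (f a) t) x (dGamma0 (f x) t * df).
Proof.
by move=> fd; apply: (@hasd_comp _ (fun r => Gamma0 r t) _ _ _ _ fd); exact: hasd_Gamma0.
Qed.

Let hasd_dGamma0_comp (f : R -> R) (x df : R) : hasd f x df ->
  hasd (fun a => dGamma0 (f a) t) x
    ((- (2 * t)^-1 * Gamma0 (f x) t - f x / (2 * t) * dGamma0 (f x) t) * df).
Proof.
move=> fd; apply: (@hasd_comp _ (fun r => dGamma0 r t) _ _ _ _ fd).
rewrite /dGamma0; eapply hasd_eq.
  apply: hasd_mul; last exact: hasd_Gamma0.
  by apply: hasd_opp; apply: hasd_mul; [exact: hasd_id|exact: hasd_cst].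
by rewrite /= /dGamma0; move: (2 * t)^-1 (Gamma0 _ _) => *; ring.
Qed.

Let hasd_cosI_comp k (r : R) (f : R -> R) (x df : R) : hasd f x df ->
  hasd (fun a => cosI t k r (f a)) x (- cosI t k.+1 r (f x) * df).
Proof.
by move=> fd; apply: (@hasd_comp _ (fun a => cosI t k r a) _ _ _ _ fd); exact: hasd_cosI_a.
Qed.

Ltac isk := isd; repeat ((match goal with
  | |- hasd (fun u => Gamma0 (@?f u) _) _ _ => apply: (@hasd_Gamma0_comp f)
  | |- hasd (fun u => dGamma0 (@?f u) _) _ _ => apply: (@hasd_dGamma0_comp f)
  | |- hasd (fun u => cosI _ ?k ?r (@?f u)) _ _ => apply: (@hasd_cosI_comp k r f)
  end); isd).

(** The kernel W with its horizontal integrals evaluated; the identification is [WkerE]. *)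
Definition vorticity_ker x y : R :=
  Gamma (x - y) t + Gamma (x - star y) t
  - 2 / pi * \int[leb]_(a in `[0, y.2]) (Gamma0 (x.2 + a) t * cosI t 1 (x.1 - y.1) (y.2 - a))
  - 2 * Gamma0 x.2 t * (cosI t 0 (x.1 - y.1) y.2 / pi).

Lemma Rintegral_vort_fibre x y (f : R -> R) : half_plane x -> half_plane y ->
  leb.-integrable `]0, +oo[ (EFin \o f) ->
  (forall a, 0 < a -> a != y.2 -> f a = vort_fibre t x y a) ->
  \int[leb]_(a in `]0, +oo[) f a = vorticity_ker x y.
Proof.
rewrite /half_plane /= => x0 y0 fi fE; set r := x.1 - y.1.
pose q : R := 2 * pi.
have q0 : 0 < q by rewrite mulr_gt0// pi_gt0.
(* Below height y.2 the fibre integral is H1' - k1, above it is H2'. *)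
pose H1 a := (Gamma0 (x.2 - a) t + Gamma0 (x.2 + a) t) / q *
  (cosI t 0 r (y.2 - a) + cosI t 0 r (a + y.2)).
pose h1 a := (dGamma0 (x.2 + a) t - dGamma0 (x.2 - a) t) / q *
    (cosI t 0 r (y.2 - a) + cosI t 0 r (a + y.2)) +
  (Gamma0 (x.2 - a) t + Gamma0 (x.2 + a) t) / q *
    (cosI t 1 r (y.2 - a) - cosI t 1 r (a + y.2)).
(* With B and C the cosine integrals of exponent 1 at heights y_2 - a and a + y_2, the first and
   third lines of [vort_fibre] add up below y_2 to (m + m') / q * (B - C) - 2 / pi * m' * B. The
   first part belongs to a derivative, the second is [k1]. Above y_2 the sign is opposite and
   nothing is left over. *)
pose k1 a := 2 / pi * (Gamma0 (x.2 + a) t * cosI t 1 r (y.2 - a)).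
pose H2 a := - ((Gamma0 (x.2 - a) t + Gamma0 (x.2 + a) t) / q *
  (cosI t 0 r (a - y.2) - cosI t 0 r (a + y.2))).
pose h2 a := (dGamma0 (x.2 - a) t - dGamma0 (x.2 + a) t) / q *
    (cosI t 0 r (a - y.2) - cosI t 0 r (a + y.2)) +
  (Gamma0 (x.2 - a) t + Gamma0 (x.2 + a) t) / q *
    (cosI t 1 r (a - y.2) - cosI t 1 r (a + y.2)).
have dH1 a : hasd H1 a (h1 a).
  rewrite /H1 /h1; eapply hasd_eq; first isk.
  rewrite /=.
 move: (dGamma0 _ _) (dGamma0 _ _) (Gamma0 _ _) (Gamma0 _ _) q^-1
    (cosI t 0 r _) (cosI t 1 r _) (cosI t 0 r _) (cosI t 1 r _) => *; ring.
have dH2 a : hasd H2 a (h2 a).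
  rewrite /H2 /h2; eapply hasd_eq; first isk.
  rewrite /=; move: (dGamma0 _ _) (dGamma0 _ _) (Gamma0 _ _) (Gamma0 _ _) q^-1
    (cosI t 0 r _) (cosI t 1 r _) (cosI t 0 r _) (cosI t 1 r _) => *; ring.
have ch1 : continuous h1 by move=> a; eapply hasd_continuous; rewrite /h1; isk.
have ch2 : continuous h2 by move=> a; eapply hasd_continuous; rewrite /h2; isk.
have ck1 : continuous k1 by move=> a; eapply hasd_continuous; rewrite /k1; isk.
have cg1 : continuous (fun a => h1 a - k1 a) by move=> a; exact: continuousB (ch1 a) (ck1 a).
have f1 a : 0 < a < y.2 -> f a = h1 a - k1 a.
  move=> /andP[a0 ay]; rewrite fE//; last by rewrite lt_eqF.
  rewrite /vort_fibre /= -/r ltr0_sg ?subr_lt0// ltr0_norm ?subr_lt0// opprB.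
  rewrite /h1 /k1 /q; move: (@pi R) (pi_gt0 R) => p p0.
  move: (dGamma0 _ _) (dGamma0 _ _) (Gamma0 _ _) (Gamma0 _ _)
    (cosI t 0 r _) (cosI t 1 r _) (cosI t 0 r _) (cosI t 1 r _) => *.
  by field; rewrite gt_eqF.
have f2 a : y.2 < a -> f a = h2 a.
  move=> ay; rewrite fE ?(lt_trans y0)//; last by rewrite gt_eqF.
  rewrite /vort_fibre /= -/r gtr0_sg ?subr_gt0// gtr0_norm ?subr_gt0//.
  rewrite /h2 /q; move: (@pi R) (pi_gt0 R) => p p0.
  move: (dGamma0 _ _) (dGamma0 _ _) (Gamma0 _ _) (Gamma0 _ _)
    (cosI t 0 r _) (cosI t 1 r _) (cosI t 0 r _) (cosI t 1 r _) => *.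
  by field; rewrite gt_eqF.
have [h2i ->] := Rintegral_split y0 cg1 ch2 fi f1 f2.
have [M M0] : exists2 M, 0 <= M & forall b, 0 <= b -> `|cosI t 0 r b| <= M.
  exists `|\int[leb]_(xi in `[0, +oo[) kap t 0 0 xi| => // b b0.
  by apply: le_trans (ler_norm _); exact: normr_cosI_le0.
move=> HM.
have H2l : H2 a @[a --> +oo] --> 0.
  pose h a := - (q^-1 * (cosI t 0 r (a - y.2) - cosI t 0 r (a + y.2))).
  have hM a : y.2 <= a -> `|h a| <= q^-1 * (M + M).
    move=> ya; rewrite normrN normrM (gtr0_norm (_ : 0 < q^-1)) ?invr_gt0//.
    rewrite ler_wpM2l ?invr_ge0 ?(ltW q0)//; apply: le_trans (ler_normB _ _) _.
    by apply: lerD; apply: HM; [rewrite subr_ge0|rewrite addr_ge0 ?(ltW y0)// (le_trans (ltW y0))].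
  have A : Gamma0 (a - x.2) t * h a + Gamma0 (a + x.2) t * h a @[a --> +oo] --> (0 : R).
    by rewrite -[0]addr0; apply: cvgD; exact: Gamma0_shift_cvg0 hM.
  move: A; apply: cvg_trans; apply: near_eq_cvg; near=> a.
  rewrite /H2 /h -(Gamma0N (x.2 - a)) opprB (addrC x.2 a) /=.
  move: (Gamma0 _ _) (Gamma0 _ _) (cosI _ _ _ _) (cosI _ _ _ _) q^-1 => *; ring.
rewrite (Rintegral_FTC_cy ch2 h2i dH2 H2l).
have ih1 : leb.-integrable `[0, y.2] (EFin \o h1) by exact: (integrable_itv_cc 0 y.2 ch1).
have ik1 : leb.-integrable `[0, y.2] (EFin \o k1) by exact: (integrable_itv_cc 0 y.2 ck1).
rewrite RintegralB// (Rintegral_FTC_cc (ltW y0) ch1 dH1).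
have ik2 : leb.-integrable `[0, y.2]
    (EFin \o (fun a => Gamma0 (x.2 + a) t * cosI t 1 r (y.2 - a))).
  by apply: integrable_itv_cc => a; eapply hasd_continuous; isk.
rewrite /k1 RintegralZl// /vorticity_ker -/r !GammaE//= -/r !opprK.
(* In H1 - H2 at y_2 the terms of height 2 y_2 cancel and twice [cosI t 0 r 0], that is 2 pi Gamma0
   r, remains: the Neumann kernel. The value of H1 at 0 is the boundary term, where direct and
   reflected kernels coincide. *)
rewrite /H1 /H2 subrr !subr0 !addr0 !add0r cosI_gauss0// /q.
move: (\int[leb]_(_ in _) _) => I.
move: (@pi R) (pi_gt0 R) => p p0.
move: (Gamma0 _ _) (Gamma0 _ _) (Gamma0 _ _) (Gamma0 _ _) (cosI _ _ _ _) (cosI _ _ _ _) => *.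
by field; rewrite gt_eqF.
Unshelve. all: end_near. Qed.

End VorticityKernelIntegral.

Section VorticityKernelPlane.
Context {R : realType}.
Local Notation leb := (@lebesgue_measure R).
Local Notation leb2 := (@lebm2 R).
Variable t : R.
Hypothesis t0 : 0 < t.
Implicit Types (x y z : R * R).

Lemma measurable_vort_ker x y : measurable_fun setT (fun z => vort_ker t x z y).
Proof.
have mz : measurable_fun setT (fun z : R * R => (z, y)) by apply: measurable_fun_pair; mfun.
have m1 : measurable_fun setT (fun z => K1 z y) := measurableT_comp measurable_K1 mz.
have m2 : measurable_fun setT (fun z => K2 z y) := measurableT_comp measurable_K2 mz.
apply: measurable_funB; first apply: measurable_funD; apply: measurable_funM => //.
- exact: measurable_d1g11.
- exact: measurable_d1g10.
- exact: measurable_d2g00.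
Qed.

Lemma vort_ker_bound x : half_plane x -> exists2 C : R, 0 <= C & forall z y,
  half_plane z -> half_plane y ->
  `|vort_ker t x z y| <= C * (qm z.1 * qm z.2 * sing z y).
Proof.
rewrite {1}/half_plane /= => x0.
have [C C0 HC] := kernel_bound t0 (`|x.1| + `|x.2|).
exists (3 * C) => [|z y zH yH]; first by rewrite mulr_ge0.
have xS : `|x.1| <= `|x.1| + `|x.2| by rewrite lerDl.
have x2S : 0 <= x.2 <= `|x.1| + `|x.2|.
  by rewrite (ltW x0)/= (le_trans (ler_norm _))// lerDr.
have [_ _ _ h1 [h2 h3]] := HC _ _ xS x2S zH.
have [k1 k2] := K_bound zH yH.
have B (a b : R) : `|a| <= C * (qm z.1 * qm z.2) -> `|b| <= sing z y ->
    `|a * b| <= C * (qm z.1 * qm z.2 * sing z y).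
  by move=> ha hb; rewrite normrM mulrA; exact: ler_pM.
rewrite /vort_ker; apply: le_trans (ler_normB _ _) _.
apply: le_trans (lerD (le_trans (ler_normD _ _) (lerD (B _ _ h3 k2) (B _ _ h2 k1)))
  (B _ _ h1 k1)) _.
by rewrite -[leRHS]mulrA; move: (C * _) => q; lra.
Qed.

Lemma integrable_vort_ker x y : half_plane x -> half_plane y ->
  leb2.-integrable half_plane (EFin \o (fun z => vort_ker t x z y)).
Proof.
move=> xH yH; have [C C0 HC] := vort_ker_bound xH.
have [B _ /(_ y)[si _]] := @singular_bound R.
have mH := @measurable_half_plane R.
have si' : leb2.-integrable half_plane (EFin \o (fun z => C * (qm z.1 * qm z.2 * sing z y))).
  by apply: integrableRZl => //; apply: integrableS si.
have mv := measurable_vort_ker x y.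
apply: le_integrableR si' => //; first exact: measurable_funTS.
by move=> z zH; exact: HC.
Qed.

Lemma Rintegral_vort_ker_half_plane x y : half_plane x -> half_plane y ->
  \int[leb2]_(z in half_plane) vort_ker t x z y = vorticity_ker t x y.
Proof.
move=> xH yH; have := integrable_vort_ker xH yH.
have -> : @half_plane R = setT `*` `]0, +oo[%classic.
  by apply/seteqP; split => z /=; rewrite in_itv/= andbT; [split|case].
move=> fi.
have Fi : leb.-integrable `]0, +oo[
    (EFin \o (fun a => \int[leb]_u vort_ker t x (u, a) y)).
  by apply: (@integrable_fubini2_on _ _ _ _ _ leb leb setT `]0, +oo[%classic _ _
    (fun z => vort_ker t x z y)).
rewrite -[LHS](@Rintegral_fubini2_on _ _ _ _ _ leb leb setT `]0, +oo[%classic _ _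
  (fun z => vort_ker t x z y))//.
apply: Rintegral_vort_fibre => // a a0 ay; exact: Rintegral_vort_ker.
Qed.

(** At height a < y_2 the function d_1^2 E is a multiple of [cosI 0 1] at height y_2 - a, and the
    horizontal heat kernel only raises its time parameter from 0 to t; the same happens to the
    Poisson kernel. *)
Lemma WkerE x y : half_plane x -> half_plane y -> Wker x y t = vorticity_ker t x y.
Proof.
rewrite /half_plane /= => x0 y0; rewrite /Wker /vorticity_ker.
have ci : leb.-integrable `[0, y.2]
    (EFin \o (fun a => Gamma0 (x.2 + a) t * cosI t 1 (x.1 - y.1) (y.2 - a))).
  apply: integrable_itv_cc => a; eapply hasd_continuous.
  apply: hasd_mul.
    by apply: (@hasd_comp _ (fun r => Gamma0 r t)); [isd|exact: hasd_Gamma0].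
  by apply: (@hasd_comp _ (fun a => cosI t 1 (x.1 - y.1) a)); [isd|exact: hasd_cosI_a].
have -> : \int[leb]_(z2 in `[0, y.2]) \int[leb]_z1
      (Gamma (x - star (z1, z2)) t * partial 0 (partial 0 Efun) ((z1, z2) - y)) =
    \int[leb]_(a in `[0, y.2]) (- (2 * pi)^-1 *
      (Gamma0 (x.2 + a) t * cosI t 1 (x.1 - y.1) (y.2 - a))).
  apply: eq_Rintegral_itv_co; last exact: integrableRZl.
  move=> a /andP[a0 ay]; have b0 : 0 < y.2 - a by rewrite subr_gt0.
  have nz : a - y.2 != 0 by rewrite subr_eq0 lt_eqF.
  transitivity (\int[leb]_u (- (2 * pi)^-1 * Gamma0 (x.2 + a) t *
      (Gamma0 (x.1 - u) t * cosI 0 1 (u - y.1) (y.2 - a)))).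
    apply: eq_Rintegral => u _; rewrite GammaE//= opprK.
    rewrite -[(u, a) - y]/(u - y.1, a - y.2) partial00_Efun//.
    rewrite -normrN opprB (gtr0_norm b0).
    move: (Gamma0 _ _) (Gamma0 _ _) (cosI _ _ _ _) (2 * pi) => *; ring.
  rewrite RintegralZl//; last first.
    apply: integrable_Gamma0_conv => //; last first.
      have [M HM] := cosI0_bounded 1 b0; exists M => s; exact: HM.
    by apply: measurable_cosI; mfun.
  rewrite Gamma0_conv_cosI//; ring.
rewrite RintegralZl//.
have -> : \int[leb]_z1 (Gamma0 (x.1 - z1) t * poisson y.2 (z1 - y.1)) =
    cosI t 0 (x.1 - y.1) y.2 / pi.
  rewrite -(Gamma0_conv_cosI 0 x.1 y.1 t0 y0) [RHS]mulrC -RintegralZl//.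
    by apply: eq_Rintegral => u _; rewrite poissonE// mulrA mulrC.
  apply: integrable_Gamma0_conv => //; last first.
    have [M HM] := cosI0_bounded 0 y0; exists M => s; exact: HM.
  by apply: measurable_cosI; mfun.
congr (_ + _ - _); move: (\int[leb]_(_ in _) _) => I.
by move: (@pi R) (pi_gt0 R) => p p0; field; rewrite gt_eqF.
Qed.

End VorticityKernelPlane.

(** * The Stokes flow of a Biot-Savart field, and the first formula *)

Section FieldIntegrals.
Context {R : realType}.
Local Notation leb := (@lebesgue_measure R).
Local Notation leb2 := (@lebm2 R).
Local Notation HH := (@half_plane R `*` @half_plane R).

(* Rintegral is 0 on non-integrable functions, so that constants can be pulled
   out without knowing for which z the Biot-Savart integral converges. *)
Lemma Rintegral_nonint d (T : measurableType d) (m : {measure set T -> \bar R}) (D : set T)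
    (f : T -> R) : measurable D -> measurable_fun D f ->
  ~ m.-integrable D (EFin \o f) -> \int[m]_(x in D) f x = 0.
Proof.
move=> mD mf nfi; rewrite /Rintegral integralE.
have mF : measurable_fun D (EFin \o f) by exact/measurable_EFinP.
have p0 : (0 <= \int[m]_(x in D) ((EFin \o f)^\+ x))%E by exact: integral_ge0.
have n0 : (0 <= \int[m]_(x in D) ((EFin \o f)^\- x))%E by exact: integral_ge0.
have E : (\int[m]_(x in D) `|(EFin \o f) x| =
    \int[m]_(x in D) ((EFin \o f)^\+ x) + \int[m]_(x in D) ((EFin \o f)^\- x))%E.
  rewrite -ge0_integralD//.
  - by apply: eq_integral => x _; rewrite -[LHS]/((abse \o (EFin \o f)) x) fune_abse.
  - exact: measurable_funepos.
  - exact: measurable_funeneg.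
have : ~ (\int[m]_(x in D) `|(EFin \o f) x| < +oo)%E.
  by move=> h; apply: nfi; apply/integrableP.
rewrite E.
move: (\int[m]_(x in D) _)%E (\int[m]_(x in D) _)%E p0 n0.
by move=> [p| |] [n| |]//= p0 n0; rewrite ?ltry.
Qed.

Lemma RintegralZl_meas d (T : measurableType d) (m : {measure set T -> \bar R}) (D : set T)
    (c : R) (f : T -> R) : measurable D -> measurable_fun D f ->
  \int[m]_(x in D) (c * f x) = c * \int[m]_(x in D) f x.
Proof.
move=> mD mf; have [fi|nfi] := pselect (m.-integrable D (EFin \o f)).
  by rewrite RintegralZl.
rewrite (Rintegral_nonint mD mf nfi) mulr0.
have [->|c0] := eqVneq c 0.
  by under eq_Rintegral do rewrite mul0r; rewrite Rintegral_cst// mul0r.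
apply: Rintegral_nonint => //; first exact: measurable_funM.
move=> /(integrableRZl mD c^-1) h; apply: nfi.
by apply: eq_integrable h => // x _; rewrite /= mulKf.
Qed.

Variable mu : {finite_measure set (R * R)%type -> \bar R}.

Lemma measurable_kerr (K : R * R -> R * R -> R) (D : set (R * R)) z :
  measurable_fun setT (fun p => K p.1 p.2) -> measurable_fun D (K z).
Proof.
move=> mK; apply: measurable_funTS; apply: (measurableT_comp mK (_ : measurable_fun setT (pair z))).
by apply: measurable_fun_pair; mfun.
Qed.

(** The factor g z is moved into the mu-integral for every z, convergent or not; the question of
    convergence is thereby left to Fubini. *)
Lemma Rintegral_gK (g : R * R -> R) (K : R * R -> R * R -> R) (C : R) :
  measurable_fun setT g -> measurable_fun setT (fun p => K p.1 p.2) ->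
  (forall z y, half_plane z -> half_plane y -> `|K z y| <= sing z y) ->
  (forall z, half_plane z -> `|g z| <= C * (qm z.1 * qm z.2)) ->
  leb2.-integrable half_plane (EFin \o (fun z => g z * \int[mu]_(y in half_plane) K z y)) /\
  \int[leb2]_(z in half_plane) (g z * \int[mu]_(y in half_plane) K z y) =
  \int[(leb2 \x mu)%E]_(p in HH) (g p.1 * K p.1 p.2).
Proof.
move=> mg mK HK Hg; have gK := integrable_gK mu mg mK HK Hg.
have mH := @measurable_half_plane R.
have E z : \int[mu]_(y in half_plane) (g z * K z y) = g z * \int[mu]_(y in half_plane) K z y.
  by rewrite RintegralZl_meas//; exact: measurable_kerr.
split.
  have : leb2.-integrable half_plane
      (EFin \o (fun z => \int[mu]_(y in half_plane) (g z * K z y))).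
    by apply: (@integrable_fubini1_on _ _ _ _ _ leb2 mu half_plane half_plane _ _
      (fun p => g p.1 * K p.1 p.2)).
  by apply: eq_integrable => // z _ /=; rewrite E.
rewrite -[RHS](@Rintegral_fubini1_on _ _ _ _ _ leb2 mu half_plane half_plane _ _
  (fun p => g p.1 * K p.1 p.2))//.
by apply: eq_Rintegral => z _; rewrite /= E.
Qed.

(** Differentiation takes place on the product space of z and y, where C qm qm sing is one
    integrable majorant for all parameters; the field is never estimated pointwise in z. *)
Lemma hasd_gK (g dg : R -> R * R -> R) (K : R * R -> R * R -> R) (a u v C : R) :
  u < a < v -> measurable_fun setT (fun p => K p.1 p.2) ->
  (forall z y, half_plane z -> half_plane y -> `|K z y| <= sing z y) ->
  (forall s, u < s < v -> measurable_fun setT (g s)) ->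
  (forall s z, u < s < v -> half_plane z -> `|g s z| <= C * (qm z.1 * qm z.2)) ->
  (forall s z, u < s < v -> half_plane z -> `|dg s z| <= C * (qm z.1 * qm z.2)) ->
  (forall s z, u < s < v -> half_plane z -> hasd (g ^~ z) s (dg s z)) ->
  hasd (fun s => \int[(leb2 \x mu)%E]_(p in HH) (g s p.1 * K p.1 p.2)) a
    (\int[(leb2 \x mu)%E]_(p in HH) (dg a p.1 * K p.1 p.2)).
Proof.
move=> auv mK HK mg Hg Hdg dgE.
have mH := @measurable_half_plane R; have mHH := measurableX mH mH.
have Gi : (leb2 \x mu)%E.-integrable HH
    (EFin \o (fun p => C * (qm p.1.1 * qm p.1.2) * sing p.1 p.2)).
  apply: (@integrable_gK _ mu (fun z => C * (qm z.1 * qm z.2)) sing `|C|).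
  - by rewrite /qm; mfun.
  - exact: measurable_sing.
  - by move=> z y _ _; rewrite ger0_norm// sing_ge0.
  - move=> z _; rewrite normrM ler_wpM2l// ger0_norm// mulr_ge0 ?qm_ge0//.
apply: (@hasd_Rintegral R _ _ (leb2 \x mu)%E (fun s p => g s p.1 * K p.1 p.2)
  (fun s p => dg s p.1 * K p.1 p.2) _ a u v _ mHH auv _ _ Gi).
- by move=> s suv; apply: integrable_gK => //; [exact: mg|move=> z zH; exact: Hg].
- move=> s [z y] suv [/= zH yH]; eapply hasd_eq.
    by apply: hasd_mul; [exact: dgE|exact: hasd_cst].
  by rewrite /= mulr0 addr0.
- move=> s [z y] suv [/= zH yH]; rewrite normrM ler_pM//; [exact: Hdg|exact: HK].
Qed.

End FieldIntegrals.

Section StokesVorticity.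
Context {R : realType}.
Local Notation leb := (@lebesgue_measure R).
Local Notation leb2 := (@lebm2 R).
Local Notation HH := (@half_plane R `*` @half_plane R).
Variable t : R.
Hypothesis t0 : 0 < t.
Implicit Types (x y z : R * R).

Section FiniteMeasure.
Variable mu : {finite_measure set (R * R)%type -> \bar R}.

Definition pair_int (g : R * R -> R) (K : R * R -> R * R -> R) : R :=
  \int[(leb2 \x mu)%E]_(p in HH) (g p.1 * K p.1 p.2).

Let K1b z y : half_plane z -> half_plane y -> `|K1 z y| <= sing z y.
Proof. by move=> zH yH; have [] := K_bound zH yH. Qed.

Let K2b z y : half_plane z -> half_plane y -> `|K2 z y| <= sing z y.
Proof. by move=> zH yH; have [] := K_bound zH yH. Qed.

Let bnd x : 0 <= x.2 -> `|x.1| <= `|x.1| + x.2 /\ 0 <= x.2 <= `|x.1| + x.2.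
Proof. by move=> x20; rewrite lerDl x20/= lerDr. Qed.

Lemma stokes_pair_int x : 0 <= x.2 ->
  [/\ leb2.-integrable half_plane
        (EFin \o (fun z => g00 t x z * \int[mu]_(y in half_plane) K1 z y)) /\
      \int[leb2]_(z in half_plane) (g00 t x z * \int[mu]_(y in half_plane) K1 z y) =
        pair_int (g00 t x) K1,
      leb2.-integrable half_plane
        (EFin \o (fun z => g10 t x z * \int[mu]_(y in half_plane) K1 z y)) /\
      \int[leb2]_(z in half_plane) (g10 t x z * \int[mu]_(y in half_plane) K1 z y) =
        pair_int (g10 t x) K1 &
      leb2.-integrable half_plane
        (EFin \o (fun z => g11 t x z * \int[mu]_(y in half_plane) K2 z y)) /\
      \int[leb2]_(z in half_plane) (g11 t x z * \int[mu]_(y in half_plane) K2 z y) =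
        pair_int (g11 t x) K2].
Proof.
move=> x0; have [C C0 HC] := kernel_bound t0 (`|x.1| + x.2).
have [xS x2S] := bnd x0.
split; apply: Rintegral_gK.
- exact: measurable_g00.
- exact: measurable_K1.
- exact: K1b.
- by move=> z zH; have [h _ _ _ _] := HC _ _ xS x2S zH; exact: h.
- exact: measurable_g10.
- exact: measurable_K1.
- exact: K1b.
- by move=> z zH; have [_ h _ _ _] := HC _ _ xS x2S zH; exact: h.
- exact: measurable_g11.
- exact: measurable_K2.
- exact: K2b.
- by move=> z zH; have [_ _ h _ _] := HC _ _ xS x2S zH; exact: h.
Qed.

Lemma hasd_pair_int x : half_plane x ->
  [/\ hasd (fun s => pair_int (g00 t (x.1, s)) K1) x.2 (pair_int (d2g00 t x) K1),
      hasd (fun s => pair_int (g10 t (s, x.2)) K1) x.1 (pair_int (d1g10 t x) K1) &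
      hasd (fun s => pair_int (g11 t (s, x.2)) K2) x.1 (pair_int (d1g11 t x) K2)].
Proof.
rewrite {1}/half_plane /= => x0.
have [C C0 HC] := kernel_bound t0 (`|x.1| + x.2 + 1).
have x2S : 0 <= x.2 <= `|x.1| + x.2 + 1.
  by rewrite (ltW x0)/= addrAC lerDr addr_ge0.
have xS : `|x.1| <= `|x.1| + x.2 + 1.
  by rewrite -addrA lerDl addr_ge0// ltW.
have sS s : 0 < s < x.2 + 1 -> 0 <= s <= `|x.1| + x.2 + 1.
  move=> /andP[s0 s1]; rewrite (ltW s0)/= (le_trans (ltW s1))// -addrA.
  by rewrite lerDr.
have rS r : x.1 - 1 < r < x.1 + 1 -> `|r| <= `|x.1| + x.2 + 1.
  move=> /andP[r1 r2]; have : `|r| <= `|x.1| + 1.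
    have -> : r = x.1 + (r - x.1) by rewrite addrC subrK.
    apply: le_trans (ler_normD _ _) _; rewrite lerD2l ler_norml; apply/andP; split; lra.
  move/le_trans; apply; rewrite addrAC lerDl; exact: ltW.
split.
- apply: (@hasd_gK R mu (fun s => g00 t (x.1, s)) (fun s => d2g00 t (x.1, s)) K1 x.2 0 (x.2 + 1) C).
  + by rewrite x0 ltrDl ltr01.
  + exact: measurable_K1.
  + exact: K1b.
  + by move=> s _; exact: measurable_g00.
  + by move=> s z /sS sb zH; have [h _ _ _ _] := HC (x.1, s) z xS sb zH; exact: h.
  + by move=> s z /sS sb zH; have [_ _ _ h _] := HC (x.1, s) z xS sb zH; exact: h.
  + by move=> s z /andP[s0 _] _; exact: (@hasd_g00 R t t0 (x.1, s) z s0).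
- apply: (@hasd_gK R mu (fun s => g10 t (s, x.2)) (fun s => d1g10 t (s, x.2)) K1 x.1 (x.1 - 1) (x.1 + 1) C).
  + by rewrite ltrDl gtrBl ltr01.
  + exact: measurable_K1.
  + exact: K1b.
  + by move=> s _; exact: measurable_g10.
  + by move=> s z /rS sb zH; have [_ h _ _ _] := HC (s, x.2) z sb x2S zH; exact: h.
  + by move=> s z /rS sb zH; have [_ _ _ _ [h _]] := HC (s, x.2) z sb x2S zH; exact: h.
  + by move=> s z _ _; exact: (@hasd_g10 R t t0 (s, x.2) z).
- apply: (@hasd_gK R mu (fun s => g11 t (s, x.2)) (fun s => d1g11 t (s, x.2)) K2 x.1 (x.1 - 1) (x.1 + 1) C).
  + by rewrite ltrDl gtrBl ltr01.
  + exact: measurable_K2.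
  + exact: K2b.
  + by move=> s _; exact: measurable_g11.
  + by move=> s z /rS sb zH; have [_ _ h _ _] := HC (s, x.2) z sb x2S zH; exact: h.
  + by move=> s z /rS sb zH; have [_ _ _ _ [_ h]] := HC (s, x.2) z sb x2S zH; exact: h.
  + by move=> s z _ _; exact: (@hasd_g11 R t t0 (s, x.2) z).
Qed.

(** Fubini with the y-integral outside: the inner integral is W, and its integrability in y comes
    with the theorem. *)
Lemma pair_int_vort x : half_plane x ->
  mu.-integrable half_plane (EFin \o (fun y => Wker x y t)) /\
  pair_int (d1g11 t x) K2 + pair_int (d1g10 t x) K1 - pair_int (d2g00 t x) K1 =
  \int[mu]_(y in half_plane) Wker x y t.
Proof.
move=> xH; have [C C0 HC] := kernel_bound t0 (`|x.1| + x.2).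
have [xS x2S] := bnd (ltW xH).
have mH := @measurable_half_plane R; have mHH := measurableX mH mH.
have i1 : (leb2 \x mu)%E.-integrable HH (EFin \o (fun p => d1g11 t x p.1 * K2 p.1 p.2)).
  apply: integrable_gK; [exact: measurable_d1g11|exact: measurable_K2|exact: K2b|].
  by move=> z zH; have [_ _ _ _ [_ h]] := HC _ _ xS x2S zH; exact: h.
have i2 : (leb2 \x mu)%E.-integrable HH (EFin \o (fun p => d1g10 t x p.1 * K1 p.1 p.2)).
  apply: integrable_gK; [exact: measurable_d1g10|exact: measurable_K1|exact: K1b|].
  by move=> z zH; have [_ _ _ _ [h _]] := HC _ _ xS x2S zH; exact: h.
have i3 : (leb2 \x mu)%E.-integrable HH (EFin \o (fun p => d2g00 t x p.1 * K1 p.1 p.2)).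
  apply: integrable_gK; [exact: measurable_d2g00|exact: measurable_K1|exact: K1b|].
  by move=> z zH; have [_ _ _ h _] := HC _ _ xS x2S zH; exact: h.
have i12 : (leb2 \x mu)%E.-integrable HH
    (EFin \o (fun p => d1g11 t x p.1 * K2 p.1 p.2 + d1g10 t x p.1 * K1 p.1 p.2)).
  by apply: integrableRD.
have i123 : (leb2 \x mu)%E.-integrable HH (EFin \o (fun p => vort_ker t x p.1 p.2)).
  by apply: (integrableRB _ i12 i3).
have E y : half_plane y -> \int[leb2]_(z in half_plane) vort_ker t x z y = Wker x y t.
  by move=> yH; rewrite Rintegral_vort_ker_half_plane// WkerE.
split.
  have : mu.-integrable half_plane
      (EFin \o (fun y => \int[leb2]_(z in half_plane) vort_ker t x z y)).
    by apply: (@integrable_fubini2_on _ _ _ _ _ leb2 mu half_plane half_plane _ _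
      (fun p => vort_ker t x p.1 p.2)).
  by apply: eq_integrable => // y; rewrite inE => yH; rewrite /= E.
rewrite /pair_int -RintegralD// -RintegralB//.
rewrite -[LHS](@Rintegral_fubini2_on _ _ _ _ _ leb2 mu half_plane half_plane _ _
  (fun p => vort_ker t x p.1 p.2))//.
by apply: eq_Rintegral => y; rewrite inE => yH; rewrite /= E.
Qed.

End FiniteMeasure.

Variable omega : {charge set (R * R)%type -> \bar R}.
Let mp : {finite_measure set (R * R)%type -> \bar R} := jordan_pos (hahnP omega).
Let mn : {finite_measure set (R * R)%type -> \bar R} := jordan_neg (hahnP omega).

Lemma biot_savartE z : half_plane z -> biot_savart omega z =
  (\int[mp]_(y in half_plane) K1 z y - \int[mn]_(y in half_plane) K1 z y,
   \int[mp]_(y in half_plane) K2 z y - \int[mn]_(y in half_plane) K2 z y).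
Proof.
move=> zH; rewrite /biot_savart /charge_int /grad_perp /=.
congr (_ - _, _ - _); apply: eq_Rintegral => y; rewrite inE => yH.
- exact: partial1_Dfun.
- exact: partial1_Dfun.
- exact: partial0_Dfun.
- exact: partial0_Dfun.
Qed.

Let sum2 (F : 'I_2 -> R) : \sum_(j < 2) F j = F 0 + F 1.
Proof. by rewrite big_ord_recl big_ord1; congr (F _ + F _); exact: val_inj. Qed.

Lemma stokes_fst x : 0 <= x.2 -> (stokes t (biot_savart omega) x).1 =
  pair_int mp (g00 t x) K1 - pair_int mn (g00 t x) K1.
Proof.
move=> x0; have [[ip <-] _ _] := stokes_pair_int mp x0.
have [[im <-] _ _] := stokes_pair_int mn x0.
have mH := @measurable_half_plane R.
rewrite -RintegralB//; apply: eq_Rintegral => z; rewrite inE => zH.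
rewrite sum2 stokes_ker00E// stokes_ker01 biot_savartE// /comp2 /=.
by rewrite mul0r addr0 mulrBr.
Qed.

Lemma stokes_snd x : 0 <= x.2 -> (stokes t (biot_savart omega) x).2 =
  pair_int mp (g10 t x) K1 + pair_int mp (g11 t x) K2 -
  (pair_int mn (g10 t x) K1 + pair_int mn (g11 t x) K2).
Proof.
move=> x0; have [_ [ip <-] [jp <-]] := stokes_pair_int mp x0.
have [_ [im <-] [jm <-]] := stokes_pair_int mn x0.
have mH := @measurable_half_plane R.
rewrite -!RintegralD// -RintegralB//; last 2 first.
- by apply: integrableRD.
- by apply: integrableRD.
apply: eq_Rintegral => z; rewrite inE => zH.
rewrite sum2 stokes_ker10E// stokes_ker11E// biot_savartE// /comp2 /=.
by rewrite !mulrBr; ring.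
Qed.

(** The closed form of S u holds at nonnegative heights only, so in x_2 the derivative is taken of a
    function that agrees with it near x_2 > 0; in x_1 the height is fixed and the two agree
    everywhere. *)
Lemma T_opE x : half_plane x ->
  [/\ derivable (fst \o stokes t (biot_savart omega)) x (evec 1),
      derivable (snd \o stokes t (biot_savart omega)) x (evec 0) &
      T_op t omega x = charge_int omega half_plane (fun y => Wker x y t)].
Proof.
move=> xH; have x0 : 0 < x.2 := xH.
have [p1 p2 p3] := hasd_pair_int mp xH; have [n1 n2 n3] := hasd_pair_int mn xH.
have d1 : hasd (fun s => (fst \o stokes t (biot_savart omega)) (x.1, s)) x.2
    (pair_int mp (d2g00 t x) K1 - pair_int mn (d2g00 t x) K1).
  apply: (@hasd_near _ (fun s => pair_int mp (g00 t (x.1, s)) K1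
      - pair_int mn (g00 t (x.1, s)) K1)).
    near=> s; have s0 : 0 < s by near: s; exact: lt_nbhsr.
    exact: esym (@stokes_fst (x.1, s) (ltW s0)).
  by apply: hasd_add => //; exact: hasd_opp.
have d2 : hasd (fun s => (snd \o stokes t (biot_savart omega)) (s, x.2)) x.1
    (pair_int mp (d1g10 t x) K1 + pair_int mp (d1g11 t x) K2 -
     (pair_int mn (d1g10 t x) K1 + pair_int mn (d1g11 t x) K2)).
  have -> : (fun s => (snd \o stokes t (biot_savart omega)) (s, x.2)) =
    (fun s => pair_int mp (g10 t (s, x.2)) K1 + pair_int mp (g11 t (s, x.2)) K2 -
     (pair_int mn (g10 t (s, x.2)) K1 + pair_int mn (g11 t (s, x.2)) K2)).
    by apply/funext => s; exact: (@stokes_snd (s, x.2) (ltW x0)).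
  apply: hasd_add; first exact: (hasd_add p2 p3).
  by apply: hasd_opp; exact: (hasd_add n2 n3).
have [dd1 e1] := partial1_hasd d1; have [dd2 e2] := partial0_hasd d2.
split => //; rewrite /T_op /div_perp e1 e2 /charge_int.
have [_ <-] := pair_int_vort mp xH; have [_ <-] := pair_int_vort mn xH.
rewrite -/mp -/mn; move: (pair_int mp (d2g00 t x) K1) (pair_int mn (d2g00 t x) K1)
  (pair_int mp (d1g10 t x) K1) (pair_int mn (d1g10 t x) K1)
  (pair_int mp (d1g11 t x) K2) (pair_int mn (d1g11 t x) K2) => *.
ring.
Unshelve. all: end_near. Qed.

Lemma charge_integrable_Wker x : half_plane x ->
  charge_integrable omega half_plane (fun y => Wker x y t).
Proof.
by move=> xH; split; [have [] := pair_int_vort mp xH|have [] := pair_int_vort mn xH].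
Qed.

End StokesVorticity.

(** * The Hilbert transform of differentiated Poisson kernels *)

Section HilbertTransform.
Context {R : realType}.
Local Notation leb := (@lebesgue_measure R).
Implicit Types (r s b c xi : R).

(** Again a linear system: the recurrences of exponent 1, with the values of exponent 0 known. *)
Lemma sinI01 r b : 0 < b -> sinI 0 1 r b = 2 * r * b / (r ^+ 2 + b ^+ 2) ^+ 2.
Proof.
move=> b0; have := sinI_rec 1 r (adm0 b0); have := cosI_rec 1 r (adm0 b0).
rewrite /= (sinI00 r b0) (cosI00 r b0).
have := sqrD_gt0 r b0 => p h1 h2.
have {}h1 : b * sinI 0 1 r b = r * cosI 0 1 r b + r / (r ^+ 2 + b ^+ 2) by move: h1; lra.
have {}h2 : r * sinI 0 1 r b = b / (r ^+ 2 + b ^+ 2) - b * cosI 0 1 r b by move: h2; lra.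
have e : (r ^+ 2 + b ^+ 2) * sinI 0 1 r b = 2 * r * b / (r ^+ 2 + b ^+ 2).
  have -> : (r ^+ 2 + b ^+ 2) * sinI 0 1 r b = r * (r * sinI 0 1 r b) + b * (b * sinI 0 1 r b).
    by ring.
  by rewrite h1 h2; field; rewrite gt_eqF.
by apply: (mulfI (lt0r_neq0 p)); rewrite e; field; rewrite gt_eqF.
Qed.

Lemma cosI00_cvg0 b (h : R -> R) : 0 < b -> (forall s, `|h s| <= 1) ->
  cosI 0 0 s b * h s @[s --> +oo] --> 0.
Proof.
move=> b0 h1; apply/cvgr0Pnorm_lt => e e0; near=> s.
have s1 : 1 <= s by near: s; apply: nbhs_pinfty_ge; exact: num_real.
have sb : b / e + 1 <= s by near: s; apply: nbhs_pinfty_ge; exact: num_real.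
have p := sqrD_gt0 s b0.
rewrite normrM (le_lt_trans (ler_piMr (normr_ge0 _) (h1 s)))//.
rewrite cosI00// ger0_norm ?divr_ge0 ?(ltW b0) ?(ltW p)// ltr_pdivrMr//.
have : b < e * s by rewrite mulrC -ltr_pdivrMr//; move: sb; lra.
move/lt_le_trans; apply; rewrite ler_wpM2l ?(ltW e0)//.
by have := sqr_ge0 b; nra.
Unshelve. all: end_near. Qed.

Lemma sinI01_le r b : 0 < b -> `|sinI 0 1 r b| <= b^-1 * cosI 0 0 r b.
Proof.
move=> b0; have p := sqrD_gt0 r b0; rewrite sinI01// cosI00// mulKf ?gt_eqF//.
rewrite normrM (ger0_norm (_ : 0 <= (_ ^+ 2)^-1)) ?invr_ge0 ?sqr_ge0//.
rewrite ler_pdivrMr ?exprn_gt0// expr2 mulKf ?gt_eqF// ler_norml.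
have := sqr_ge0 (r - b); have := sqr_ge0 (r + b); rewrite !sqrrD !sqrrN => h1 h2.
by apply/andP; split; move: h1 h2; rewrite -!mulrA mulrN; lra.
Qed.

Lemma integrable_sinI01 b : 0 < b -> leb.-integrable setT (EFin \o (fun s => sinI 0 1 s b)).
Proof.
move=> b0; have gi := @integrableRZl _ _ _ leb _ measurableT b^-1 _ (integrable_cosI00 b0).
apply: le_integrableR gi => //; first by apply: measurable_sinI; mfun.
by move=> s _; exact: sinI01_le.
Qed.

(** [sinI 0 1] is minus the derivative of [cosI 0 0], so an integration by parts reduces the claim
    to [poisson_cos]. The integrand [g] is even, and on the half line both boundary values vanish:
    sin 0 = 0 at one end, the decay of [cosI 0 0] at the other. *)
Lemma sinI01_sin b xi : 0 < b ->
  \int[leb]_s (sinI 0 1 s b * sin (s * xi)) = pi * (xi * expR (- (b * `|xi|))).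
Proof.
move=> b0.
pose g s := xi * (cosI 0 0 s b * cos (s * xi)) - sinI 0 1 s b * sin (s * xi).
have ci : leb.-integrable setT (EFin \o (fun s => cosI 0 0 s b * cos (s * xi))).
  by apply: integrable_trig; [exact: integrable_cosI00|mfun|move=> s; exact: cos_max].
have si : leb.-integrable setT (EFin \o (fun s => sinI 0 1 s b * sin (s * xi))).
  by apply: integrable_trig; [exact: integrable_sinI01|mfun|move=> s; exact: sin_max].
have xci := integrableRZl measurableT xi ci.
have gi : leb.-integrable setT (EFin \o g) := integrableRB measurableT xci si.
have gE : \int[leb]_s g s = 0.
  rewrite Rintegral_fold//.
  have G2 s : g s + g (- s) = 2 * g s.
    by rewrite /g cosIN sinIN ?adm0// (mulNr s) cosN sinN; ring.
  under eq_Rintegral do rewrite G2.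
  rewrite RintegralZl//; last by apply: integrableS gi.
  have dg s : hasd (fun s => cosI 0 0 s b * sin (s * xi)) s (g s).
    eapply hasd_eq; first (apply: hasd_mul; [exact/hasd_cosI_r/adm0|isd]).
    by rewrite /g; ring.
  rewrite (@Rintegral_FTC_cy _ (fun s => cosI 0 0 s b * sin (s * xi)) g 0 0) //.
  - by rewrite mul0r sin0 mulr0 subrr mulr0.
  - move=> s; rewrite /g.
    eapply hasd_continuous; apply: hasd_add; last apply: hasd_opp; last apply: hasd_mul.
    + apply: hasd_mul; first exact: hasd_cst.
      by apply: hasd_mul; [exact/hasd_cosI_r/adm0|isd].
    + exact/hasd_sinI_r/adm0.
    + isd.
  - by apply: integrableS gi.
  - by apply: cosI00_cvg0 => // s; exact: sin_max.
rewrite /g RintegralB// RintegralZl// poisson_cos// in gE.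
by move: gE => /eqP; rewrite subr_eq0 => /eqP <-; rewrite mulrCA.
Qed.

Lemma sinI01_cos b xi : 0 < b -> \int[leb]_s (sinI 0 1 s b * cos (s * xi)) = 0.
Proof.
move=> b0; rewrite Rintegral_fold; last first.
  by apply: integrable_trig; [exact: integrable_sinI01|mfun|move=> s; exact: cos_max].
under eq_Rintegral => s _ do rewrite sinIN ?adm0// (mulNr s) cosN mulNr addrN.
by rewrite Rintegral_cst// mul0r.
Qed.

End HilbertTransform.

Section HilbertPoisson.
Context {R : realType}.
Local Notation leb := (@lebesgue_measure R).
Implicit Types (r s b c xi al ga be de : R).

Section HilbertOdd.
Variables (g G : R -> R) (y : R).
Hypothesis gi : leb.-integrable setT (EFin \o g).
Hypothesis godd : forall s, g (- s) = - g s.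
Hypothesis gcos : forall xi, \int[leb]_s (g s * cos (s * xi)) = 0.
Hypothesis gsin : forall xi, \int[leb]_s (g s * sin (s * xi)) = G xi.

Let gci xi : leb.-integrable setT (EFin \o (fun s => g s * cos (s * xi))).
Proof. by apply: integrable_trig => //; [mfun|move=> s; exact: cos_max]. Qed.

Let gsi xi : leb.-integrable setT (EFin \o (fun s => g s * sin (s * xi))).
Proof. by apply: integrable_trig => //; [mfun|move=> s; exact: sin_max]. Qed.

Let lin xi u v : \int[leb]_s (u * (g s * cos (s * xi)) + v * (g s * sin (s * xi))) = v * G xi.
Proof.
rewrite RintegralD//; last 2 first.
- exact: integrableRZl.
- exact: integrableRZl.
by rewrite !RintegralZl// gcos gsin mulr0 add0r.
Qed.

Let lini xi u v : leb.-integrable setT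
  (EFin \o (fun s => u * (g s * cos (s * xi)) + v * (g s * sin (s * xi)))).
Proof. by apply: integrableRD => //; exact: integrableRZl. Qed.

Let gshift s : g (s - y) = - g (y - s).
Proof. by rewrite -godd opprB. Qed.

Let fcos xi : \int[leb]_s (cos (s * xi) * g (s - y)) = - (sin (y * xi) * G xi).
Proof.
rewrite -mulNr -(lin xi (- cos (y * xi))) -(Rintegral_subl y (lini _ _ _)).
apply: eq_Rintegral => s _; rewrite gshift.
have -> : s * xi = y * xi - (y - s) * xi by ring.
by rewrite cosB; ring.
Qed.

(** The Fourier transform of g (. - y) is - i exp(- i y xi) G(xi), as g is odd. The multiplier - i
    xi / |xi| makes it - xi / |xi| G(xi) times the phase, and the real part of the inverse transform
    is a cosine integral. *)
Lemma hilbert_odd s : hilbert (fun r => g (r - y)) s =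
  (2 * pi)^-1 * \int[leb]_xi (- (xi / `|xi| * G xi * cos ((s - y) * xi))).
Proof.
rewrite /hilbert /fourier_inv /cint /=.
rewrite mul0r subr0; congr (_ * _); apply: eq_Rintegral => xi _.
have -> : \int[leb]_r (cos (- (r * xi)) * g (r - y) - sin (- (r * xi)) * 0) =
    - (sin (y * xi) * G xi).
  by rewrite -fcos; apply: eq_Rintegral => r _; rewrite mulr0 subr0 cosN.
have -> : \int[leb]_r (cos (- (r * xi)) * 0 + sin (- (r * xi)) * g (r - y)) =
    - cos (y * xi) * G xi.
  rewrite -(lin xi (sin (y * xi))) -(Rintegral_subl y (lini _ _ _)).
  apply: eq_Rintegral => r _; rewrite gshift mulr0 add0r sinN.
  have -> : r * xi = y * xi - (y - r) * xi by ring.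
  by rewrite sinB; ring.
have -> : (s - y) * xi = s * xi - y * xi by ring.
rewrite cosB; move: (cos _) (sin _) (cos _) (sin _) (xi / _) (G xi) => *; ring.
Qed.

End HilbertOdd.

Let lin2 (u v : R -> R) al ga : leb.-integrable setT (EFin \o u) ->
  leb.-integrable setT (EFin \o v) ->
  \int[leb]_s (al * u s + ga * v s) = al * \int[leb]_s u s + ga * \int[leb]_s v s.
Proof.
move=> ui vi; rewrite -!RintegralZl// -RintegralD//; exact: integrableRZl.
Qed.

(** The sine transform pi xi exp(- b |xi|) becomes - pi |xi| exp(- b |xi|), the cosine transform of
    [- cosI 0 1]. The two heights are treated together because d_2 d_1 D is such a combination. *)
Lemma hilbert_sinI01 al be ga de y s : 0 < be -> 0 < de ->
  hilbert (fun r => al * sinI 0 1 (r - y) be + ga * sinI 0 1 (r - y) de) s =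
  - (al * cosI 0 1 (s - y) be + ga * cosI 0 1 (s - y) de).
Proof.
move=> b0 d0.
pose g r := al * sinI 0 1 r be + ga * sinI 0 1 r de.
pose G xi := pi * xi * (al * expR (- (be * `|xi|)) + ga * expR (- (de * `|xi|))).
have bi := integrable_sinI01 b0; have di := integrable_sinI01 d0.
have gi : leb.-integrable setT (EFin \o g).
  by apply: integrableRD => //; exact: integrableRZl.
have godd r : g (- r) = - g r by rewrite /g !sinIN ?adm0//; move: (sinI _ _ _ _) (sinI _ _ _ _) => *; ring.
have trig (h k : R -> R) : measurable_fun setT h -> (forall r, `|h r| <= 1) ->
    \int[leb]_r (g r * h r) = al * \int[leb]_r (sinI 0 1 r be * h r) +
      ga * \int[leb]_r (sinI 0 1 r de * h r).
  move=> mh h1; have bhi := integrable_trig bi mh h1; have dhi := integrable_trig di mh h1.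
  rewrite -(lin2 al ga bhi dhi).
  by apply: eq_Rintegral => r _; rewrite /g mulrDl !mulrA.
have gcos xi : \int[leb]_r (g r * cos (r * xi)) = 0.
  rewrite trig//; [|mfun|by move=> r; exact: cos_max].
  by rewrite !sinI01_cos// !mulr0 addr0.
have gsin xi : \int[leb]_r (g r * sin (r * xi)) = G xi.
  rewrite trig//; [|mfun|by move=> r; exact: sin_max].
  by rewrite !sinI01_sin// /G; move: (expR _) (expR _) (@pi R) => *; ring.
rewrite -[LHS]/(hilbert (fun r => g (r - y)) s) (hilbert_odd y gi godd gcos gsin).
pose f b xi := `|xi| * expR (- (b * `|xi|)) * cos ((s - y) * xi).
have fE xi : - (xi / `|xi| * G xi * cos ((s - y) * xi)) =
    - pi * (al * f be xi + ga * f de xi).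
  rewrite /G /f; have -> : xi / `|xi| * (pi * xi * (al * expR (- (be * `|xi|)) +
      ga * expR (- (de * `|xi|)))) = pi * (`|xi| * (al * expR (- (be * `|xi|)) +
      ga * expR (- (de * `|xi|)))).
    have [->|x0] := eqVneq xi 0; first by rewrite normr0 !(mul0r, mulr0).
    rewrite -[X in _ = pi * (X * _)](mulfK (_ : `|xi| != 0)) ?normr_eq0//.
    by rewrite -normrM -expr2 ger0_norm ?sqr_ge0// expr2; move: (`|xi|^-1) (@pi R) => *; ring.
  by move: (`|xi|) (expR _) (expR _) (cos _) (@pi R) => *; ring.
have f_even b xi : f b (- xi) = f b xi by rewrite /f normrN mulrN cosN.
have fkap b xi : xi \in `[0, +oo[%classic -> f b xi = kap 0 1 b xi * cos ((s - y) * xi).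
  rewrite inE/= in_itv/= andbT => x0; rewrite /f /kap (ger0_norm x0) expr1 mul0r subr0.
  by [].
have fi b : 0 < b -> leb.-integrable setT (EFin \o f b).
  (* M bounds (u + u^3) exp(- b u), hence u exp(- b u) <= M / (1 + u^2). *)
  move=> bb; pose M : R := 1`!%:R / b ^+ 1 + 3`!%:R / b ^+ 3.
  have qi := @integrableRZl _ _ _ leb _ measurableT M _ (@integrable_qm R).
  apply: le_integrableR qi => //; first by rewrite /f; mfun.
  move=> xi _; rewrite /f normrM.
  apply: le_trans (ler_piMr (normr_ge0 _) (cos_max _)) _.
  rewrite ger0_norm ?mulr_ge0 ?expR_ge0// /qm.
  have q0 : 0 < 1 + xi ^+ 2 by rewrite ltr_pwDl ?sqr_ge0.
  rewrite -(real_normK (num_real xi)) in q0 *.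
  move: (`|xi|) (normr_ge0 xi) q0 => u u0 q0.
  rewrite ler_pdivlMr// expRN mulrAC ler_pdivrMr ?expR_gt0//.
  have h1 := pow_le_expR 1 bb u0; have h3 := pow_le_expR 3 bb u0.
  rewrite /M mulrDl; move: (lerD h1 h3).
  by rewrite expr1 mulrDr mulr1 -exprS.
have fI b : 0 < b -> \int[leb]_xi f b xi = 2 * cosI 0 1 (s - y) b.
  move=> bb; rewrite Rintegral_fold; last exact: fi.
  rewrite /cosI -RintegralZl//; last exact/integrable_kap_cos/adm0.
  by apply: eq_Rintegral => xi xi0; rewrite f_even fkap//; ring.
under eq_Rintegral do rewrite fE.
have fbi := fi _ b0; have fdi := fi _ d0.
rewrite RintegralZl//; last by apply: integrableRD => //; exact: integrableRZl.
rewrite (lin2 al ga fbi fdi) !fI//.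
move: (@pi R) (pi_gt0 R) (cosI _ _ _ _) (cosI _ _ _ _) => p p0 *; by field; rewrite gt_eqF.
Qed.

End HilbertPoisson.

(** * The kernel of the remainder term *)

Section Remainder.
Context {R : realType}.
Local Notation leb := (@lebesgue_measure R).
Variable t : R.
Hypothesis t0 : 0 < t.
Implicit Types (x y z : R * R) (s a : R).

Lemma partial00_Dfun z y : half_plane z -> half_plane y -> z.2 != y.2 ->
  partial 0 (partial 0 (Dfun ^~ y)) z =
  - (cosI 0 1 (z.1 - y.1) `|z.2 - y.2| - cosI 0 1 (z.1 - y.1) (z.2 + y.2)) / (2 * pi).
Proof.
move=> zH yH zy.
have b0 : 0 < `|z.2 - y.2| by rewrite normr_gt0 subr_eq0.
have c0 : 0 < z.2 + y.2 by exact: addr_gt0.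
have H : hasd (fun s => partial 0 (Dfun ^~ y) (s, z.2)) z.1
    (- (cosI 0 1 (z.1 - y.1) `|z.2 - y.2| - cosI 0 1 (z.1 - y.1) (z.2 + y.2)) / (2 * pi)).
  have -> : (fun s => partial 0 (Dfun ^~ y) (s, z.2)) =
      (fun s => - (sinI 0 0 (s - y.1) `|z.2 - y.2| - sinI 0 0 (s - y.1) (z.2 + y.2)) / (2 * pi)).
    apply/funext => s; rewrite mulNr -(@K2E _ (s, z.2) y)//.
    by rewrite -(partial0_Dfun (z := (s, z.2)))// opprK.
  eapply hasd_eq.
    apply: hasd_mul; last exact: hasd_cst.
    apply: hasd_opp; apply: hasd_add; last apply: hasd_opp.
      by apply: (@hasd_comp _ (fun r => sinI 0 0 r `|z.2 - y.2|)); [isd|exact/hasd_sinI_r/adm0].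
    by apply: (@hasd_comp _ (fun r => sinI 0 0 r (z.2 + y.2))); [isd|exact/hasd_sinI_r/adm0].
  by rewrite /=; move: (cosI _ _ _ _) (cosI _ _ _ _) (2 * pi) => *; ring.
by have [_ ->] := partial0_hasd H.
Qed.

Lemma partial10_Dfun z y : half_plane z -> half_plane y -> z.2 != y.2 ->
  partial 1 (partial 0 (Dfun ^~ y)) z =
  (Num.sg (z.2 - y.2) * sinI 0 1 (z.1 - y.1) `|z.2 - y.2|
   - sinI 0 1 (z.1 - y.1) (z.2 + y.2)) / (2 * pi).
Proof.
move=> zH yH zy.
have b0 : 0 < `|z.2 - y.2| by rewrite normr_gt0 subr_eq0.
have c0 : 0 < z.2 + y.2 by exact: addr_gt0.
have s1 : 0 < sqn (z.1 - y.1) (z.2 - y.2) by rewrite sqn_gt0// subr_eq0.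
have s2 : 0 < sqn (z.1 - y.1) (z.2 + y.2) by rewrite sqn_gt0// gt_eqF.
have z0 : 0 < z.2 := zH.
have H : hasd (fun a => partial 0 (Dfun ^~ y) (z.1, a)) z.2
    ((Num.sg (z.2 - y.2) * sinI 0 1 (z.1 - y.1) `|z.2 - y.2|
     - sinI 0 1 (z.1 - y.1) (z.2 + y.2)) / (2 * pi)).
  apply: (@hasd_near _ (fun a => - (((z.1 - y.1) / ((z.1 - y.1) ^+ 2 + (a - y.2) ^+ 2)
   - (z.1 - y.1) / ((z.1 - y.1) ^+ 2 + (a + y.2) ^+ 2)) / (2 * pi)))).
    near=> a; have aH : half_plane (z.1, a) by rewrite /half_plane/=; near: a; exact: lt_nbhsr.
    by rewrite -[RHS]opprK (partial0_Dfun aH yH).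
  eapply hasd_eq.
    isd; [exact: lt0r_neq0 s1|exact: lt0r_neq0 s2].
  rewrite !sinI01// real_normK ?num_real//.
  have -> : Num.sg (z.2 - y.2) * (2 * (z.1 - y.1) * `|z.2 - y.2| /
      ((z.1 - y.1) ^+ 2 + (z.2 - y.2) ^+ 2) ^+ 2) =
      2 * (z.1 - y.1) * (z.2 - y.2) / ((z.1 - y.1) ^+ 2 + (z.2 - y.2) ^+ 2) ^+ 2.
    by rewrite mulrA (mulrCA (Num.sg _)) -numEsg.
  rewrite /= -/(sqn (z.1 - y.1) (z.2 - y.2)) -/(sqn (z.1 - y.1) (z.2 + y.2)).
  move: (sqn _ _) (sqn _ _) s1 s2 (@pi R) (pi_gt0 R) => A B A0 B0 p p0.
  by field; rewrite !gt_eqF.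
by have [_ ->] := partial1_hasd H.
Unshelve. all: end_near. Qed.

Lemma HD_kerE z y : half_plane z -> half_plane y -> z.2 != y.2 ->
  HD_ker z y = if z.2 < y.2 then cosI 0 1 (z.1 - y.1) (y.2 - z.2) / pi else 0.
Proof.
move=> zH yH zy.
have b0 : 0 < `|z.2 - y.2| by rewrite normr_gt0 subr_eq0.
have c0 : 0 < z.2 + y.2 by exact: addr_gt0.
rewrite /HD_ker /hilbert1 partial00_Dfun//.
have -> : (fun s => partial 1 (partial 0 (Dfun ^~ y)) (s, z.2)) =
    (fun s => Num.sg (z.2 - y.2) / (2 * pi) * sinI 0 1 (s - y.1) `|z.2 - y.2|
      + - (2 * pi)^-1 * sinI 0 1 (s - y.1) (z.2 + y.2)).
  apply/funext => s; rewrite partial10_Dfun//=.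
  by move: (sinI _ _ _ _) (sinI _ _ _ _) (2 * pi) => *; ring.
rewrite hilbert_sinI01//; case: ifPn => [zly|].
  rewrite ltr0_sg ?subr_lt0// ltr0_norm ?subr_lt0// opprB.
  move: (cosI _ _ _ _) (cosI _ _ _ _) (@pi R) (pi_gt0 R) => A B p p0.
  by field; rewrite gt_eqF.
rewrite -leNgt => yz; have yz' : y.2 < z.2 by rewrite lt_neqAle eq_sym zy.
rewrite gtr0_sg ?subr_gt0//.
by move: (cosI _ _ _ _) (cosI _ _ _ _) (2 * pi) => *; ring.
Qed.

Lemma remainder_kerE x y : half_plane y -> remainder_ker t x y =
  2 / pi * \int[leb]_(a in `[0, y.2]) (Gamma0 (x.2 + a) t * cosI t 1 (x.1 - y.1) (y.2 - a)).
Proof.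
move=> yH; have y0 : 0 < y.2 := yH.
pose g1 a := 2 / pi * (Gamma0 (x.2 + a) t * cosI t 1 (x.1 - y.1) (y.2 - a)).
pose f a := \int[leb]_z1
  ((heatN_ker x (z1, a) t - heatD_ker x (z1, a) t) * HD_ker (z1, a) y).
have dg a : hasd (fun a => Gamma0 (x.2 + a) t * cosI t 1 (x.1 - y.1) (y.2 - a)) a
    (dGamma0 (x.2 + a) t * (0 + 1) * cosI t 1 (x.1 - y.1) (y.2 - a) +
     Gamma0 (x.2 + a) t * (- cosI t 2 (x.1 - y.1) (y.2 - a) * (0 - 1))).
  apply: hasd_mul.
    by apply: (@hasd_comp _ (fun r => Gamma0 r t)); [isd|exact: hasd_Gamma0].
  by apply: (@hasd_comp _ (fun a => cosI t 1 (x.1 - y.1) a)); [isd|exact: hasd_cosI_a].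
have cg : continuous (fun a => Gamma0 (x.2 + a) t * cosI t 1 (x.1 - y.1) (y.2 - a)).
  move=> a; eapply hasd_continuous; exact: dg.
have cg1 : continuous g1.
  by move=> a; eapply hasd_continuous; apply: hasd_mul; [exact: hasd_cst|exact: dg].
have gi := integrable_itv_cc 0 y.2 cg; have gi1 := integrable_itv_cc 0 y.2 cg1.
have hE (u a : R) : heatN_ker x (u, a) t - heatD_ker x (u, a) t =
    2 * Gamma0 (x.2 + a) t * Gamma0 (x.1 - u) t.
  by rewrite /heatN_ker /heatD_ker !GammaE//= opprK; ring.
have f1 a : 0 < a < y.2 -> f a = g1 a.
  move=> /andP[a0 ay]; have b0 : 0 < y.2 - a by rewrite subr_gt0.
  rewrite /f /g1 -(Gamma0_conv_cosI 1 x.1 y.1 t0 b0).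
  transitivity (\int[leb]_u (2 / pi * Gamma0 (x.2 + a) t *
      (Gamma0 (x.1 - u) t * cosI 0 1 (u - y.1) (y.2 - a)))).
    apply: eq_Rintegral => u _; rewrite hE HD_kerE//; last by rewrite lt_eqF.
    by rewrite /= ay; move: (Gamma0 _ _) (Gamma0 _ _) (cosI _ _ _ _) (pi^-1) => *; ring.
  rewrite RintegralZl ?mulrA//; apply: integrable_Gamma0_conv => //; last first.
    by have [M HM] := cosI0_bounded 1 b0; exists M => s; exact: HM.
  by apply: measurable_cosI; mfun.
have f2 a : y.2 < a -> f a = 0.
  move=> ya; rewrite /f; have a0 : 0 < a by exact: lt_trans ya.
  transitivity (\int[leb]_(_ in setT) (0 : R)); last by rewrite Rintegral_cst// mul0r.
  apply: eq_Rintegral => u _; rewrite HD_kerE//=; last by rewrite gt_eqF.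
  by rewrite ltNge (ltW ya)/= mulr0.
(* No formula for f is available at the singular height y_2. Its value there is carried by a
   separate function supported on that single point, so that f is pointwise a sum of two integrable
   functions. *)
have fi : leb.-integrable `]0, +oo[ (EFin \o f).
  have i1 : leb.-integrable setT (EFin \o (g1 \_ `[0, y.2[)).
    rewrite -restrict_EFin; apply: (iffLR (integrable_mkcond _ _)) => //.
    by apply: integrableS gi1 => //; exact: subset_itv_co_cc.
  have i2 : leb.-integrable setT (EFin \o ((cst (f y.2)) \_ [set y.2])).
    rewrite -restrict_EFin; apply: (iffLR (integrable_mkcond _ _)) => //.
    have := @integrable_itv_cc R (cst (f y.2)) y.2 y.2 (@cst_continuous _ _ _).
    by rewrite set_itv1.
  have i12 := integrableRD measurableT i1 i2.
  have : leb.-integrable `]0, +oo[ (EFin \o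
      (fun a => (g1 \_ `[0, y.2[) a + (cst (f y.2) \_ [set y.2]) a)).
    by apply: integrableS i12.
  apply: eq_integrable => // a; rewrite inE/= in_itv/= andbT => a0.
  congr EFin; rewrite !patchE (_ : (a \in `[0, y.2[%classic) = (a < y.2)); last first.
    by apply/idP/idP; rewrite inE/= in_itv/= (ltW a0).
  rewrite (_ : (a \in [set y.2]) = (a == y.2)); last first.
    by apply/idP/eqP; rewrite inE.
  case: (ltgtP a y.2) => ay.
  - by rewrite addr0 f1// a0.
  - by rewrite addr0 f2.
  - by rewrite add0r ay.
have [_] := Rintegral_split y0 cg1 (@cst_continuous _ _ (0 : R)) fi f1 f2.
rewrite /remainder_ker /heatNmD -/f => ->.
rewrite RintegralZl// Rintegral_cst// mul0r addr0//.
Qed.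

End Remainder.

(** * The boundary term and the second formula *)

Section SecondFormula.
Context {R : realType}.
Local Notation leb := (@lebesgue_measure R).
Variable t : R.
Hypothesis t0 : 0 < t.
Implicit Types (x y z : R * R).

(** At y_2 > 0 this is pi times the Poisson kernel P_{y_2} evolved by the one-dimensional heat flow,
    at the point x_1 - y_1. *)
Definition trace_ker x y : R := cosI t 0 (x.1 - y.1) y.2.

Lemma Wker_heatN x y : half_plane x -> half_plane y ->
  Wker x y t = heatN_ker x y t - remainder_ker t x y - 2 * Gamma0 x.2 t / pi * trace_ker x y.
Proof.
move=> xH yH; rewrite WkerE// /vorticity_ker remainder_kerE// /heatN_ker /trace_ker.
by congr (_ - _); rewrite mulrA mulrAC.
Qed.

Section FiniteMeasure.
Variable mu : {finite_measure set (R * R)%type -> \bar R}.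

Lemma integrable_bounded (f : R * R -> R) (M : R) : measurable_fun setT f ->
  (forall y, half_plane y -> `|f y| <= M) -> mu.-integrable half_plane (EFin \o f).
Proof.
move=> mf fM; have mH := @measurable_half_plane R.
have ci : mu.-integrable half_plane (EFin \o cst M)  by exact: finite_measure_integrable_cst.
by apply: le_integrableR ci => //; exact: measurable_funTS.
Qed.

Lemma integrable_heatN x : mu.-integrable half_plane (EFin \o (fun y => heatN_ker x y t)).
Proof.
apply: (@integrable_bounded _ (2 * (Gmax t * Gmax t))).
  rewrite (_ : (fun y => _) = (fun y => Gamma0 (x.1 - y.1) t * Gamma0 (x.2 - y.2) t +
    Gamma0 (x.1 - y.1) t * Gamma0 (x.2 + y.2) t)).
    by rewrite /Gamma0; mfun.
  by apply/funext => y; rewrite /heatN_ker !GammaE//= opprK.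
move=> y _; rewrite /heatN_ker !GammaE//=.
have G0 r : `|Gamma0 r t| <= Gmax t by rewrite ger0_norm ?Gamma0_ge0// Gamma0_le_max.
apply: le_trans (ler_normD _ _) _; rewrite (_ : 2 * _ = Gmax t * Gmax t + Gmax t * Gmax t); last ring.
by apply: lerD; rewrite normrM; exact: (ler_pM (normr_ge0 _) (normr_ge0 _) (G0 _) (G0 _)).
Qed.

Lemma trace_ker_bound x y : half_plane y ->
  `|trace_ker x y| <= \int[leb]_(xi in `[0, +oo[) kap t 0 0 xi.
Proof. by move=> yH; apply: normr_cosI_le0 => //; exact: ltW. Qed.

Lemma integrable_trace_ker x : mu.-integrable half_plane (EFin \o trace_ker x).
Proof.
apply: integrable_bounded; last exact: trace_ker_bound.
by rewrite /trace_ker; apply: measurable_cosI; mfun.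
Qed.

(** The Neumann and trace kernels are bounded in y and W is already integrable; the remainder kernel
    is their combination, which gives its integrability. *)
Lemma integrable_remainder x : half_plane x ->
  mu.-integrable half_plane (EFin \o remainder_ker t x) /\
  \int[mu]_(y in half_plane) Wker x y t =
    \int[mu]_(y in half_plane) heatN_ker x y t
    - \int[mu]_(y in half_plane) remainder_ker t x y
    - 2 * Gamma0 x.2 t / pi * \int[mu]_(y in half_plane) trace_ker x y.
Proof.
move=> xH; have mH := @measurable_half_plane R.
have hi := integrable_heatN x; have [wi _] := pair_int_vort t0 mu xH.
have ti := integrableRZl mH (2 * Gamma0 x.2 t / pi) (integrable_trace_ker x).
have ri : mu.-integrable half_plane (EFin \o remainder_ker t x).
  have := integrableRB mH (integrableRB mH hi wi) ti.
  apply: eq_integrable => // y; rewrite inE => yH /=; rewrite Wker_heatN//.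
  by congr EFin; move: (heatN_ker _ _ _) (remainder_ker _ _ _) (_ * trace_ker _ _) => *; ring.
split=> //; rewrite -(RintegralZl _ _ (integrable_trace_ker x))//.
have hri := integrableRB mH hi ri.
rewrite -(RintegralB mH hi ri) -(RintegralB mH hri ti).
by apply: eq_Rintegral => y; rewrite inE => yH; exact: Wker_heatN.
Qed.

Definition poisson_int s : R := \int[mu]_(y in half_plane) (y.2 / ((s - y.1) ^+ 2 + y.2 ^+ 2)).

(** The integrand is nonnegative, so Tonelli applies: for fixed y the s-integral is [trace_ker],
    bounded uniformly in y, and mu is finite. Points s where the Poisson integral diverges need no
    separate treatment. *)
Lemma poisson_int_heat (r : R) :
  leb.-integrable setT (EFin \o (fun s => Gamma0 (r - s) t * poisson_int s)) /\
  \int[leb]_s (Gamma0 (r - s) t * poisson_int s) =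
  \int[mu]_(y in half_plane) trace_ker (r, 0) y.
Proof.
have mH := @measurable_half_plane R.
pose k (s : R) y := y.2 / ((s - y.1) ^+ 2 + y.2 ^+ 2).
(* Cutting the kernel to zero below the boundary makes h nonnegative and measurable on the whole
   space. *)
pose h (p : R * (R * R)) := Gamma0 (r - p.1) t * (if 0 < p.2.2 then k p.1 p.2 else 0).
have mh : measurable_fun setT h by rewrite /h /k /Gamma0; mfun.
have h0 p : 0 <= h p.
  rewrite mulr_ge0 ?Gamma0_ge0//; case: ifPn => // p0.
  by rewrite divr_ge0 ?(ltW p0)// addr_ge0 ?sqr_ge0.
have hE y : half_plane y -> leb.-integrable setT (EFin \o (fun s => h (s, y))) /\
    \int[leb]_s h (s, y) = trace_ker (r, 0) y.
  rewrite /half_plane /= => y0.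
  have e s : h (s, y) = Gamma0 (r - s) t * cosI 0 0 (s - y.1) y.2.
    by rewrite /h /= y0 cosI00.
  split; last by under eq_Rintegral do rewrite e; rewrite Gamma0_conv_cosI.
  apply: (eq_integrable _ _ _ _ (_ : leb.-integrable setT (EFin \o
    (fun s => Gamma0 (r - s) t * cosI 0 0 (s - y.1) y.2)))) => //.
    by move=> s _; rewrite /= e.
  apply: integrable_Gamma0_conv => //; last first.
    by have [M HM] := cosI0_bounded 0 y0; exists M => s; exact: HM.
  by apply: measurable_cosI; mfun.
pose M := \int[leb]_(xi in `[0, +oo[) kap t 0 0 xi.
have hi : (leb \x mu)%E.-integrable setT (EFin \o h).
  apply/(integrable21ltyP leb mu); first exact/measurable_EFinP.
  apply: (@le_lt_trans _ _ (\int[mu]_y (`|M|)%:E)%E); last first.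
    by rewrite integral_cst// lte_mul_pinfty// ?lee_fin// ltey_eq fin_num_measure.
  apply: ge0_le_integral => //.
  - by move=> y _; apply: integral_ge0.
  - apply: (@measurable_fun_fubini_tonelli_G _ _ _ _ _ leb (fun p => `|(h p)%:E|)%E) => //.
    by apply: measurableT_comp => //; exact/measurable_EFinP.
  - move=> y _; under eq_integral do rewrite /= (ger0_norm (h0 _)).
    have [yH|yH] := pselect (half_plane y).
      have [hyi hyE] := hE _ yH.
      rewrite -(fineK (integrable_fin_num measurableT hyi)) lee_fin.
      rewrite -[leLHS]/(\int[leb]_s h (s, y)) hyE.
      by apply: le_trans (ler_norm _) _; apply: le_trans (trace_ker_bound _ yH) _; exact: ler_norm.
    rewrite integral0_eq ?lee_fin// => s _; rewrite /h /=.
    by move/negP/negbTE: yH; rewrite /half_plane /= => ->; rewrite mulr0.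
have hiH : (leb \x mu)%E.-integrable (setT `*` half_plane) (EFin \o h).
  by apply: integrableS hi => //; exact: measurableX.
have E s : \int[mu]_(y in half_plane) h (s, y) = Gamma0 (r - s) t * poisson_int s.
  rewrite /poisson_int -RintegralZl_meas//; last by apply: measurable_funTS; mfun.
  by apply: eq_Rintegral => y; rewrite inE => y0; rewrite /h /= (_ : 0 < y.2).
split.
  have : leb.-integrable setT (EFin \o (fun s => \int[mu]_(y in half_plane) h (s, y))).
    by apply: (@integrable_fubini1_on _ _ _ _ _ leb mu setT half_plane _ _ h).
  by apply: eq_integrable => // s _; rewrite /= E.
transitivity (\int[leb]_s \int[mu]_(y in half_plane) h (s, y)).
  by apply: eq_Rintegral => s _; rewrite E.
apply: etrans (@Rfubini_on _ _ _ _ _ leb mu setT half_plane measurableT mH h hiH) _.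
by apply: eq_Rintegral => y; rewrite inE => yH; have [_ ->] := hE _ yH.
Qed.

End FiniteMeasure.

End SecondFormula.

Theorem lemma3p3 (R : realType) (u0 : R * R -> R * R)
    (omega0 : {charge set (R * R)%type -> \bar R})
    (hu0 : lorentz2oo_sigma u0)
    (homega0 : closed_half_plane_measure omega0)
    (hcurl : is_vorticity u0 omega0)
    (t : R) (ht : 0 < t) (x : R * R) (hx : half_plane x) :
  (* the derivatives defining T(t) omega_0 (x) exist *)
  [/\ derivable (fst \o stokes t (biot_savart omega0)) x (evec 1) &
      derivable (snd \o stokes t (biot_savart omega0)) x (evec 0)] /\
  (* first formula, with absolute convergence *)
  (charge_integrable omega0 half_plane (fun y => Wker x y t) /\
   T_op t omega0 x = charge_int omega0 half_plane (fun y => Wker x y t)) /\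
  (* second formula, with absolute convergence *)
  [/\ charge_integrable omega0 half_plane (fun y => heatN_ker x y t),
      charge_integrable omega0 half_plane (remainder_ker t x),
      (@lebesgue_measure R).-integrable setT
        (fun s => (Gamma0 (x.1 - s) t * u1_trace omega0 s)%:E) &
      T_op t omega0 x =
        heatN_meas t omega0 x - remainder t omega0 x
        - 2 * Gamma0 x.2 t * heat1 t (u1_trace omega0) x.1].
Proof.
have [d1 d2 TE] := T_opE ht omega0 hx; split; first by split.
split; first by split => //; exact: charge_integrable_Wker.
(* The identities for finite positive measures are applied to the two Jordan variations and
   subtracted. *)
pose mp : {finite_measure set (R * R)%type -> \bar R} := jordan_pos (hahnP omega0).
pose mn : {finite_measure set (R * R)%type -> \bar R} := jordan_neg (hahnP omega0).
have [rp Wp] := integrable_remainder ht mp hx.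
have [rn Wn] := integrable_remainder ht mn hx.
have [pp Pp] := poisson_int_heat ht mp x.1.
have [pn Pn] := poisson_int_heat ht mn x.1.
have uE s : Gamma0 (x.1 - s) t * u1_trace omega0 s =
    pi^-1 * (Gamma0 (x.1 - s) t * poisson_int mp s - Gamma0 (x.1 - s) t * poisson_int mn s).
  rewrite /u1_trace /charge_int -/(poisson_int mp s) -/(poisson_int mn s).
  by rewrite -mulrBr mulrA mulrC.
have ppn := integrableRB measurableT pp pn.
split.
- by split; exact: integrable_heatN.
- by split.
- have := integrableRZl measurableT pi^-1 ppn.
  by apply: eq_integrable => // s _; rewrite /= uE.
- rewrite TE /charge_int -/mp -/mn Wp Wn /heat1.
  under [in RHS]eq_Rintegral do rewrite uE.
  rewrite RintegralZl// RintegralB// Pp Pn.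
  rewrite /heatN_meas /remainder /charge_int -/mp -/mn.
  (* [trace_ker] sees only the first coordinate of its first point, so (x.1, 0) may be replaced by
     x. *)
  rewrite -![trace_ker t (x.1, 0)]/(trace_ker t x).
  move: (Rintegral _ _ _) (Rintegral _ _ _) (Rintegral _ _ _) (Rintegral _ _ _)
    (Rintegral _ _ _) (Rintegral _ _ _) (pi^-1) (Gamma0 _ _) => *; ring.
Qed.
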